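(* Consider the thruster model with the HTC parameter values (both specified in the context), its straight motion equilibrium $(u,v,r,\psi)=(u_0,0,0,0)$, and its linearization matrix $A=M^{-1}J$. Define $$\varepsilon_\psi(\varepsilon_r) := -\frac{K_{02}\varepsilon_r^2+K_{01}\varepsilon_r+K_{00}}{K_{11}\varepsilon_r+K_{10}},$$ with the coefficients $K_{ij}$ given in the context, where $\varepsilon_r,\varepsilon_\psi$ are the control gains in the steering law $\eta=\varepsilon_r r+\varepsilon_\psi\psi$. Fix any $\underline{\varepsilon}_r,\underline{\varepsilon}_\psi\ge 0$, not both zero, and for $s\ge 0$ consider the control parameters on the ray $(\varepsilon_r,\varepsilon_\psi)=s\cdot(\underline{\varepsilon}_r,\underline{\varepsilon}_\psi)$. Then, as $s$ increases, the equilibrium $(u_0,0,0,0)$ is stabilized when $s\cdot(\underline{\varepsilon}_r,\underline{\varepsilon}_\psi)$ crosses the curve $\varepsilon_\psi=\varepsilon_\psi(\varepsilon_r)$. This crossing point lies at a unique $s^*>0$ for each fixed $(\underline{\varepsilon}_r,\underline{\varepsilon}_\psi)$. The eigenvalues of $A$ behave as follows: for $\underline{\varepsilon}_\psi>0$, a complex conjugate pair of eigenvalues traverses the imaginary axis as $s$ crosses $s^*$, while for $\underline{\varepsilon}_\psi=0$ one eigenvalue is fixed at zero and a real eigenvalue (simple as an eigenvalue of the 3D reduction $S$) traverses zero at $s=s^*$.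
   Context: **Thruster model.** For $(u,v,r,\psi)$ near $(u_0,0,0,0)$ with $u_0>0$, the system is $$M\begin{pmatrix}\dot u\\ \dot v\\ \dot r\\ \dot\psi\end{pmatrix}=\begin{pmatrix} m v r+X_H+\tau(u)\cos\eta\\ -m u r+Y_H+\tau(u)\sin\eta\\ N_H+x_T\tau(u)\sin\eta\\ r\end{pmatrix},\qquad M=\begin{pmatrix} m+m_{uu}&0&0&0\\0&m+m_{vv}&m_{vr}&0\\0&m_{rv}&I_z+m_{rr}&0\\0&0&0&1\end{pmatrix},$$ with steering law $\eta=\varepsilon_r r+\varepsilon_\psi\psi$, control gains $\varepsilon_r,\varepsilon_\psi\ge0$. With $V=\sqrt{u^2+v^2}$ the hull forces are $$X_H=X_{u|u|}u^2+X_{\beta\gamma}vr,$$ $$Y_H=Y_\beta uv+Y_\gamma ur+Y_{\beta|\beta|}v|v|+Y_{\gamma|\gamma|}r|r|+Y_{\beta|\gamma|}v|r|+Y_{|\beta|\gamma}|v|r+Y_{ab}u^3|v|vV^{-3},$$ $$N_H=N_\beta uv+N_\gamma ur+N_{u'\gamma c}u|r|rV^{-1}+N_{\gamma|\gamma|}r|r|+N_{\beta|\beta|}v|v|+N_{\beta\beta\gamma}rv^2V^{-1}+N_{\beta\gamma\gamma}vr^2V^{-1}+N_{ab}uv^3V^{-2}.$$ The propeller force is $\tau(u)=2(1-t)\frac{L_{pp}}{T}D_p^4\sum_{i=0}^5K_{Ti}\left(\frac{1-w}{D_p}u\right)^i$, with $D_p=\bar D_p/L_{pp}$ (propeller frequency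 normalized to 1). **HTC values.** $m=0.2328$, $I_z=0.0134$, $m_{uu}=0.0247$, $m_{vv}=0.2286$, $m_{rr}=0.0150$, $m_{vr}=m_{rv}=0.0074$; $X_{u|u|}=-0.0141$; $Y_\beta=-0.1735$, $Y_\gamma=0.0338$, $Y_{\beta|\beta|}=-1.1378$, $Y_{\gamma|\gamma|}=0.0123$, $Y_{\beta|\gamma|}=-0.0537$, $Y_{|\beta|\gamma}=0.1251$; $N_\beta=-0.1442$, $N_\gamma=-0.0276$, $N_{\beta|\beta|}=-0.0375$, $N_{\gamma|\gamma|}=-0.0386$; $\bar D_p=6.105$, $L_{pp}=153.70$, $T=10.30$, $t=0.22$, $w=0.38$; $K_{T0}=0.366897$, $K_{T1}=-0.345036$, $K_{T2}=0.068841$, $K_{T3}=-0.710991$, $K_{T4}=0.948559$, $K_{T5}=-0.428915$; $x_T=-0.49429$. The remaining coefficients $X_{\beta\gamma},Y_{ab},N_{u'\gamma c},N_{\beta\beta\gamma},N_{\beta\gamma\gamma},N_{ab}$ are real constants (they do not enter the linearization). **Straight motion.** $u_0>0$ is the unique positive solution of $X_{u|u|}u_0^2+\tau(u_0)=0$ ($u_0\approx0.03$); $(u_0,0,0,0)$ is then an equilibrium for all $\varepsilon_r,\varepsilon_\psi$. **Linearization.** $A=M^{-1}J$ with $$J=\begin{pmatrix}2X_{u|u|}u_0+\partial_u\tau(u_0)&0&0&0\\0&Y_\beta u_0&(Y_\gamma-m)u_0+\tau(u_0)\varepsilon_r&\tau(u_0)\varepsilon_\psi\\0&N_\beta u_0&N_\gamma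 u_0+x_T\tau(u_0)\varepsilon_r&x_T\tau(u_0)\varepsilon_\psi\\0&0&1&0\end{pmatrix}.$$ $S$ denotes the upper left $3\times3$ submatrix of $A$ (the 3D reduction to $(u,v,r)$, used when $\varepsilon_\psi=0$). **Stabilized** means: the equilibrium is exponentially asymptotically stable, up to the symmetry in $\psi$ when $\varepsilon_\psi=0$; equivalently, all eigenvalues of $A$ (if $\varepsilon_\psi>0$), respectively of $S$ (if $\varepsilon_\psi=0$), have strictly negative real part. **Coefficients.** With $D=(m+m_{vv})(I_z+m_{rr})-m_{rv}m_{vr}$ set $p_{22u}=D^{-1}((I_z+m_{rr})Y_\beta-m_{vr}N_\beta)$, $p_{32u}=D^{-1}(-m_{rv}Y_\beta+(m+m_{vv})N_\beta)$, $p_{23u}=D^{-1}((I_z+m_{rr})(Y_\gamma-m)-m_{vr}N_\gamma)$, $p_{33u}=D^{-1}(-m_{rv}(Y_\gamma-m)+(m+m_{vv})N_\gamma)$, $q_{23}=D^{-1}(I_z+m_{rr}-m_{vr}x_T)$, $q_{33}=D^{-1}(-m_{rv}+(m+m_{vv})x_T)$, and $$K_{11}=q_{33}^2\tau(u_0)^2,\qquad K_{02}=q_{33}(p_{32u}q_{23}-p_{22u}q_{33})u_0\tau(u_0)^2,$$ $$K_{01}=[(p_{22u}+p_{33u})(p_{32u}q_{23}-p_{22u}q_{33})+q_{33}(p_{23u}p_{32u}-p_{22u}p_{33u})]u_0^2\tau(u_0),$$ $$K_{10}=[(p_{22u}+p_{33u})q_{33}+p_{32u}q_{23}-p_{22u}q_{33}]u_0\tau(u_0),$$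 $$K_{00}=(p_{22u}+p_{33u})(p_{23u}p_{32u}-p_{22u}p_{33u})u_0^3.$$ *)

(* Defs.v *)
(* MathComp / MathComp-Analysis, over an arbitrary [R : realType]. *)
From mathcomp Require Import all_boot all_order all_algebra.
From mathcomp Require Import all_classical all_reals all_analysis.
From mathcomp Require Import complex.

Set Implicit Arguments.
Unset Strict Implicit.
Unset Printing Implicit Defensive.

Import Order.TTheory GRing.Theory Num.Theory.
Import numFieldNormedType.Exports.
Local Open Scope ring_scope.

Definition col_of {R : realType} {n : nat} (s : seq R) : 'cV[R]_n :=
  \col_(i < n) s`_i.

Definition mx_of {R : realType} {m n : nat} (rows : seq (seq R)) : 'M[R]_(m, n) :=
  \matrix_(i < m, j < n) (nth [::] rows i)`_j.

(* The model coefficients whose value is left arbitrary: X_{beta gamma}, Y_{ab},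
   N_{u' gamma c}, N_{beta beta gamma}, N_{beta gamma gamma}, N_{ab}. *)
Record free_coeffs (R : realType) := FreeCoeffs {
  X_bg : R; Y_ab : R; N_ugc : R; N_bbg : R; N_bgg : R; N_ab : R }.

Section ThrusterHTC.
Variable R : realType.

(* In coefficient names b = beta, g = gamma, u = u, and underscores around an
   index letter stand for absolute-value bars: Y_b_b_ is Y_{beta|beta|}, Y__b_g is
   Y_{|beta|gamma}. Long decimals are split because ring numerals are unary: for
   instance 0.366897 is 366 / 10 ^+ 3 + 897 / 10 ^+ 6. *)
Definition m_ship : R := 2328 / 10 ^+ 4.
Definition I_z : R := 134 / 10 ^+ 4.
Definition m_uu : R := 247 / 10 ^+ 4.
Definition m_vv : R := 2286 / 10 ^+ 4.
Definition m_rr : R := 150 / 10 ^+ 4.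
Definition m_vr : R := 74 / 10 ^+ 4.
Definition m_rv : R := 74 / 10 ^+ 4.

Definition X_u_u_ : R := - (141 / 10 ^+ 4).

Definition Y_b : R := - (1735 / 10 ^+ 4).
Definition Y_g : R := 338 / 10 ^+ 4.
Definition Y_b_b_ : R := - (1 + 1378 / 10 ^+ 4).
Definition Y_g_g_ : R := 123 / 10 ^+ 4.
Definition Y_b_g_ : R := - (537 / 10 ^+ 4).
Definition Y__b_g : R := 1251 / 10 ^+ 4.

Definition N_b : R := - (1442 / 10 ^+ 4).
Definition N_g : R := - (276 / 10 ^+ 4).
Definition N_b_b_ : R := - (375 / 10 ^+ 4).
Definition N_g_g_ : R := - (386 / 10 ^+ 4).

Definition D_p_bar : R := 6105 / 10 ^+ 3.
Definition L_pp : R := 1537 / 10.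
Definition T_draft : R := 103 / 10.
Definition t_ded : R := 22 / 10 ^+ 2.
Definition w_wake : R := 38 / 10 ^+ 2.
Definition x_T : R := - (494 / 10 ^+ 3 + 290 / 10 ^+ 6).

Definition K_T (i : 'I_6) : R :=
  [:: 366 / 10 ^+ 3 + 897 / 10 ^+ 6;
      - (345 / 10 ^+ 3 + 36 / 10 ^+ 6);
      68 / 10 ^+ 3 + 841 / 10 ^+ 6;
      - (710 / 10 ^+ 3 + 991 / 10 ^+ 6);
      948 / 10 ^+ 3 + 559 / 10 ^+ 6;
      - (428 / 10 ^+ 3 + 915 / 10 ^+ 6)]`_i.

Definition D_p : R := D_p_bar / L_pp.

Definition tau (u : R) : R :=
  2 * (1 - t_ded) * (L_pp / T_draft) * D_p ^+ 4 *
  \sum_(i < 6) K_T i * ((1 - w_wake) / D_p * u) ^+ i.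

Definition mass_mx : 'M[R]_4 := mx_of
  [:: [:: m_ship + m_uu; 0; 0; 0];
      [:: 0; m_ship + m_vv; m_vr; 0];
      [:: 0; m_rv; I_z + m_rr; 0];
      [:: 0; 0; 0; 1]].

Section Dynamics.
Variable c : free_coeffs R.

Definition speed (u v : R) : R := Num.sqrt (u ^+ 2 + v ^+ 2).

Definition X_H (u v r : R) : R := X_u_u_ * u ^+ 2 + X_bg c * v * r.

Definition Y_H (u v r : R) : R :=
  Y_b * u * v + Y_g * u * r + Y_b_b_ * v * `|v| + Y_g_g_ * r * `|r|
  + Y_b_g_ * v * `|r| + Y__b_g * `|v| * r
  + Y_ab c * u ^+ 3 * `|v| * v * speed u v ^- 3.

Definition N_H (u v r : R) : R :=
  N_b * u * v + N_g * u * r + N_ugc c * u * `|r| * r * (speed u v)^-1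
  + N_g_g_ * r * `|r| + N_b_b_ * v * `|v|
  + N_bbg c * r * v ^+ 2 * (speed u v)^-1
  + N_bgg c * v * r ^+ 2 * (speed u v)^-1
  + N_ab c * u * v ^+ 3 * speed u v ^- 2.

(* States are the columns (u, v, r, psi). *)
Definition force (er ep : R) (x : 'cV[R]_4) : 'cV[R]_4 :=
  let u := x (inord 0) 0 in let v := x (inord 1) 0 in
  let r := x (inord 2) 0 in let psi := x (inord 3) 0 in
  let eta := er * r + ep * psi in
  col_of [:: m_ship * v * r + X_H u v r + tau u * cos eta;
             - (m_ship * u * r) + Y_H u v r + tau u * sin eta;
             N_H u v r + x_T * tau u * sin eta;
             r].

(* Forward solutions. Requiring a two-sided derivative at time 0 is harmless: a
   solution on [0, +oo[ extends affinely to negative times, where nothing is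
   required. *)
Definition solution (er ep : R) (x : R -> 'cV[R]_4) : Prop :=
  forall t : R, 0 <= t ->
    derivable x t 1 /\ mass_mx *m derive1 x t = force er ep (x t).

Definition equilibrium (u0 : R) : 'cV[R]_4 := col_of [:: u0; 0; 0; 0].

(* Distance to the equilibrium. For ep = 0 the system is invariant under shifts of
   psi, and the distance is to the group orbit {(u0, 0, 0, psi)}, i.e. it only
   sees (u, v, r). *)
Definition deviation (u0 ep : R) (x : 'cV[R]_4) : R :=
  if ep == 0 then `|usubmx (x - equilibrium u0 : 'cV[R]_(3 + 1))|
  else `|x - equilibrium u0|.

(* Exponential asymptotic stability, up to the symmetry in psi when ep = 0. *)
Definition stabilized (u0 er ep : R) : Prop :=
  exists delta C kappa : R, [/\ 0 < delta, 0 < C, 0 < kappa &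
    forall x0 : 'cV[R]_4, deviation u0 ep x0 < delta ->
      (exists x, solution er ep x /\ x 0 = x0) /\
      (forall x, solution er ep x -> x 0 = x0 -> forall t : R, 0 <= t ->
        deviation u0 ep (x t) <= C * expR (- kappa * t) * deviation u0 ep x0)].

End Dynamics.

Definition straight_speed (u0 : R) : Prop :=
  0 < u0 /\ X_u_u_ * u0 ^+ 2 + tau u0 = 0.

Section Linearization.
Variables (u0 er ep : R).

Definition J_mx : 'M[R]_4 := mx_of
  [:: [:: 2 * X_u_u_ * u0 + derive1 tau u0; 0; 0; 0];
      [:: 0; Y_b * u0; (Y_g - m_ship) * u0 + tau u0 * er; tau u0 * ep];
      [:: 0; N_b * u0; N_g * u0 + x_T * tau u0 * er; x_T * tau u0 * ep];
      [:: 0; 0; 1; 0]].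

Definition A_mx : 'M[R]_4 := invmx mass_mx *m J_mx.

Definition S_mx : 'M[R]_3 := ulsubmx (A_mx : 'M[R]_(3 + 1, 3 + 1)).

Definition A_eigenvalue (z : R[i]) : bool :=
  eigenvalue (map_mx (real_complex R) A_mx) z.

End Linearization.

Definition D_det : R := (m_ship + m_vv) * (I_z + m_rr) - m_rv * m_vr.
Definition p22u : R := D_det^-1 * ((I_z + m_rr) * Y_b - m_vr * N_b).
Definition p32u : R := D_det^-1 * (- m_rv * Y_b + (m_ship + m_vv) * N_b).
Definition p23u : R := D_det^-1 * ((I_z + m_rr) * (Y_g - m_ship) - m_vr * N_g).
Definition p33u : R :=
  D_det^-1 * (- m_rv * (Y_g - m_ship) + (m_ship + m_vv) * N_g).
Definition q23 : R := D_det^-1 * (I_z + m_rr - m_vr * x_T).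
Definition q33 : R := D_det^-1 * (- m_rv + (m_ship + m_vv) * x_T).

Section Curve.
Variable u0 : R.

Definition K11 : R := q33 ^+ 2 * tau u0 ^+ 2.
Definition K02 : R := q33 * (p32u * q23 - p22u * q33) * u0 * tau u0 ^+ 2.
Definition K01 : R :=
  ((p22u + p33u) * (p32u * q23 - p22u * q33)
   + q33 * (p23u * p32u - p22u * p33u)) * u0 ^+ 2 * tau u0.
Definition K10 : R :=
  ((p22u + p33u) * q33 + p32u * q23 - p22u * q33) * u0 * tau u0.
Definition K00 : R :=
  (p22u + p33u) * (p23u * p32u - p22u * p33u) * u0 ^+ 3.

Definition eps_psi (er : R) : R :=
  - ((K02 * er ^+ 2 + K01 * er + K00) / (K11 * er + K10)).

Definition on_curve (er ep : R) : Prop :=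
  K11 * er + K10 != 0 /\ ep = eps_psi er.

End Curve.

(* [f] is continuous and changes from positive to negative at [sc], within the
   window of radius [rho] around [sc]. *)
Definition traverses_zero (f : R -> R) (sc rho : R) : Prop :=
  forall s, `|s - sc| < rho ->
    {for s, continuous f} /\ Num.sg (f s) = Num.sg (sc - s).

End ThrusterHTC.

(* Main.v *)
Require Import Defs.
From mathcomp Require Import all_boot all_order all_algebra.
From mathcomp Require Import all_classical all_reals all_analysis.
From mathcomp Require Import complex.
From mathcomp Require Import ring lra.

(* The surge equation decouples linearly, with negative eigenvalue because the
   propeller polynomial is decreasing.  The remaining 3 x 3 block has the cubic
   X^3 + a2 X^2 + a1 X + a0 with a2 > 0 and a0 >= 0, and its Routh-Hurwitz
   determinant a2 a1 - a0 equals (K11 er + K10) ep + K02 er^2 + K01 er + K00.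
   Along a ray this is a quadratic in s, negative at 0 and with nonnegative
   leading coefficient, so that it has exactly one sign change on s > 0.

   In the coordinates x1 = psi, x2 = r, x3 = x2' + b3 x1 the block takes Schwarz
   form x1' = x2, x2' = - b3 x1 + x3, x3' = - b2 x2 - b1 x3 with b1 = a2,
   b3 = a0 / a2 and b2 = a1 - a0 / a2.  If b2 > 0, a small perturbation of the
   form b2 b3 x1^2 + b2 x2^2 + x3^2 is a strict Lyapunov function for the
   nonlinear system, whose nonlinearity is quadratically small; solutions exist
   by Picard iteration for the field composed with a clamping map.  If b2 <= 0,
   some quadratic form Q is positive somewhere and nondecreasing under the
   linear flow; exponential decay x(t) = O(|x(0)| exp(-k t)) would then give
   Q(x(0)) = O(|x(0)|^3), which is absurd. *)

Set Implicit Arguments.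
Unset Strict Implicit.
Unset Printing Implicit Defensive.

Import Order.TTheory GRing.Theory Num.Theory.
Import numFieldNormedType.Exports.
Local Open Scope ring_scope.

(** * Real analysis and Picard iteration *)

Section Calculus.
Variable R : realType.
Implicit Types (f g df dg : R -> R) (a b c t s : R).

(** Stability is a property of solutions of the nonlinear system, whose hull forces contain absolute
    values and negative powers of the speed. Both directions are therefore direct estimates in
    explicit coordinates, without a linearized stability theorem. At the crossing the linearization
    has eigenvalues on the imaginary axis and says nothing about instability; what is refuted there
    is the exponential rate. Orders decide: from a start of size d the form has value of order d^2,
    while the remainder, integrated along a decaying solution, contributes only order d^3.

    For ep = 0 the deviation does not see psi, and b3 = 0. The coordinate x1 is then 0 and its
    equation becomes x1' = sg x2 with sg = 0, under the relations sg x1 = x1 and b3 sg = b3; one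
    computation serves both cases.

    The numerical data enter through signs only. Powers of u0 and tau u0 are positive factors of the
    coefficients K, so that u0 itself is never located. *)

Lemma is_derive_continuous f t d : is_derive t 1 f d -> {for t, continuous f}.
Proof. by case=> dft _; exact/differentiable_continuous/derivable1_diffP. Qed.

Lemma le_of_derive f g df dg a b : a <= b ->
  (forall t, a <= t <= b -> is_derive t 1 f (df t)) ->
  (forall t, a <= t <= b -> is_derive t 1 g (dg t)) ->
  (forall t, a < t < b -> df t <= dg t) ->
  f a <= g a -> f b <= g b.
Proof.
rewrite le_eqVlt => /predU1P[->//|ab] Df Dg dfg fga.
have DD t : a <= t <= b -> is_derive t 1 (g - f) (dg t - df t).
  by move=> tab; apply: is_deriveB; [exact: Dg|exact: Df].
have [||z] := @MVT R (g - f) (fun t => dg t - df t) a b ab.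
- by move=> t; rewrite in_itv/= => /andP[at_ tb]; apply: DD; rewrite !ltW.
- apply: derivable_within_continuous => t; rewrite in_itv/= => tab.
  by have [] := DD t tab.
rewrite in_itv/= => zab E; have : 0 <= (g - f) b - (g - f) a.
  by rewrite E mulr_ge0 ?subr_ge0 ?dfg// ltW.
rewrite [(g - f) b](_ : _ = g b - f b)// [(g - f) a](_ : _ = g a - f a)//.
lra.
Qed.

(** Majorizing the derivative replaces the estimation of integrals in the Picard iteration and in
    the bounds for sine and cosine. *)
Lemma norm_le_of_derive f g df dg a b : a <= b ->
  (forall t, a <= t <= b -> is_derive t 1 f (df t)) ->
  (forall t, a <= t <= b -> is_derive t 1 g (dg t)) ->
  (forall t, a <= t <= b -> `|df t| <= dg t) ->
  `|f a| <= g a -> `|f b| <= g b.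
Proof.
move=> ab Df Dg dfg; rewrite !ler_norml => /andP[l u].
have dfg' t : a < t < b -> `|df t| <= dg t.
  by move=> /andP[at_ tb]; apply: dfg; rewrite !ltW.
apply/andP; split; last first.
  apply: (le_of_derive ab Df Dg _ u) => t tab.
  exact: le_trans (ler_norm _) (dfg' t tab).
rewrite lerNl; apply: (@le_of_derive (- f) g (- df) dg a b) => //.
- by move=> t tab; apply: is_deriveN; exact: Df.
- by move=> t tab; rewrite (le_trans (ler_norm _))// normrN dfg'.
- by rewrite -[(- f) a]/(- f a) lerNl.
Qed.

(** Integration starts at -1, so that every [t >= 0], 0 included, is an interior point and the
    derivative there is two-sided. *)
Lemma continuous_primitive g c : continuous g ->
  exists2 G : R -> R, G 0 = c & forall t, 0 <= t -> is_derive t 1 G (g t).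
Proof.
move=> cg; set mu := @lebesgue_measure R.
pose F x := (\int[mu]_(t in [set` `[-1 : R, x]]) g t)%R.
exists (fun t => F t + (c - F 0)); first by lra.
move=> t t0.
have [||||dF F'] := @continuous_FTC1_closed R g (-1) t (t + 1).
- by lra.
- apply: continuous_compact_integrable; first exact: segment_compact.
  exact: continuous_subspaceT.
- by lra.
- exact: cg.
rewrite -[g t]addr0; apply: (@is_deriveD _ _ _ F (cst (c - F 0))).
by rewrite -F' derive1E; exact/derivableP.
Qed.

(* The limit is the supremum of the increasing sequence [u k - 2 C / 2 ^ k]. *)
Lemma geometric_cauchy (u : nat -> R) (C : R) : 0 <= C ->
  (forall k, `|u k.+1 - u k| <= C / 2 ^+ k) ->
  exists l, forall k, `|u k - l| <= 2 * C / 2 ^+ k.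
Proof.
move=> C0 hu.
have hs k : C / 2 ^+ k = 2 * C / 2 ^+ k.+1.
  by rewrite exprS; field; rewrite expf_neq0.
(* The intervals of radius [2 * C / 2 ^+ k] around [u k] are nested. *)
have mono k m : u k - 2 * C / 2 ^+ k <= u (k + m)%N - 2 * C / 2 ^+ (k + m) /\
    u (k + m)%N + 2 * C / 2 ^+ (k + m) <= u k + 2 * C / 2 ^+ k.
  elim: m => [|m [h1 h2]]; first by rewrite addn0.
  have := hu (k + m)%N; rewrite addnS ler_norml => /andP[].
  have := hs (k + m)%N; move: h1 h2; rewrite -!mulrA.
  set x := C / _; set y := C / 2 ^+ (k+m).+1; lra.
have bnd k m : u k - 2 * C / 2 ^+ k <= u m + 2 * C / 2 ^+ m.
  have p n : 0 <= 2 * C / 2 ^+ n by rewrite divr_ge0 ?mulr_ge0.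
  have [km|/ltnW mk] := leqP k m.
    have [h _] := mono k (m - k)%N; move: h; rewrite subnKC//.
    by have := p m; lra.
  have [_ h] := mono m (k - m)%N; move: h; rewrite subnKC//.
  by have := p k; lra.
pose A := [set u k - 2 * C / 2 ^+ k | k in setT]%classic.
have A0 : (A !=set0)%classic by exists (u 0%N - 2 * C / 2 ^+ 0), 0%N.
exists (sup A) => k; rewrite ler_norml; apply/andP; split.
  have : sup A <= u k + 2 * C / 2 ^+ k.
    by apply: ge_sup => // _ [m _ <-]; exact: bnd.
  by lra.
have : u k - 2 * C / 2 ^+ k <= sup A.
  apply: ub_le_sup; last by exists k.
  by exists (u 0%N + 2 * C / 2 ^+ 0) => _ [m _ <-]; exact: bnd.
by lra.
Qed.

Lemma lipschitz_at_continuous g t rho L : 0 < rho ->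
  (forall s, `|s - t| < rho -> `|g s - g t| <= L * `|s - t|) ->
  {for t, continuous g}.
Proof.
move=> rho0 gL; apply/cvgrPdist_le => e e0.
have L0 : 0 < `|L| + 1 by rewrite ltr_wpDl.
have d0 : 0 < Num.min rho (e / (`|L| + 1)) by rewrite lt_min rho0 divr_gt0.
apply/nbhs_ballP; exists (Num.min rho (e / (`|L| + 1))) => //= s.
rewrite /ball/= distrC lt_min => /andP[srho se].
rewrite distrC (le_trans (gL _ srho))//.
rewrite (@le_trans _ _ ((`|L| + 1) * `|s - t|))//.
  by rewrite ler_wpM2r// (le_trans (ler_norm _))// lerDl.
by rewrite -ler_pdivlMl// mulrC ltW.
Qed.

Lemma le_of_geometric_error a b c : (forall k, a <= b + c / 2 ^+ k) -> a <= b.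
Proof.
move=> h; rewrite leNgt; apply/negP => ba.
have c0 : 0 < c by have := h 0%N; rewrite expr0 divr1; lra.
have [k hk] : exists k, c / (a - b) < 2 ^+ k.
  exists (Num.bound (c / (a - b))); apply: (lt_le_trans (archi_boundP _)).
    by rewrite divr_ge0 ?subr_ge0 ?ltW.
  by rewrite -natrX ler_nat ltnW// ltn_expl.
have := h k; rewrite leNgt => /negP; apply.
rewrite -ltrBrDl ltr_pdivrMr ?exprn_gt0//.
by rewrite mulrC -ltr_pdivrMr// subr_gt0.
Qed.

Section Picard.
Variables (n : nat) (F : ('I_n -> R) -> 'I_n -> R) (L B : R) (x0 : 'I_n -> R).
Hypothesis L_gt0 : 0 < L.
Hypothesis F_lipschitz : forall (x y : 'I_n -> R) (M : R), (forall i, `|x i - y i| <= M) ->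
  forall i, `|F x i - F y i| <= L * M.
Hypothesis F_bounded : forall x i, `|F x i| <= B.

(** Since [F] is bounded by [B], every Picard iterate has this modulus of continuity, which keeps
    [F] continuous along it. *)
Let lip (x : 'I_n -> R -> R) := forall i (s t : R), 0 <= s -> 0 <= t ->
  `|x i s - x i t| <= B * `|s - t|.

Let step (x y : 'I_n -> R -> R) := (forall i, y i 0 = x0 i) /\
  forall t i, 0 <= t -> is_derive t 1 (y i) (F (x^~ t) i).

Let step_lip x y : step x y -> lip y.
Proof.
move=> [_ Dy] i s t; wlog st : s t / s <= t => [hw s0 t0|s0 t0].
  have [/hw|/ltW/hw] := leP s t; first exact.
  by rewrite distrC [`|s - t|]distrC; apply.
rewrite [`|s - t|]ler0_norm ?subr_le0// opprB distrC.
apply: (@norm_le_of_derive (fun t => y i t - y i s) (fun t => B * (t - s))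
  (fun t => F (x^~ t) i) (fun=> B) s t) => //.
- move=> r /andP[sr _]; rewrite -[F _ _]subr0.
  apply: (@is_deriveB _ _ _ (y i) (cst (y i s))).
  by apply: Dy; exact: le_trans sr.
- move=> r _; have -> : (fun t => B * (t - s)) = B \*: (id - cst s) by [].
  by apply: is_derive_eq; rewrite subr0 /GRing.scale/= mulr1.
- by rewrite subrr normr0 subrr mulr0.
Qed.

Let step_ex x : lip x -> exists y, step x y.
Proof.
(* A primitive is taken of a function continuous on the whole line, but [x] is controlled for
   nonnegative times only; [p] freezes it before time 0. *)
move=> xlip; pose p (t : R) := Num.max t 0.
have p0 t : 0 <= p t by rewrite le_max lexx orbT.
have pp s t : `|p s - p t| <= `|s - t|.
  rewrite /p; case: (leP s 0) => s0; case: (leP t 0) => t0; rewrite ?subrr ?normr0//.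
  - by rewrite !ler0_norm; lra.
  - by rewrite !ger0_norm; lra.
have cF i : continuous (fun t => F (fun j => x j (p t)) i).
  move=> t; apply: (@lipschitz_at_continuous _ _ 1 (L * B)) => // s _.
  rewrite -mulrA; apply: F_lipschitz => j.
  apply: le_trans (xlip _ _ _ (p0 _) (p0 _)) _.
  apply: ler_wpM2l => //.
  have := F_bounded x0 j; exact: le_trans.
have /choice[y hy] : forall i, exists G : R -> R, G 0 = x0 i /\
    forall t, 0 <= t -> is_derive t 1 G (F (fun j => x j (p t)) i).
  by move=> i; have [G ? ?] := continuous_primitive (x0 i) (cF i); exists G.
exists y; split=> [i|t i t0]; first by have [] := hy i.
have [_ /(_ t t0)] := hy i; suff -> : p t = t by [].
by rewrite /p; case: leP => // t0'; apply/eqP; rewrite eq_le t0.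
Qed.

Lemma picard_existence : exists x : 'I_n -> R -> R, (forall i, x i 0 = x0 i) /\
  forall t i, 0 <= t -> is_derive t 1 (x i) (F (x^~ t) i).
Proof.
(* Without an index [0 <= B] cannot be read off from the bound on [F], but then there is no equation
   to solve. *)
case: (pselect (exists i : 'I_n, True)) => [[i0 _]|ni]; last first.
  by exists (fun i _ => x0 i); split=> [//|t i]; case: ni; exists i.
have B0 : 0 <= B := le_trans (normr_ge0 _) (F_bounded x0 i0).
pose X := {x : 'I_n -> R -> R | lip x}.
have /choice[next nextP] : forall x : X, exists y : X, step (sval x) (sval y).
  move=> [x xlip]; have [y xy] := step_ex xlip.
  by exists (exist _ y (step_lip xy)).
have lip0 : lip (fun i _ => x0 i).
  by move=> i s t _ _; rewrite subrr normr0 mulr_ge0.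
pose u (k : nat) : 'I_n -> R -> R := sval (iter k next (exist _ _ lip0)).
have ulip k : lip (u k) by rewrite /u; exact: svalP.
have uS k : step (u k) (u k.+1) by rewrite /u iterS; exact: nextP.
(* Exponentially weighted norm: with rate [2 * L] one Picard step halves the weighted distance on
   all of the half-line, so no gluing of short time intervals occurs. *)
pose E t := expR (2 * L * t); pose C := B / (2 * L).
have LL : 2 * L > 0 by rewrite mulr_gt0.
have C0 : 0 <= C by rewrite divr_ge0// ltW.
have DE c t : is_derive t 1 (fun t => c * E t) (L * (2 * c * E t)).
  have -> : (fun t => c * E t) = c \*: (expR \o (2 * L \*: id)) by [].
  by apply: is_derive_eq; rewrite /GRing.scale/= /E; ring.
have E0 : E 0 = 1 by rewrite /E mulr0 expR0.
have u_near k i t : 0 <= t -> `|u k.+1 i t - u k i t| <= C * E t / 2 ^+ k.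
  elim: k i t => [|k IH] i t t0.
    have [u10 Du1] := uS 0%N.
    have := step_lip (uS 0%N) i t0 (lexx 0).
    rewrite u10 subr0 [`|t|]ger0_norm// => /le_trans; apply.
    rewrite expr0 divr1 /C mulrAC ler_pdivlMr// -mulrA ler_wpM2l//.
    by rewrite mulrC (le_trans _ (expR_ge1Dx _))// lerDr.
  have [a0 Da] := uS k; have [b0 Db] := uS k.+1.
  have -> : C * E t / 2 ^+ k.+1 = C / 2 ^+ k.+1 * E t by rewrite mulrAC.
  apply: (@norm_le_of_derive (u k.+2 i - u k.+1 i)
    (fun t => C / 2 ^+ k.+1 * E t)
    (fun t => F ((u k.+1)^~ t) i - F ((u k)^~ t) i)
    (fun t => L * (2 * (C / 2 ^+ k.+1) * E t)) 0 t) => //.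
  - by move=> s /andP[s0 _]; apply: is_deriveB; [exact: Db|exact: Da].
  - move=> s /andP[s0 _]; apply: F_lipschitz => j.
    rewrite (_ : 2 * _ * _ = C * E s / 2 ^+ k); first exact: IH.
    by rewrite exprS; field; rewrite expf_neq0.
  - rewrite -[X in `|X|]/(u k.+2 i 0 - u k.+1 i 0) a0 b0 subrr normr0 E0 mulr1.
    by rewrite divr_ge0// exprn_ge0.
have /choice[l lP] : forall it : 'I_n * R, exists l, 0 <= it.2 ->
    forall k, `|u k it.1 it.2 - l| <= 2 * (C * E it.2) / 2 ^+ k.
  move=> [i t]/=; have [t0|t0] := leP 0 t; last by exists 0.
  have CE0 : 0 <= C * E t by rewrite mulr_ge0// expR_ge0.
  by have [l lP] := geometric_cauchy CE0 (fun k => u_near k i t t0); exists l.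
have llip : lip (fun i t => l (i, t)).
  move=> i s t s0 t0.
  apply: (@le_of_geometric_error _ _ (2 * (C * E s) + 2 * (C * E t))) => k.
  have := lP (i, s) s0 k; have := lP (i, t) t0 k.
  have : `|u k i s - u k i t| <= B * `|s - t|.
    exact: ulip.
  rewrite /= (mulrDl (2 * (C * E s)) (2 * (C * E t))).
  set p := _ / _; set q := _ / _ => h1 h2 h3.
  have -> : l (i, s) - l (i, t) =
    (u k i s - u k i t) + (u k i t - l (i, t)) - (u k i s - l (i, s)) by ring.
  apply: (le_trans (ler_normB _ _)).
  by have := ler_normD (u k i s - u k i t) (u k i t - l (i, t)); lra.
(* One more Picard step from the limit [l]: the iterates converge to [y] as well as to [l], hence
   [y = l] is a fixed point. *)
have [y [y0 Dy]] := step_ex llip; exists y; split=> [//|t i t0].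
suff -> : y^~ t = (fun i => l (i, t)) by exact: Dy.
apply/funext => j; apply/eqP; rewrite -subr_eq0 -normr_le0.
apply: (@le_of_geometric_error _ _ (2 * (C * E t))) => k; rewrite add0r/=.
have h : `|u k.+1 j t - y j t| <= 2 * C / 2 ^+ k.+1 * E t.
  have [a0 Da] := uS k.
  apply: (@norm_le_of_derive (u k.+1 j - y j)
    (fun t => 2 * C / 2 ^+ k.+1 * E t)
    (fun t => F ((u k)^~ t) j - F (fun i => l (i, t)) j)
    (fun t => L * (2 * (2 * C / 2 ^+ k.+1) * E t)) 0 t) => //.
  - by move=> s /andP[s0 _]; apply: is_deriveB; [exact: Da|exact: Dy].
  - move=> s /andP[s0 _]; apply: F_lipschitz => m.
    rewrite (_ : 2 * _ * _ = 2 * (C * E s) / 2 ^+ k); first exact: (lP (m, s)).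
    by rewrite exprS; field; rewrite expf_neq0.
  - rewrite -[X in `|X|]/(u k.+1 j 0 - y j 0) a0 y0 subrr normr0 E0 mulr1.
    by apply: divr_ge0; [exact: mulr_ge0|exact: exprn_ge0].
have := lP (j, t) t0 k.+1 => /= h2.
have -> : y j t - l (j, t) = (u k.+1 j t - l (j, t)) - (u k.+1 j t - y j t).
  by ring.
apply: (le_trans (ler_normB _ _)); apply: (le_trans (lerD h2 h)).
have -> : 2 * (C * E t) / 2 ^+ k.+1 + 2 * C / 2 ^+ k.+1 * E t =
  2 * (C * E t) / 2 ^+ k by rewrite exprS; field; rewrite expf_neq0.
by [].
Qed.

End Picard.

End Calculus.

(** * Decay and failure of decay from differential inequalities *)

Section DifferentialInequalities.
Variable R : realType.
Implicit Types (W dW Q dQ : R -> R) (c k K B t s r : R).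

Lemma is_derive_expRM (k t : R) :
  is_derive t 1 (fun t : R => expR (k * t)) (k * expR (k * t)).
Proof.
have -> : (fun t : R => expR (k * t)) = expR \o (k \*: id) by [].
by apply: is_derive_eq; rewrite /GRing.scale/=; ring.
Qed.

(** Continuity argument: as long as [W < w0] holds, [W] does not increase, so at the supremum [m] of
    such times still [W m <= W 0 < w0] and the bound extends beyond [m]. The rate then follows
    because [W t * expR (c * t)] does not increase. *)
Lemma lyapunov_decay W dW c (w0 : R) : 0 <= c ->
  (forall t, 0 <= t -> is_derive t 1 W (dW t)) ->
  (forall t, 0 <= t -> 0 <= W t) -> W 0 < w0 ->
  (forall t, 0 <= t -> W t < w0 -> dW t <= - c * W t) ->
  forall t, 0 <= t -> W t < w0 /\ W t <= W 0 * expR (- c * t).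
Proof.
move=> c0 DW W0 Ww0 dWle.
have decr t : 0 <= t -> (forall s, 0 < s < t -> W s < w0) -> W t <= W 0.
  move=> t0 lt_w0; apply: (@le_of_derive _ W (cst (W 0)) dW (cst 0) 0 t) => //.
  - by move=> s /andP[s0 _]; exact: DW.
  - move=> s /andP[s0 st]; have st' := lt_w0 s (introT andP (conj s0 st)).
    apply: (le_trans (dWle s (ltW s0) st')).
    by rewrite /cst mulNr oppr_le0 mulr_ge0// W0// ltW.
have stay t : 0 <= t -> W t < w0.
  move=> t0; rewrite ltNge; apply/negP => wt.
  pose A := [set s | 0 <= s <= t /\ forall r, 0 <= r <= s -> W r < w0]%classic.
  have A0 : A 0.
    split; first by rewrite lexx.
    by move=> r r0; have -> : r = 0 by apply/eqP; rewrite eq_le andbC.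
  have Aub : has_ubound A by exists t => s [/andP[]].
  pose m := sup A.
  have m0 : 0 <= m by exact: ub_le_sup.
  have mt : m <= t by apply: ge_sup; [exists 0|move=> s [/andP[]]].
  have lt_m s : 0 <= s -> s < m -> W s < w0.
    move=> s0 sm; have [r [_ Ar] sr] : exists2 r, A r & s < r.
      by apply: sup_gt => //; exists 0.
    by apply: Ar; rewrite s0 ltW.
  have Wm : W m < w0.
    apply: le_lt_trans Ww0; apply: decr => // s /andP[s0 sm].
    by apply: lt_m => //; exact: ltW.
  have cWm := is_derive_continuous (DW m m0).
  have near_lt : nbhs m [set s | W s < w0]%classic .
    exact: (cvgr_lt _ cWm _ Wm).
  have [e e0 He] := (nbhs_ballP _ _).1 near_lt.
  have e0' : 0 < e by [].
  have tm : m + e / 2 <= t.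
    rewrite leNgt; apply/negP => tlt; move: wt; rewrite leNgt => /negP; apply.
    by apply: He; rewrite /ball/= ltr_norml; apply/andP; split; lra.
  have : m + e / 2 <= m.
    apply: ub_le_sup => //; split; first by apply/andP; split; lra.
    move=> r /andP[r0 rme]; have [rm|mr] := ltP r m; first exact: lt_m.
    by apply: He; rewrite /ball/= ltr_norml; apply/andP; split; lra.
  by lra.
move=> t t0; split; first exact: stay.
have : W t * expR (c * t) <= W 0.
  apply: (@le_of_derive _ (fun t => W t * expR (c * t)) (cst (W 0))
    (fun t => W t * (c * expR (c * t)) + expR (c * t) * dW t) (cst 0) 0 t) => //.
  - move=> s /andP[s0 _].
    have D1 := DW s s0; have D2 := is_derive_expRM c s.
    exact: (@is_deriveM _ _ W (fun t => expR (c * t))).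
  - move=> s /andP[s0 _]; rewrite /cst.
    have -> : W s * (c * expR (c * s)) + expR (c * s) * dW s =
      expR (c * s) * (dW s + c * W s) by ring.
    rewrite mulr_ge0_le0 ?expR_ge0//.
    by have := dWle s (ltW s0) (stay s (ltW s0)); rewrite mulNr; lra.
  - by rewrite mulr0 expR0 mulr1.
by rewrite mulNr expRN ler_pdivlMr// expR_gt0.
Qed.

(** The total decrease of [Q] allowed by the lower bound on [dQ] is at most [K], whereas the upper
    bound pushes [Q] to 0 at infinity or below. *)
Lemma not_decaying_of_derive_ge Q dQ k K B : 0 < k ->
  (forall t, 0 <= t -> is_derive t 1 Q (dQ t)) ->
  (forall t, 0 <= t -> - (k * K * expR (- k * t)) <= dQ t) ->
  (forall t, 0 <= t -> Q t <= B * expR (- k * t)) -> Q 0 <= K.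
Proof.
move=> k0 DQ dQge QB; rewrite leNgt; apply/negP => KQ.
have low t : 0 <= t -> Q 0 - K + K * expR (- k * t) <= Q t.
  move=> t0; apply: (@le_of_derive _ (fun t => Q 0 - K + K * expR (- k * t)) Q
    (fun t => 0 + K * (- k * expR (- k * t))) dQ 0 t) => //.
  - move=> s _; apply: (@is_deriveD _ _ _ (cst (Q 0 - K))
      (K \*: (fun t => expR (- k * t)))).
    by apply: is_deriveZ; exact: is_derive_expRM.
  - by move=> s /andP[s0 _]; exact: DQ.
  - by move=> s /andP[/ltW s0 _]; have := dQge s s0; lra.
  - by rewrite mulr0 expR0; lra.
pose d := Q 0 - K; have d0 : 0 < d by rewrite subr_gt0.
(* At this time [d * (1 + k * t)] exceeds [B - K], which contradicts [d * expR (k * t) <= B - K]. *)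
pose t := (`|B| + `|K|) / (d * k).
have t0 : 0 <= t by rewrite divr_ge0 ?addr_ge0// ltW// mulr_gt0.
have h := le_trans (low t t0) (QB t t0).
have : d * expR (k * t) <= B - K.
  have e0 := expR_gt0 (k * t).
  by move: h; rewrite -ler_pdivlMr// mulrBl mulNr expRN -/d; lra.
have := ler_wpM2l (ltW d0) (expR_ge1Dx (k * t)).
have -> : d * (1 + k * t) = d + (`|B| + `|K|).
  by rewrite /t; field; rewrite !gt_eqF.
have := ler_norm B; have := ler_norm (- K); rewrite normrN; lra.
Qed.

End DifferentialInequalities.

(** * Lyapunov function in Schwarz form *)

Section SchwarzForm.
Variable R : realType.
Implicit Types w x ro th : R.

(** Used to choose a small constant below finitely many positive thresholds at once. *)
Lemma pos_lower_bound (s : seq R) : all (fun x => 0 < x) s ->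
  exists2 m, 0 < m & all (fun x => m <= x) s.
Proof.
elim: s => [_|a s IH /= /andP[a0 /IH[m m0 ms]]]; first by exists 1.
exists (Num.min a m); first by rewrite lt_min a0.
rewrite ge_min lexx /=; apply: sub_all ms => x mx.
by rewrite ge_min mx orbT.
Qed.

Lemma normM_le (a b A B : R) : `|a| <= A -> `|b| <= B -> `|a * b| <= A * B.
Proof. by move=> aA bB; rewrite normrM ler_pM. Qed.

(** For [e = 0] the derivative controls only [w] and [x3]. The product [x1 * x2] contributes
    [- b3 * x1 ^+ 2] at the price of at most [x2 ^+ 2], and the factor [2 / b2] makes [x2 * x3]
    contribute [- 2 * x2 ^+ 2], which pays for it. *)
Definition schwarz_form (b2 b3 e w x1 x2 x3 : R) : R :=
  w ^+ 2 + b2 * (b3 * x1 ^+ 2 + x2 ^+ 2) + x3 ^+ 2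
  + e * (2 / b2 * (x2 * x3) + x1 * x2).

Definition schwarz_form_deriv (b2 b3 e w x1 x2 x3 w' x1' x2' x3' : R) : R :=
  2 * w * w' + b2 * (b3 * (2 * x1 * x1') + 2 * x2 * x2') + 2 * x3 * x3'
  + e * (2 / b2 * (x2 * x3' + x3 * x2') + (x1 * x2' + x2 * x1')).

(** A small [e] keeps the form positive definite and makes its linear derivative negative definite;
    perturbations that are small relative to the state use up only part of that negativity. *)
Lemma schwarz_form_lyapunov (lam b1 b2 b3 : R) :
  lam < 0 -> 0 < b1 -> 0 < b2 -> 0 < b3 ->
  exists e k1 k2 c, [/\ 0 < k1, 0 < k2, 0 < c,
    (forall w x1 x2 x3, let N := w ^+ 2 + x1 ^+ 2 + x2 ^+ 2 + x3 ^+ 2 in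
      k1 * N <= schwarz_form b2 b3 e w x1 x2 x3 <= k2 * N) &
    (forall w x1 x2 x3 sg ro1 ro2 ro3 th, 0 <= sg <= 1 -> sg * x1 = x1 ->
      let S := `|w| + `|x1| + `|x2| + `|x3| in
      `|ro1| <= th * S -> `|ro2| <= th * S -> `|ro3| <= th * S -> th <= c ->
      schwarz_form_deriv b2 b3 e w x1 x2 x3 (lam * w + ro1) (sg * x2)
        (- b3 * x1 + x3 + ro2) (- b2 * x2 - b1 * x3 + ro3)
      <= - c * schwarz_form b2 b3 e w x1 x2 x3)].
Proof.
move=> lam0 b10 b20 b30;
have [k kE] : exists k, k = 2 / b2 by exists (2 / b2).
have k0 : 0 < k by rewrite kE divr_gt0.
have kb2 : k * b2 = 2 by rewrite kE divfK// gt_eqF.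
(* [G] is the coefficient of [x3 ^+ 2] that remains after completing the squares in [x1] and [x2] in
   [main]; [e * G <= b1] lets half of the damping [2 * b1] absorb it. *)
have [G GE] : exists G,
    G = k + (1 - k * b3) ^+ 2 / (2 * b3) + k ^+ 2 * b1 ^+ 2 / 2 by eexists.
have G0 : 0 < G.
  rewrite GE -addrA ltr_wpDr// addr_ge0//.
    by rewrite divr_ge0 ?sqr_ge0// mulr_ge0// ltW.
  by rewrite divr_ge0// mulr_ge0 ?sqr_ge0.
have k10 : 0 < k + 1 by lra.
have [|mu mu0 /and4P[mu1 mu2 mu3 _]] :=
  @pos_lower_bound [:: b2 * b3; b2; 1].
  by rewrite /= mulr_gt0 ?b20 ?ltr01.
have [|e e0 /and3P[eG ek _]] :=
  @pos_lower_bound [:: b1 / G; mu / (2 * (k + 1))].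
  by rewrite /= !divr_gt0 ?mulr_gt0.
have {}eG : e * G <= b1 by rewrite -ler_pdivlMr.
have {}ek : 2 * (e * (k + 1)) <= mu.
  by move: ek; rewrite ler_pdivlMr ?mulr_gt0//; lra.
(* [c1] bounds from below the four diagonal coefficients of the negated unperturbed derivative. *)
have [|c1 c10 /and5P[c1l c1b c1e c1eb _]] :=
  @pos_lower_bound [:: - (2 * lam); b1; e / 2; e * b3 / 2].
  by rewrite /= !divr_gt0 ?mulr_gt0//; apply/and3P; split=> //; lra.
have [k2 k2E] : exists k2, k2 = 1 + b2 * b3 + b2 + mu / 2 by eexists.
have k20 : 0 < k2 by rewrite k2E !addr_gt0 ?mulr_gt0 ?divr_gt0.
have [G2 G2E] : exists G2, G2 = 4 + 2 * b2 + e * (2 * k + 1) by eexists.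
have G20 : 0 < G2 by rewrite G2E !addr_gt0 ?mulr_gt0// addr_gt0 ?mulr_gt0.
(* Half of [c1] pays for the perturbation, bounded by [4 * G2 * c] times [N], and the other half for
   [c] times the form, bounded by [c * k2 * N]. *)
have [|c c0 /and3P[cG ck _]] :=
  @pos_lower_bound [:: c1 / (8 * G2); c1 / (2 * k2)].
  by rewrite /= !divr_gt0 ?mulr_gt0.
have {}cG : c * (8 * G2) <= c1 by rewrite -ler_pdivlMr ?mulr_gt0.
have {}ck : c * (2 * k2) <= c1 by rewrite -ler_pdivlMr ?mulr_gt0.
have sq2 (x y : R) : 2 * `|x * y| <= x ^+ 2 + y ^+ 2.
  rewrite normrM -(real_normK (num_real x)) -(real_normK (num_real y)).
  by have := sqr_ge0 (`|x| - `|y|); rewrite sqrrB; lra.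
have form_bnd w x1 x2 x3 : let N := w ^+ 2 + x1 ^+ 2 + x2 ^+ 2 + x3 ^+ 2 in
    mu / 2 * N <= schwarz_form b2 b3 e w x1 x2 x3 <= k2 * N.
  move=> N; set T := k * (x2 * x3) + x1 * x2.
  have T_le : `|e * T| <= mu / 2 * (x1 ^+ 2 + x2 ^+ 2 + x3 ^+ 2).
    rewrite normrM (gtr0_norm e0).
    apply: (@le_trans _ _ (e * ((k + 1) * (x1 ^+ 2 + x2 ^+ 2 + x3 ^+ 2)))).
      rewrite ler_wpM2l ?(ltW e0)// /T (le_trans (ler_normD _ _))//.
      rewrite [`|k * _|]normrM (gtr0_norm k0) mulrDl lerD//.
        rewrite ler_wpM2l ?(ltW k0)//; have := sq2 x2 x3.
        have := sqr_ge0 x1; have := normr_ge0 (x2 * x3); lra.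
      have := sq2 x1 x2; have := sqr_ge0 x3; have := normr_ge0 (x1 * x2); lra.
    rewrite mulrA ler_wpM2r ?addr_ge0 ?sqr_ge0//; lra.
  have -> : schwarz_form b2 b3 e w x1 x2 x3 = w ^+ 2 + b2 * b3 * x1 ^+ 2
      + b2 * x2 ^+ 2 + x3 ^+ 2 + e * T by rewrite /schwarz_form -kE /T; ring.
  move: T_le; rewrite ler_norml => /andP[Tl Tu].
  have m2 : mu / 2 <= 1 by lra.
  have h1 := ler_wpM2r (sqr_ge0 x1) mu1.
  have h2 := ler_wpM2r (sqr_ge0 x2) mu2.
  have h3 := ler_wpM2r (sqr_ge0 x3) mu3.
  have hw := ler_wpM2r (sqr_ge0 w) m2.
  have p0 := mulr_ge0 (ltW b20) (ltW b30).
  have mu0' := ltW mu0; have b20' := ltW b20.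
  have [w0 x10 x20 x30] :=
    And4 (sqr_ge0 w) (sqr_ge0 x1) (sqr_ge0 x2) (sqr_ge0 x3).
  have [q1 q2 q3 q4] := And4 (mulr_ge0 p0 w0) (mulr_ge0 p0 x10)
    (mulr_ge0 p0 x20) (mulr_ge0 p0 x30).
  have [r1 r2 r3 r4] := And4 (mulr_ge0 b20' w0) (mulr_ge0 b20' x10)
    (mulr_ge0 b20' x20) (mulr_ge0 b20' x30).
  have [s1 s2 s3 s4] := And4 (mulr_ge0 mu0' w0) (mulr_ge0 mu0' x10)
    (mulr_ge0 mu0' x20) (mulr_ge0 mu0' x30).
  by rewrite /N k2E; apply/andP; split; lra.
exists e, (mu / 2), k2, c; split=> //; first by rewrite divr_gt0.
move=> w x1 x2 x3 sg ro1 ro2 ro3 th /andP[sg0 sg1] sgx1 S h1 h2 h3 thc.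
have /andP[_ WN] := form_bnd w x1 x2 x3; move: WN.
set N := w ^+ 2 + _ + _ + _ => WN.
have N0 : 0 <= N by rewrite !addr_ge0 ?sqr_ge0.
pose P := 2 * (w * ro1) + 2 * b2 * (x2 * ro2) + 2 * (x3 * ro3)
  + e * (k * (x3 * ro2) + k * (x2 * ro3) + x1 * ro2).
have S0 : 0 <= S by rewrite !addr_ge0.
have SN : S ^+ 2 <= 4 * N.
  rewrite /N -(real_normK (num_real w)) -(real_normK (num_real x1)).
  rewrite -(real_normK (num_real x2)) -(real_normK (num_real x3)) /S.
  have := sqr_ge0 (`|w| - `|x1|); have := sqr_ge0 (`|w| - `|x2|).
  have := sqr_ge0 (`|w| - `|x3|); have := sqr_ge0 (`|x1| - `|x2|).
  have := sqr_ge0 (`|x1| - `|x3|); have := sqr_ge0 (`|x2| - `|x3|).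
  lra.
have P_le : P <= c1 / 2 * N.
  have bnd (x r : R) : `|x| <= S -> `|r| <= th * S -> x * r <= c * S ^+ 2.
    move=> hx hr; apply: (le_trans (ler_norm _)).
    apply: (le_trans (normM_le hx hr)).
    by rewrite mulrCA -expr2 ler_wpM2r ?sqr_ge0.
  have [nw n1 n2 n3] :
    [/\ `|w| <= S, `|x1| <= S, `|x2| <= S & `|x3| <= S].
    have := normr_ge0 w; have := normr_ge0 x1; have := normr_ge0 x2.
    by have := normr_ge0 x3; rewrite /S; split; lra.
  apply: (@le_trans _ _ (G2 * (c * S ^+ 2))).
    have ek0 : 0 <= e * k by rewrite mulr_ge0 ?ltW.
    have b20' : 0 <= 2 * b2 by rewrite mulr_ge0 ?ltW.
    have p1 := bnd _ _ nw h1; have p2 := ler_wpM2l b20' (bnd _ _ n2 h2).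
    have p3 := bnd _ _ n3 h3; have p4 := ler_wpM2l ek0 (bnd _ _ n3 h2).
    have p5 := ler_wpM2l ek0 (bnd _ _ n2 h3).
    have p6 := ler_wpM2l (ltW e0) (bnd _ _ n1 h2).
    rewrite /P G2E; lra.
  apply: (@le_trans _ _ (G2 * (c * (4 * N)))).
    by rewrite ler_wpM2l ?(ltW G20)// ler_wpM2l ?(ltW c0).
  by have := ler_wpM2r N0 cG; lra.
(* The products [x1 * x2] from the first two equations cancel by [sg * x1 = x1]. *)
have -> : schwarz_form_deriv b2 b3 e w x1 x2 x3 (lam * w + ro1) (sg * x2)
    (- b3 * x1 + x3 + ro2) (- b2 * x2 - b1 * x3 + ro3)
  = 2 * lam * w ^+ 2 - 2 * b1 * x3 ^+ 2 + e * (k * (- b3 * (x1 * x3) + x3 ^+ 2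
      - b1 * (x2 * x3)) - k * b2 * x2 ^+ 2
    + sg * x2 ^+ 2 - b3 * x1 ^+ 2 + x1 * x3) + P
    + 2 * b2 * b3 * x2 * (sg * x1 - x1).
  by rewrite /schwarz_form_deriv /P -kE; ring.
rewrite sgx1 subrr mulr0 addr0 kb2.
have main : e * (k * (- b3 * (x1 * x3) + x3 ^+ 2 - b1 * (x2 * x3))
      - 2 * x2 ^+ 2 + sg * x2 ^+ 2 - b3 * x1 ^+ 2 + x1 * x3)
    <= e * G * x3 ^+ 2 - e / 2 * x2 ^+ 2 - e * b3 / 2 * x1 ^+ 2.
  rewrite -subr_ge0.
  have -> : e * G * x3 ^+ 2 - e / 2 * x2 ^+ 2 - e * b3 / 2 * x1 ^+ 2
     - e * (k * (- b3 * (x1 * x3) + x3 ^+ 2 - b1 * (x2 * x3))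
      - 2 * x2 ^+ 2 + sg * x2 ^+ 2 - b3 * x1 ^+ 2 + x1 * x3) =
    e * (b3 / 2 * (x1 - (1 - k * b3) / b3 * x3) ^+ 2
      + 1 / 2 * (x2 + k * b1 * x3) ^+ 2 + (1 - sg) * x2 ^+ 2).
    by rewrite GE; field; rewrite gt_eqF.
  rewrite mulr_ge0 ?(ltW e0)// !addr_ge0// mulr_ge0 ?sqr_ge0 ?subr_ge0//.
  by rewrite divr_ge0// ltW.
have i1 := ler_wpM2r (sqr_ge0 x3) eG.
have i2 := ler_wpM2r (sqr_ge0 x3) c1b.
have i3 := ler_wpM2r (sqr_ge0 x2) c1e.
have i4 := ler_wpM2r (sqr_ge0 x1) c1eb.
have i5 := ler_wpM2r (sqr_ge0 w) c1l.
have i6 := ler_wpM2l (ltW c0) WN.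
have i7 := ler_wpM2r N0 ck.
have NE : c1 * N = c1 * w ^+ 2 + c1 * x1 ^+ 2 + c1 * x2 ^+ 2 + c1 * x3 ^+ 2.
  by rewrite /N; ring.
lra.
Qed.

End SchwarzForm.

(** * Bounded Lipschitz functions and orders of vanishing *)

Section SineBounds.
Variable R : realType.
Implicit Types s t a b : R.

Lemma sin_lipschitz a b : `|sin a - sin b| <= `|a - b|.
Proof.
wlog ba : a b / b <= a => [hw|].
  have [/hw//|/ltW/hw] := leP b a.
  by rewrite distrC [`|b - a|]distrC.
rewrite [`|a - b|]ger0_norm ?subr_ge0//.
apply: (@norm_le_of_derive R (fun t => sin t - sin b) (fun t => t - b) cos
  (fun=> 1) b a) => //.
- move=> t _; rewrite -[cos t]subr0.
  by apply: (@is_deriveB _ _ _ (@sin R) (cst (sin b))).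
- move=> t _; rewrite -[X in is_derive _ _ _ X]subr0.
  by apply: (@is_deriveB _ _ _ id (cst b)).
- by move=> t _; exact: cos_max.
- by rewrite !subrr normr0.
Qed.

Lemma cos_lipschitz a b : `|cos a - cos b| <= `|a - b|.
Proof.
wlog ba : a b / b <= a => [hw|].
  have [/hw//|/ltW/hw] := leP b a.
  by rewrite distrC [`|b - a|]distrC.
rewrite [`|a - b|]ger0_norm ?subr_ge0//.
apply: (@norm_le_of_derive R (fun t => cos t - cos b) (fun t => t - b)
  (fun t => - sin t) (fun=> 1) b a) => //.
- move=> t _; rewrite -[- sin t]subr0.
  by apply: (@is_deriveB _ _ _ (@cos R) (cst (cos b))).
- move=> t _; rewrite -[X in is_derive _ _ _ X]subr0.
  by apply: (@is_deriveB _ _ _ id (cst b)).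
- by move=> t _; rewrite normrN; exact: sin_max.
- by rewrite !subrr normr0.
Qed.

Let is_derive_sqr t : is_derive t 1 (fun t => t ^+ 2) (2 * t).
Proof.
have -> : (fun t : R => t ^+ 2) = id ^+ 2 by apply/funext.
by apply: is_derive_eq; rewrite /GRing.scale/= expr1 mulr1 mulr_natl.
Qed.

Lemma cos_sub1_le t : `|cos t - 1| <= t ^+ 2.
Proof.
wlog t0 : t / 0 <= t => [hw|].
  have [/hw//|/ltW t0] := leP 0 t.
  by rewrite -cosN -sqrrN; apply: hw; rewrite oppr_ge0.
apply: (@norm_le_of_derive R (fun t => cos t - 1) (fun t => t ^+ 2)
  (fun t => - sin t) (fun t => 2 * t) 0 t) => //.
- move=> s _; rewrite -[- sin s]subr0.
  by apply: (@is_deriveB _ _ _ (@cos R) (cst 1)).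
- move=> s /andP[s0 _]; rewrite normrN; have := sin_lipschitz s 0.
  by rewrite sin0 !subr0 [`|s|]ger0_norm//; lra.
- by rewrite cos0 subrr normr0 expr0n.
Qed.

Lemma sin_sub_id_le t : `|sin t - t| <= t ^+ 2.
Proof.
wlog t0 : t / 0 <= t => [hw|].
  have [/hw//|/ltW t0] := leP 0 t.
  have := hw (- t); rewrite oppr_ge0 sinN sqrrN opprK.
  by rewrite [- sin t + t]addrC distrC; exact.
apply: (@norm_le_of_derive R (fun t => sin t - t) (fun t => t ^+ 2)
  (fun t => cos t - 1) (fun t => 2 * t) 0 t) => //.
- move=> s /andP[s0 _]; have := cos_lipschitz s 0.
  by rewrite cos0 subr0 [`|s|]ger0_norm//; lra.
- by rewrite sin0 subrr normr0 expr0n.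
Qed.

End SineBounds.

Section BoundedLipschitz.
Variables (R : realType) (n : nat).
Implicit Types (f g : ('I_n -> R) -> R) (x y : 'I_n -> R).

(** Boundedness is part of the notion because it makes the Lipschitz functions closed under
    products. *)
Definition bounded_lipschitz f := exists2 L, 0 <= L &
  (forall x, `|f x| <= L) /\
  (forall x y (M : R), 0 <= M -> (forall i, `|x i - y i| <= M) ->
    `|f x - f y| <= L * M).

Lemma bounded_lipschitz_cst (a : R) : bounded_lipschitz (fun=> a).
Proof.
exists `|a|; first exact: normr_ge0.
by split=> // x y M M0 _; rewrite subrr normr0 mulr_ge0.
Qed.

Lemma bounded_lipschitzD f g : bounded_lipschitz f -> bounded_lipschitz g ->
  bounded_lipschitz (fun x => f x + g x).
Proof.
move=> [L L0 [fL fl]] [K K0 [gK gl]]; exists (L + K); first exact: addr_ge0.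
split=> [x|x y M M0 xy].
  by rewrite (le_trans (ler_normD _ _))// lerD.
have -> : f x + g x - (f y + g y) = (f x - f y) + (g x - g y) by ring.
by rewrite (le_trans (ler_normD _ _))// mulrDl lerD// ?fl ?gl.
Qed.

Lemma bounded_lipschitzN f : bounded_lipschitz f ->
  bounded_lipschitz (fun x => - f x).
Proof.
move=> [L L0 [fL fl]]; exists L => //; split=> [x|x y M M0 xy].
  by rewrite normrN.
by rewrite -opprD normrN fl.
Qed.

Lemma bounded_lipschitzM f g : bounded_lipschitz f -> bounded_lipschitz g ->
  bounded_lipschitz (fun x => f x * g x).
Proof.
move=> [L L0 [fL fl]] [K K0 [gK gl]].
exists (L * K + L * K); first by rewrite addr_ge0// mulr_ge0.
split=> [x|x y M M0 xy].
  by rewrite (le_trans (normM_le (fL x) (gK x)))// lerDl mulr_ge0.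
have -> : f x * g x - f y * g y = f x * (g x - g y) + (f x - f y) * g y.
  by ring.
rewrite (le_trans (ler_normD _ _))// (mulrDl (L * K)) lerD//.
  by rewrite -mulrA normM_le ?gl.
by rewrite mulrAC normM_le ?fl.
Qed.

Lemma bounded_lipschitzX f k : bounded_lipschitz f ->
  bounded_lipschitz (fun x => f x ^+ k).
Proof.
move=> bf; elim: k => [|k IH]; first exact: bounded_lipschitz_cst.
under eq_fun do rewrite exprS; exact: bounded_lipschitzM.
Qed.

Lemma bounded_lipschitz_comp (h : R -> R) f :
  (forall a, `|h a| <= 1) -> (forall a b, `|h a - h b| <= `|a - b|) ->
  bounded_lipschitz f -> bounded_lipschitz (fun x => h (f x)).
Proof.
move=> h1 hl [L L0 [fL fl]]; exists (L + 1); first by rewrite addr_ge0.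
split=> [x|x y M M0 xy]; first by rewrite (le_trans (h1 _))// lerDr.
rewrite (le_trans (hl _ _))// (le_trans (fl _ _ _ M0 xy))//.
by rewrite ler_wpM2r// lerDl.
Qed.

Lemma bounded_lipschitz_norm f : bounded_lipschitz f ->
  bounded_lipschitz (fun x => `|f x|).
Proof.
move=> [L L0 [fL fl]]; exists L => //; split=> [x|x y M M0 xy].
  by rewrite normr_id.
by rewrite (le_trans (ler_dist_dist _ _))// fl.
Qed.

Lemma bounded_lipschitzV f (m : R) : 0 < m -> (forall x, m <= f x) ->
  bounded_lipschitz f -> bounded_lipschitz (fun x => (f x)^-1).
Proof.
move=> m0 mf [L L0 [fL fl]].
have f0 x : 0 < f x by exact: lt_le_trans (mf x).
have nz x : f x != 0 by rewrite gt_eqF.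
have mV : 0 <= m^-1 by rewrite invr_ge0 ltW.
have fV x : `|(f x)^-1| <= m^-1 by rewrite gtr0_norm ?invr_gt0// lef_pV2 ?posrE.
exists (m^-1 + m^-1 * m^-1 * L); first by rewrite addr_ge0// !mulr_ge0.
split=> [x|x y M M0 xy].
  by rewrite (le_trans (fV x))// lerDl !mulr_ge0.
have -> : (f x)^-1 - (f y)^-1 = (f x)^-1 * (f y)^-1 * (f y - f x).
  by field; rewrite !nz.
rewrite mulrDl (@le_trans _ _ (m^-1 * m^-1 * L * M))//.
  rewrite -[leRHS]mulrA !normM_le//.
  by rewrite distrC fl.
by rewrite lerDr mulr_ge0.
Qed.

Lemma bounded_lipschitz_sqrt f (m : R) : 0 < m -> (forall x, m <= f x) ->
  bounded_lipschitz f -> bounded_lipschitz (fun x => Num.sqrt (f x)).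
Proof.
move=> m0 mf [L L0 [fL fl]].
have f0 x : 0 <= f x by apply: ltW; exact: lt_le_trans (mf x).
have q0 : 0 < Num.sqrt m by rewrite sqrtr_gt0.
have qf x : Num.sqrt m <= Num.sqrt (f x) by rewrite ler_wsqrtr.
exists (Num.sqrt L + (Num.sqrt m)^-1 * L).
  by rewrite addr_ge0 ?sqrtr_ge0// mulr_ge0// invr_ge0 ltW.
split=> [x|x y M M0 xy].
  rewrite ger0_norm ?sqrtr_ge0// (@le_trans _ _ (Num.sqrt L))//.
    by rewrite ler_wsqrtr// (le_trans (ler_norm _)).
  by rewrite lerDl mulr_ge0// invr_ge0 ltW.
have d0 : 0 < Num.sqrt (f x) + Num.sqrt (f y).
  by apply: (lt_le_trans q0); rewrite (le_trans (qf x))// lerDl sqrtr_ge0.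
have -> : Num.sqrt (f x) - Num.sqrt (f y) =
    (Num.sqrt (f x) + Num.sqrt (f y))^-1 * (f x - f y).
  rewrite -[in f x - _](sqr_sqrtr (f0 x)) -[in _ - f y](sqr_sqrtr (f0 y)).
  by rewrite subr_sqr mulrCA mulVf ?mulr1// gt_eqF.
rewrite mulrDl (@le_trans _ _ ((Num.sqrt m)^-1 * L * M))//.
  rewrite -mulrA normM_le// ?fl// gtr0_norm ?invr_gt0//.
  by rewrite lef_pV2 ?posrE// (le_trans (qf x))// lerDl sqrtr_ge0.
by rewrite lerDr mulr_ge0// sqrtr_ge0.
Qed.

Lemma bounded_lipschitz_horner (p : {poly R}) f : bounded_lipschitz f ->
  bounded_lipschitz (fun x => p.[f x]).
Proof.
move=> bf; elim/poly_ind: p => [|p c IH].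
  by under eq_fun do rewrite horner0; exact: bounded_lipschitz_cst.
under eq_fun do rewrite hornerMXaddC.
apply: bounded_lipschitzD; last exact: bounded_lipschitz_cst.
exact: bounded_lipschitzM.
Qed.

Definition clamp (a b t : R) := Num.max a (Num.min b t).

Lemma clamp_ge (a b t : R) : a <= clamp a b t.
Proof. by rewrite /clamp le_max lexx. Qed.

Lemma clamp_le (a b t : R) : a <= b -> clamp a b t <= b.
Proof. by move=> ab; rewrite /clamp ge_max ab ge_min lexx. Qed.

Lemma clamp_id (a b t : R) : a <= t <= b -> clamp a b t = t.
Proof.
by move=> /andP[at_ tb]; rewrite /clamp (min_idPr tb) (max_idPr at_).
Qed.

Lemma bounded_lipschitz_clamp (a b : R) i : a <= b ->
  bounded_lipschitz (fun x => clamp a b (x i)).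
Proof.
move=> ab; exists (`|a| + `|b| + 1); first by rewrite !addr_ge0.
split=> [x|x y M M0 /(_ i) xy].
  have := clamp_ge a b (x i); have := clamp_le (x i) ab.
  rewrite /= ler_norml => h1 h2; apply/andP; split.
    by have := ler_norm (- a); have := normr_ge0 b; rewrite normrN; lra.
  by have := ler_norm b; have := normr_ge0 a; lra.
apply: (@le_trans _ _ (1 * M)); last first.
  by rewrite ler_wpM2r// lerDr addr_ge0.
move: xy; rewrite mul1r !ler_norml /clamp => /andP[h1 h2].
by case: (leP b (x i)) => ?; case: (leP b (y i)) => ?;
  case: (leP a b) => ?; case: (leP a (x i)) => ?; case: (leP a (y i)) => ?;
  apply/andP; split; lra.
Qed.

End BoundedLipschitz.

Section OrderOfVanishing.
Variables (R : realType) (T : Type) (S : T -> R) (eta : R).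
Hypothesis S_ge0 : forall x, 0 <= S x.
Hypothesis eta_ge0 : 0 <= eta.
Implicit Types (f g : T -> R).

(** [f = O(S ^ k)], on the fixed set [S <= eta] instead of an unspecified neighbourhood, so that
    estimates combine without shrinking it. *)
Definition vanishes k f :=
  exists2 K, 0 <= K & forall x, S x <= eta -> `|f x| <= K * S x ^+ k.

Lemma vanishes_cst (a : R) : vanishes 0 (fun=> a).
Proof. by exists `|a| => // x _; rewrite expr0 mulr1. Qed.

Lemma vanishesD k f g : vanishes k f -> vanishes k g ->
  vanishes k (fun x => f x + g x).
Proof.
move=> [K K0 fK] [L L0 gL]; exists (K + L); first exact: addr_ge0.
move=> x xe; rewrite (le_trans (ler_normD _ _))// mulrDl lerD ?fK ?gL//.
Qed.

Lemma vanishesN k f : vanishes k f -> vanishes k (fun x => - f x).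
Proof. by move=> [K K0 fK]; exists K => // x xe; rewrite normrN fK. Qed.

Lemma vanishesM k l f g : vanishes k f -> vanishes l g ->
  vanishes (k + l) (fun x => f x * g x).
Proof.
move=> [K K0 fK] [L L0 gL]; exists (K * L); first exact: mulr_ge0.
by move=> x xe; rewrite exprD mulrACA normM_le ?fK ?gL.
Qed.

Lemma vanishes_norm k f : vanishes k f -> vanishes k (fun x => `|f x|).
Proof. by move=> [K K0 fK]; exists K => // x xe; rewrite normr_id fK. Qed.

Lemma vanishesX k l f : vanishes k f -> vanishes (k * l) (fun x => f x ^+ l).
Proof.
move=> fk; elim: l => [|l IH]; first by rewrite muln0; exact: vanishes_cst.
by rewrite mulnS; under eq_fun do rewrite exprS; exact: vanishesM.
Qed.

Lemma vanishes_le k l f : (l <= k)%N -> vanishes k f -> vanishes l f.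
Proof.
move=> lk [K K0 fK]; exists (K * eta ^+ (k - l)).
  by rewrite mulr_ge0// exprn_ge0.
move=> x xe; rewrite (le_trans (fK x xe))// -mulrA ler_wpM2l//.
rewrite -[in leLHS](subnK lk) exprD ler_wpM2r ?exprn_ge0//.
by rewrite lerXn2r ?nnegrE.
Qed.

Lemma vanishesW k f g : vanishes k g ->
  (forall x, S x <= eta -> `|f x| <= `|g x|) -> vanishes k f.
Proof.
move=> [K K0 gK] fg; exists K => // x xe.
by rewrite (le_trans (fg x xe)) ?gK.
Qed.

End OrderOfVanishing.

(** Induction along Horner's scheme: the remainder of [p * 'X + c] is that of [p] times [a + w],
    plus the derivative of [p] at [a] times [w ^+ 2]. *)
Lemma poly_taylor1 (R : realType) (p : {poly R}) (a : R) :
  exists2 K, 0 <= K & forall w, `|w| <= 1 ->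
    `|p.[a + w] - p.[a] - p^`().[a] * w| <= K * w ^+ 2.
Proof.
elim/poly_ind: p => [|p c [K K0 pK]].
  by exists 0 => // w _; rewrite deriv0 !horner0 !mul0r !subr0 normr0.
exists (K * (`|a| + 1) + `|p^`().[a]|).
  by rewrite addr_ge0// mulr_ge0// addr_ge0.
move=> w w1; rewrite derivMXaddC !hornerMXaddC !hornerD hornerM !hornerX.
have -> : p.[a + w] * (a + w) + c - (p.[a] * a + c) -
    (p.[a] + p^`().[a] * a) * w =
  (p.[a + w] - p.[a] - p^`().[a] * w) * (a + w) + p^`().[a] * w ^+ 2 by ring.
rewrite (le_trans (ler_normD _ _))// (mulrDl (K * _)) lerD//.
  rewrite mulrAC normM_le ?pK//.
  by rewrite (le_trans (ler_normD _ _))// lerD.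
by rewrite normrM [`|w ^+ 2|]ger0_norm ?sqr_ge0.
Qed.

(** * Signs of the coefficients *)

Section Numerics.
Variable R : realType.

Lemma D_det_gt0 : 0 < D_det R.
Proof. rewrite /D_det /m_ship /m_vv /I_z /m_rr /m_rv /m_vr. lra. Qed.

Ltac bound_tac := rewrite ler_pdivlMl ?ler_pdivrMl ?D_det_gt0//;
  rewrite /D_det /Y_b /Y_g /N_b /N_g /x_T /m_ship /m_vv /I_z /m_rr /m_rv /m_vr;
  lra.

(** These coarse enclosures are just fine enough to fix the signs of the combinations of
    coefficients in the characteristic polynomial and the curve. *)
Lemma p22u_bounds : - (3 / 10) <= p22u R <= - (29 / 100).
Proof. rewrite /p22u; bound_tac. Qed.

Lemma p32u_bounds : - (51 / 10) <= p32u R <= - 5.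
Proof. rewrite /p32u; bound_tac. Qed.

Lemma p23u_bounds : - (5 / 10) <= p23u R <= - (4 / 10).
Proof. rewrite /p23u; bound_tac. Qed.

Lemma p33u_bounds : - (9 / 10) <= p33u R <= - (86 / 100).
Proof. rewrite /p33u; bound_tac. Qed.

Lemma q23_bounds : 24 / 10 <= q23 R <= 25 / 10.
Proof. rewrite /q23; bound_tac. Qed.

Lemma q33_bounds : - 19 <= q33 R <= - 18.
Proof. rewrite /q33; bound_tac. Qed.

End Numerics.

(** * The vessel as a system of four scalar equations *)

Section FourByFour.

Lemma ord4_ind (P : 'I_4 -> Prop) :
  P (inord 0) -> P (inord 1) -> P (inord 2) -> P (inord 3) -> forall i, P i.
Proof.
move=> P0 P1 P2 P3 i; rewrite -(inord_val i).
by case: i => -[|[|[|[|//]]]].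
Qed.

Lemma sum4 (V : nmodType) (f : 'I_4 -> V) :
  \sum_i f i = f (inord 0) + f (inord 1) + f (inord 2) + f (inord 3).
Proof.
under eq_bigr do rewrite -[X in f X]inord_val.
by rewrite !big_ord_recr big_ord0 /= add0r.
Qed.

Variable R : realType.

Lemma mx_ofE m n (rows : seq (seq R)) i j : (i < m.+1)%N -> (j < n.+1)%N ->
  (mx_of rows : 'M[R]_(m.+1, n.+1)) (inord i) (inord j) = (nth [::] rows i)`_j.
Proof. by move=> im jn; rewrite mxE !inordK. Qed.

Lemma col_ofE n (s : seq R) i k : (i < n.+1)%N ->
  (col_of s : 'cV[R]_n.+1) (inord i) k = s`_i.
Proof. by move=> im; rewrite mxE !inordK. Qed.

End FourByFour.

Section Vessel.
Variables (R : realType) (c : free_coeffs R) (er ep : R).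
Implicit Types (u v r psi t : R) (x : R -> 'cV[R]_4).

Definition X_total u v r psi : R :=
  m_ship R * v * r + X_H c u v r + tau u * cos (er * r + ep * psi).

Definition Y_total u v r psi : R :=
  - (m_ship R * u * r) + Y_H c u v r + tau u * sin (er * r + ep * psi).

Definition N_total u v r psi : R :=
  N_H c u v r + x_T R * tau u * sin (er * r + ep * psi).

Definition surge_acc u v r psi : R := X_total u v r psi / (m_ship R + m_uu R).

(** Cramer's rule for the coupled sway-yaw block of the mass matrix, together with [solve_yaw]. *)
Definition solve_sway (Y N : R) : R :=
  (D_det R)^-1 * ((I_z R + m_rr R) * Y - m_vr R * N).

Definition solve_yaw (Y N : R) : R :=
  (D_det R)^-1 * (- m_rv R * Y + (m_ship R + m_vv R) * N).

Definition sway_acc u v r psi : R :=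
  solve_sway (Y_total u v r psi) (N_total u v r psi).

Definition yaw_acc u v r psi : R :=
  solve_yaw (Y_total u v r psi) (N_total u v r psi).

Definition acc (i : nat) u v r psi : R := match i with
  | 0 => surge_acc u v r psi | 1 => sway_acc u v r psi
  | 2 => yaw_acc u v r psi | _ => r end.

Lemma surge_mass_gt0 : 0 < m_ship R + m_uu R.
Proof. by rewrite /m_ship /m_uu; lra. Qed.

(** The number of columns is left free: one column gives the equations of motion, four give the
    invertibility of [mass_mx] and the entries of [A_mx]. *)
Lemma mass_mx_mul n (y z : 'M[R]_(4, n)) : mass_mx R *m y = z <-> forall k,
  [/\ y (inord 0) k = z (inord 0) k / (m_ship R + m_uu R),
      y (inord 1) k = solve_sway (z (inord 1) k) (z (inord 2) k),
      y (inord 2) k = solve_yaw (z (inord 1) k) (z (inord 2) k) &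
      y (inord 3) k = z (inord 3) k].
Proof.
have D0 : D_det R != 0 by rewrite gt_eqF ?D_det_gt0.
have m0 : m_ship R + m_uu R != 0 by rewrite gt_eqF ?surge_mass_gt0.
have row k : [/\ (mass_mx R *m y) (inord 0) k = (m_ship R + m_uu R) * y (inord 0) k,
    (mass_mx R *m y) (inord 1) k = (m_ship R + m_vv R) * y (inord 1) k + m_vr R * y (inord 2) k,
    (mass_mx R *m y) (inord 2) k = m_rv R * y (inord 1) k + (I_z R + m_rr R) * y (inord 2) k &
    (mass_mx R *m y) (inord 3) k = y (inord 3) k].
  by split; rewrite mxE sum4 !mx_ofE//= !(mul0r, mul1r, addr0, add0r).
move: D0; rewrite /solve_sway /solve_yaw /D_det.
move: (m_ship R + m_vv R) (I_z R + m_rr R) (m_rv R) (m_vr R) row => a b p q row D0.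
split=> [Myz k|yz].
  have [r0 r1 r2 r3] := row k; rewrite -Myz r0 r1 r2 r3.
  by split=> //; field.
apply/matrixP => i k; have [r0 r1 r2 r3] := row k; have [z0 z1 z2 z3] := yz k.
move: i; apply: ord4_ind.
- by rewrite r0 z0; field.
- by rewrite r1 z1 z2; field.
- by rewrite r2 z1 z2; field.
- by rewrite r3 z3.
Qed.

Lemma solutionP x : solution c er ep x <-> forall t i, 0 <= t -> (i < 4)%N ->
  is_derive t 1 (fun t => x t (inord i) 0)
    (acc i (x t (inord 0) 0) (x t (inord 1) 0) (x t (inord 2) 0) (x t (inord 3) 0)).
Proof.
split=> [sol t i t0 i4|sol t t0].
  have [dx Mx] := sol t t0.
  have dxi : derivable (fun t => x t (inord i) 0) t 1.
    by move/derivable_mxP : dx.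
  apply: DeriveDef => //.
  have -> : 'D_1 (fun t => x t (inord i) 0) t = derive1 x t (inord i) 0.
    by rewrite derive1E derive_mx// mxE.
  have [z0 z1 z2 z3] := (mass_mx_mul _ _).1 Mx 0.
  move: z0 z1 z2 z3; rewrite /force !col_ofE//= => z0 z1 z2 z3.
  by case: i i4 {dxi} => [|[|[|[|//]]]] _ /=.
have dx : derivable x t 1.
  apply/derivable_mxP => i j; rewrite (ord1 j) -(inord_val i).
  by have [dxi _] := sol t i t0 (ltn_ord i); exact: dxi.
split=> //; apply/mass_mx_mul => k; rewrite (ord1 k).
have E i : (i < 4)%N -> derive1 x t (inord i) 0 =
    acc i (x t (inord 0) 0) (x t (inord 1) 0) (x t (inord 2) 0) (x t (inord 3) 0).
  move=> i4; have [_ <-] := sol t i t0 i4.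
  by rewrite derive1E derive_mx// mxE.
by rewrite !E// /force !col_ofE//=.
Qed.

End Vessel.

(** * Comparison of norms on the state space *)

Lemma mx_norm_ge_entry (R : realType) m n (M : 'M[R]_(m, n)) i j :
  `|M i j| <= `|M|.
Proof.
by rewrite [leRHS]/Num.Def.normr/= mx_normrE; exact: (le_bigmax _ _ (i, j)).
Qed.

Lemma mx_norm_le (R : realType) m n (M : 'M[R]_(m, n)) (e : R) : 0 <= e ->
  (forall i j, `|M i j| <= e) -> `|M| <= e.
Proof.
move=> e0 Me; rewrite /Num.Def.normr/= mx_normrE.
by apply: bigmax_le => //= -[i j] _; exact: Me.
Qed.

Section Size.
Variables (R : realType) (u0 ep : R).
Implicit Types x : 'cV[R]_4.

(** Sum norm equivalent to [deviation]. The factor [(ep != 0)%:R] replaces the case distinction, and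
    sums of absolute values suit linear arithmetic. *)
Definition size_dev x : R := `|x (inord 0) 0 - u0| + `|x (inord 1) 0|
  + `|x (inord 2) 0| + (ep != 0)%:R * `|x (inord 3) 0|.

Lemma size_dev_ge0 x : 0 <= size_dev x.
Proof. by rewrite !addr_ge0 ?mulr_ge0. Qed.

Let entry x i : (i < 4)%N ->
  (x - equilibrium u0) (inord i) 0 = x (inord i) 0 - [:: u0; 0; 0; 0]`_i.
Proof. by move=> i4; rewrite !mxE inordK. Qed.

Let us_entry x (i : 'I_3) j :
  usubmx (x - equilibrium u0 : 'cV[R]_(3 + 1)) i j = (x - equilibrium u0) (inord i) 0.
Proof.
rewrite mxE (ord1 j); congr ((_ : 'cV[R]_4) _ _).
by apply/val_inj; rewrite /= inordK// ltnW// ltnS.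
Qed.

Lemma deviation_le_size x : deviation u0 ep x <= size_dev x.
Proof.
rewrite /deviation /size_dev.
have [p0 p1 p2 p3] := And4 (normr_ge0 (x (inord 0) 0 - u0))
  (normr_ge0 (x (inord 1) 0)) (normr_ge0 (x (inord 2) 0)) (normr_ge0 (x (inord 3) 0)).
have [ep0|ep0] := eqVneq ep 0.
  apply: mx_norm_le; first by rewrite !addr_ge0 ?mulr_ge0.
  move=> i j; rewrite us_entry entry; last by rewrite ltnW// ltnS.
  by case: i => -[|[|[|//]]] _ /=; rewrite ?subr0; lra.
apply: mx_norm_le; first by rewrite !addr_ge0 ?mulr_ge0.
move=> i j; rewrite (ord1 j); move: i; apply: ord4_ind; rewrite entry//= ?subr0; lra.
Qed.

Lemma size_le_deviation x : size_dev x <= 4 * deviation u0 ep x.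
Proof.
rewrite /deviation /size_dev.
have [ep0|ep0] := eqVneq ep 0.
  set M := usubmx _.
  have h i : (i < 3)%N -> `|x (inord i) 0 - [:: u0; 0; 0; 0]`_i| <= `|M|.
    move=> i3; have := mx_norm_ge_entry M (inord i) 0.
    by rewrite us_entry inordK// entry// ltnW// ltnS.
  have := h 0%N isT; have := h 1%N isT; have := h 2%N isT => /=; rewrite !subr0.
  by have := normr_ge0 M; lra.
set M := x - _.
have h i : (i < 4)%N -> `|x (inord i) 0 - [:: u0; 0; 0; 0]`_i| <= `|M|.
  by move=> i4; rewrite -entry//; exact: mx_norm_ge_entry.
have := h 0%N isT; have := h 1%N isT; have := h 2%N isT; have := h 3%N isT.
by rewrite /= !subr0; lra.
Qed.

End Size.

Section TauPolynomial.
Variable R : realType.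

Definition tau_poly : {poly R} :=
  (2 * (1 - t_ded R) * (L_pp R / T_draft R) * D_p R ^+ 4)%:P *
  \sum_(i < 6) (K_T R i)%:P * (((1 - w_wake R) / D_p R)%:P * 'X) ^+ i.

Lemma tauE : @tau R = horner tau_poly.
Proof.
apply/funext => u; rewrite /tau /tau_poly hornerM hornerC; congr (_ * _).
rewrite horner_sum; apply: eq_bigr => i _.
by rewrite hornerM hornerC horner_exp hornerM hornerC hornerX.
Qed.

Lemma derive1_tauE (u : R) : derive1 (@tau R) u = tau_poly^`().[u].
Proof. by rewrite tauE derive1E derive_val. Qed.

End TauPolynomial.

Section Linearized.
Variables (R : realType) (u0 er ep : R).

(** Entries of the linearization: [lam_u] is the surge eigenvalue; in [Bij] the rows 1, 2 belong to
    v, r and the columns 1, 2, 3 to v, r, psi. *)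
Definition lam_u : R :=
  (2 * X_u_u_ R * u0 + derive1 (@tau R) u0) / (m_ship R + m_uu R).
Definition B11 : R := p22u R * u0.
Definition B12 : R := p23u R * u0 + q23 R * tau u0 * er.
Definition B13 : R := q23 R * tau u0 * ep.
Definition B21 : R := p32u R * u0.
Definition B22 : R := p33u R * u0 + q33 R * tau u0 * er.
Definition B23 : R := q33 R * tau u0 * ep.

End Linearized.

(** * The vector field minus its linearization is quadratically small *)

Section Remainder.
Variables (R : realType) (c : free_coeffs R) (u0 er ep : R).
Hypothesis straight : straight_speed u0.

(** The bound 1 is the range of the Taylor estimate for [tau]; the bound [u0 / 2] keeps the speed
    away from 0, where its negative powers blow up. *)
Let eta : R := Num.min 1 (u0 / 2).
Let T := 'cV[R]_4.
Let uu (x : T) := x (inord 0) 0.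
Let vv (x : T) := x (inord 1) 0.
Let rr (x : T) := x (inord 2) 0.
Let pp (x : T) := x (inord 3) 0.
Let ang (x : T) := er * rr x + ep * pp x.

Let u0_gt0 : 0 < u0. Proof. by case: straight. Qed.
Let eta_gt0 : 0 < eta. Proof. by rewrite lt_min ltr01 divr_gt0. Qed.

Notation van := (vanishes (size_dev u0 ep) eta).
Let S0 := @size_dev_ge0 R u0 ep.
Let eta0 : 0 <= eta := ltW eta_gt0.

Let van01 f g : van 0 f -> van 1 g -> van 1 (fun x => f x * g x).
Proof. by move=> *; apply: (@vanishesM _ _ _ _ 0 1). Qed.
Let van10 f g : van 1 f -> van 0 g -> van 1 (fun x => f x * g x).
Proof. by move=> *; apply: (@vanishesM _ _ _ _ 1 0). Qed.
Let van11 f g : van 1 f -> van 1 g -> van 2 (fun x => f x * g x).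
Proof. by move=> *; apply: (@vanishesM _ _ _ _ 1 1). Qed.
Let van02 f g : van 0 f -> van 2 g -> van 2 (fun x => f x * g x).
Proof. by move=> *; apply: (@vanishesM _ _ _ _ 0 2). Qed.
Let van20 f g : van 2 f -> van 0 g -> van 2 (fun x => f x * g x).
Proof. by move=> *; apply: (@vanishesM _ _ _ _ 2 0). Qed.
Let van00 f g : van 0 f -> van 0 g -> van 0 (fun x => f x * g x).
Proof. by move=> *; apply: (@vanishesM _ _ _ _ 0 0). Qed.
Let vanX0 f k : van 0 f -> van 0 (fun x => f x ^+ k).
Proof. by move=> *; apply: (@vanishesX _ _ _ _ 0). Qed.
Let vanX2 f : van 1 f -> van 2 (fun x => f x ^+ 2).
Proof. by move=> *; apply: (@vanishesX _ _ _ _ 1 2). Qed.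
Let van_cst (a : R) : van 0 (fun=> a).
Proof. exact: vanishes_cst. Qed.
Let vanD k f g : van k f -> van k g -> van k (fun x => f x + g x).
Proof. exact: vanishesD. Qed.
Let vanN k f : van k f -> van k (fun x => - f x).
Proof. exact: vanishesN. Qed.
Let van_norm k f : van k f -> van k (fun x => `|f x|).
Proof. exact: vanishes_norm. Qed.
Let vanL k l f : (l <= k)%N -> van k f -> van l f.
Proof. exact: vanishes_le. Qed.
Let van_eq k f g : (forall x, f x = g x) -> van k g -> van k f.
Proof. by move=> fg; have -> : f = g by exact/funext. Qed.

Let van_id f : (forall x, `|f x| <= size_dev u0 ep x) -> van 1 f.
Proof. by move=> fS; exists 1 => // x _; rewrite mul1r expr1. Qed.

Let parts x : [/\ `|uu x - u0| <= size_dev u0 ep x, `|vv x| <= size_dev u0 ep x,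
  `|rr x| <= size_dev u0 ep x & (ep != 0)%:R * `|pp x| <= size_dev u0 ep x].
Proof.
have h : 0 <= (ep != 0)%:R * `|pp x| by rewrite mulr_ge0.
have := normr_ge0 (uu x - u0); have := normr_ge0 (vv x); have := normr_ge0 (rr x).
by rewrite /size_dev -/(uu x) -/(vv x) -/(rr x) -/(pp x); split; lra.
Qed.

Let van_w : van 1 (fun x => uu x - u0).
Proof. by apply: van_id => x; have [] := parts x. Qed.
Let van_v : van 1 vv.
Proof. by apply: van_id => x; have [] := parts x. Qed.
Let van_r : van 1 rr.
Proof. by apply: van_id => x; have [] := parts x. Qed.
Let van_ang : van 1 ang.
Proof.
apply: vanD; first exact: van01.
(* For [ep = 0] the angle is not controlled by [size_dev]; the inserted factor shows that it then
   drops out of the rudder angle as well. *)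
apply: (@van_eq 1 _ (fun x => ep * ((ep != 0)%:R * pp x))).
  move=> x; have [->|] := eqVneq ep 0; first by rewrite !mul0r.
  by rewrite mul1r.
apply: van01 => //; apply: van_id => x; have [_ _ _] := parts x.
by rewrite normrM [`|_%:R|]ger0_norm ?ler0n.
Qed.
Let van_u : van 0 uu.
Proof.
apply: (@van_eq 0 _ (fun x => (uu x - u0) + u0)) => [x|]; first by rewrite /= subrK.
by apply: vanD => //; apply: vanL van_w.
Qed.

Let van_speedV : van 0 (fun x => (speed (uu x) (vv x))^-1).
Proof.
exists (2 / u0); first by rewrite divr_ge0// ltW.
move=> x xe; rewrite expr0 mulr1.
have uge : u0 / 2 <= uu x.
  have : `|uu x - u0| <= u0 / 2.
    apply: (@le_trans _ _ (size_dev u0 ep x)).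
      by have [] := parts x.
    by apply: (le_trans xe); rewrite ge_min lexx orbT.
  by rewrite ler_norml => /andP[]; lra.
have h : u0 / 2 <= speed (uu x) (vv x).
  rewrite (le_trans uge)// (le_trans (ler_norm _))// -sqrtr_sqr.
  by rewrite ler_wsqrtr// lerDl sqr_ge0.
have h0 : 0 < u0 / 2 by rewrite divr_gt0.
rewrite gtr0_norm ?invr_gt0; last exact: lt_le_trans h.
by rewrite -invf_div lef_pV2 ?posrE//; exact: lt_le_trans h.
Qed.

Let van_tau2 : van 2 (fun x => tau (uu x) - tau u0 - derive1 (@tau R) u0 * (uu x - u0)).
Proof.
have [K K0 hK] := poly_taylor1 (tau_poly R) u0.
have [L L0 hL] := vanX2 van_w.
exists (K * L); first by rewrite mulr_ge0.
move=> x xe; rewrite derive1_tauE tauE.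
have w1 : `|uu x - u0| <= 1.
  apply: (@le_trans _ _ (size_dev u0 ep x)).
    by have [] := parts x.
  by apply: (le_trans xe); rewrite ge_min lexx.
have := hK _ w1; have -> : u0 + (uu x - u0) = uu x by ring.
move=> /le_trans; apply.
rewrite -mulrA ler_wpM2l//; apply: le_trans (hL x xe); exact: ler_norm.
Qed.

Let van_tau1 : van 1 (fun x => tau (uu x) - tau u0).
Proof.
apply: (@van_eq 1 _ (fun x => (tau (uu x) - tau u0 - derive1 (@tau R) u0 * (uu x - u0))
  + derive1 (@tau R) u0 * (uu x - u0))) => [x|]; first by rewrite /= subrK.
by apply: vanD; [exact: vanL van_tau2|exact: van01].
Qed.

Let van_tau0 : van 0 (fun x => tau (uu x)).
Proof.
apply: (@van_eq 0 _ (fun x => (tau (uu x) - tau u0) + tau u0)) => [x|].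
  by rewrite /= subrK.
by apply: vanD => //; apply: vanL van_tau1.
Qed.

Let van_sin : van 2 (fun x => sin (ang x) - ang x).
Proof.
apply: (vanishesW (vanX2 van_ang)) => x _.
by rewrite [leRHS]ger0_norm ?sqr_ge0// sin_sub_id_le.
Qed.

Let van_cos : van 2 (fun x => cos (ang x) - 1).
Proof.
apply: (vanishesW (vanX2 van_ang)) => x _.
by rewrite [leRHS]ger0_norm ?sqr_ge0// cos_sub1_le.
Qed.

Let van_v0 : van 0 vv. Proof. by apply: vanL van_v. Qed.
Let van_r0 : van 0 rr. Proof. by apply: vanL van_r. Qed.

Ltac van_leaf := first [exact: van_cst | exact: van_v | exact: van_r
  | exact: van_u | exact: van_v0 | exact: van_r0 | exact: van_ang | exact: van_speedV
  | exact: van_tau0].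

(** Searches for a distribution of the required order over the factors. Sums with a known order are
    tried before splitting, since [uu x - u0] and the like vanish to an order that their summands do
    not have. *)
Ltac van_auto := lazymatch goal with
  | |- vanishes _ _ 2 (fun x => @?f x * @?g x) => solve [apply: van11; van_auto
      | apply: van02; van_auto | apply: van20; van_auto]
  | |- vanishes _ _ 1 (fun x => @?f x * @?g x) =>
      solve [apply: van01; van_auto | apply: van10; van_auto]
  | |- vanishes _ _ 0 (fun x => @?f x * @?g x) => apply: van00; van_auto
  | |- vanishes _ _ 2 (fun x => @?f x ^+ _) => apply: vanX2; van_auto
  | |- vanishes _ _ 0 (fun x => @?f x ^+ _) => apply: vanX0; van_auto
  | |- vanishes _ _ _ (fun x => `| @?f x |) => apply: van_norm; van_auto
  | |- vanishes _ _ _ (fun x => - @?f x) => apply: vanN; van_auto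
  | |- vanishes _ _ _ (fun x => @?f x + @?g x) => first [exact: van_w
      | exact: van_tau1 | exact: van_tau2 | exact: van_sin | exact: van_cos
      | apply: vanD; van_auto]
  | _ => van_leaf
  end.

(** The equation for the straight speed removes the constant term; the rest is regrouped into
    summands that are visibly quadratic. *)
Let van_X : van 2 (fun x => X_total c er ep (uu x) (vv x) (rr x) (pp x)
  - (2 * X_u_u_ R * u0 + derive1 (@tau R) u0) * (uu x - u0)).
Proof.
have [_ e0] := straight.
apply: (@van_eq 2 _ (fun x => m_ship R * vv x * rr x + X_bg c * vv x * rr x
  + X_u_u_ R * (uu x - u0) ^+ 2
  + (tau (uu x) - tau u0 - derive1 (@tau R) u0 * (uu x - u0))
  + tau (uu x) * (cos (ang x) - 1))); last by van_auto.
move=> x; rewrite /X_total /X_H -/(ang x).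
have -> : tau u0 = - (X_u_u_ R * u0 ^+ 2) by rewrite -[LHS](addKr (X_u_u_ R * u0 ^+ 2)) e0 addr0.
ring.
Qed.

Let van_Y : van 2 (fun x => Y_total c er ep (uu x) (vv x) (rr x) (pp x)
  - (Y_b R * u0 * vv x + (Y_g R - m_ship R) * u0 * rr x + tau u0 * ang x)).
Proof.
apply: (@van_eq 2 _ (fun x => - (m_ship R * (uu x - u0) * rr x)
  + (Y_b R * (uu x - u0) * vv x + Y_g R * (uu x - u0) * rr x
  + Y_b_b_ R * vv x * `|vv x| + Y_g_g_ R * rr x * `|rr x|
  + Y_b_g_ R * vv x * `|rr x| + Y__b_g R * `|vv x| * rr x
  + Y_ab c * uu x ^+ 3 * `|vv x| * vv x * (speed (uu x) (vv x))^-1 ^+ 3)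
  + ((tau (uu x) - tau u0) * ang x + tau (uu x) * (sin (ang x) - ang x)))); last by van_auto.
move=> x; rewrite /Y_total /Y_H -/(ang x) exprVn; ring.
Qed.

Let van_N : van 2 (fun x => N_total c er ep (uu x) (vv x) (rr x) (pp x)
  - (N_b R * u0 * vv x + N_g R * u0 * rr x + x_T R * tau u0 * ang x)).
Proof.
(* The cube of [vv x] is split as [vv x * vv x ^+ 2], because [van_auto] obtains order 2 from a
   power only when it is a square. *)
apply: (@van_eq 2 _ (fun x => N_b R * (uu x - u0) * vv x
  + N_g R * (uu x - u0) * rr x + N_ugc c * uu x * `|rr x| * rr x * (speed (uu x) (vv x))^-1
  + N_g_g_ R * rr x * `|rr x| + N_b_b_ R * vv x * `|vv x|
  + N_bbg c * rr x * vv x ^+ 2 * (speed (uu x) (vv x))^-1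
  + N_bgg c * vv x * rr x ^+ 2 * (speed (uu x) (vv x))^-1
  + N_ab c * uu x * (vv x * vv x ^+ 2) * (speed (uu x) (vv x))^-1 ^+ 2
  + x_T R * ((tau (uu x) - tau u0) * ang x + tau (uu x) * (sin (ang x) - ang x)))).
  move=> x; rewrite /N_total /N_H -/(ang x) exprVn; ring.
van_auto.
Qed.

Lemma surge_remainder : van 2 (fun x =>
  surge_acc c er ep (uu x) (vv x) (rr x) (pp x) - lam_u u0 * (uu x - u0)).
Proof.
apply: (@van_eq 2 _ _ _ (van20 van_X (van_cst (m_ship R + m_uu R)^-1))) => x.
rewrite /surge_acc /lam_u; ring.
Qed.

Lemma sway_remainder : van 2 (fun x =>
  sway_acc c er ep (uu x) (vv x) (rr x) (pp x)
  - (B11 u0 * vv x + B12 u0 er * rr x + B13 u0 ep * pp x)).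
Proof.
apply: (@van_eq 2 _ _ _ (vanD (van02 (van_cst ((D_det R)^-1 * (I_z R + m_rr R))) van_Y)
  (van02 (van_cst (- ((D_det R)^-1 * m_vr R))) van_N))) => x.
rewrite /sway_acc /solve_sway /B11 /B12 /B13 /p22u /p23u /q23 /ang; ring.
Qed.

Lemma yaw_remainder : van 2 (fun x =>
  yaw_acc c er ep (uu x) (vv x) (rr x) (pp x)
  - (B21 u0 * vv x + B22 u0 er * rr x + B23 u0 ep * pp x)).
Proof.
apply: (@van_eq 2 _ _ _ (vanD (van02 (van_cst (- ((D_det R)^-1 * m_rv R))) van_Y)
  (van02 (van_cst ((D_det R)^-1 * (m_ship R + m_vv R))) van_N))) => x.
rewrite /yaw_acc /solve_yaw /B21 /B22 /B23 /p32u /p33u /q33 /ang; ring.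
Qed.

End Remainder.

(** * Global solutions of the clamped vector field *)

Section ClampedField.
Variables (R : realType) (c : free_coeffs R) (u0 er ep eta : R).
Hypothesis eta_gt0 : 0 < eta.
Hypothesis eta_le : eta <= u0 / 2.

(** On the box the surge velocity is at least [u0 - eta >= eta], so the clamped field is bounded and
    Lipschitz on the whole space, as the Picard iteration requires, and it agrees with [acc] near
    the equilibrium. *)
Definition clamped_acc (y : 'I_4 -> R) (i : 'I_4) : R :=
  acc c er ep i (clamp (u0 - eta) (u0 + eta) (y (inord 0)))
    (clamp (- eta) eta (y (inord 1))) (clamp (- eta) eta (y (inord 2)))
    (clamp (- eta) eta (y (inord 3))).

Notation bl := (@bounded_lipschitz R 4).
Let uu (y : 'I_4 -> R) := clamp (u0 - eta) (u0 + eta) (y (inord 0)).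
Let vv (y : 'I_4 -> R) := clamp (- eta) eta (y (inord 1)).
Let rr (y : 'I_4 -> R) := clamp (- eta) eta (y (inord 2)).
Let pp (y : 'I_4 -> R) := clamp (- eta) eta (y (inord 3)).

Let bl_u : bl uu. Proof. by apply: bounded_lipschitz_clamp; have := eta_gt0; lra. Qed.
Let bl_v : bl vv. Proof. by apply: bounded_lipschitz_clamp; have := eta_gt0; lra. Qed.
Let bl_r : bl rr. Proof. by apply: bounded_lipschitz_clamp; have := eta_gt0; lra. Qed.
Let bl_p : bl pp. Proof. by apply: bounded_lipschitz_clamp; have := eta_gt0; lra. Qed.
Let blC (a : R) : bl (fun=> a). Proof. exact: bounded_lipschitz_cst. Qed.
Let blD f g : bl f -> bl g -> bl (fun x => f x + g x).
Proof. exact: bounded_lipschitzD. Qed.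
Let blM f g : bl f -> bl g -> bl (fun x => f x * g x).
Proof. exact: bounded_lipschitzM. Qed.
Let blN f : bl f -> bl (fun x => - f x).
Proof. exact: bounded_lipschitzN. Qed.
Let blX f k : bl f -> bl (fun x => f x ^+ k).
Proof. exact: bounded_lipschitzX. Qed.
Let bl_norm f : bl f -> bl (fun x => `|f x|).
Proof. exact: bounded_lipschitz_norm. Qed.

Let bl_ang : bl (fun y => er * rr y + ep * pp y).
Proof. by apply: blD; apply: blM. Qed.

Let bl_sin : bl (fun y => sin (er * rr y + ep * pp y)).
Proof.
by apply: (bounded_lipschitz_comp _ _ bl_ang); [exact: sin_max|exact: sin_lipschitz].
Qed.

Let bl_cos : bl (fun y => cos (er * rr y + ep * pp y)).
Proof.
by apply: (bounded_lipschitz_comp _ _ bl_ang); [exact: cos_max|exact: cos_lipschitz].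
Qed.

Let bl_tau : bl (fun y => tau (uu y)).
Proof. by rewrite tauE; exact: bounded_lipschitz_horner. Qed.

Let bl_speedV : bl (fun y => (speed (uu y) (vv y))^-1).
Proof.
have m0 : 0 < eta ^+ 2 by rewrite exprn_gt0.
have mle y : eta ^+ 2 <= uu y ^+ 2 + vv y ^+ 2.
  have h : eta <= uu y by apply: le_trans (clamp_ge _ _ _); have := eta_le; lra.
  apply: ler_wpDr; first exact: sqr_ge0.
  by rewrite lerXn2r ?nnegrE ?(ltW eta_gt0)// (le_trans _ h)// ltW.
apply: (@bounded_lipschitzV _ _ _ (Num.sqrt (eta ^+ 2))).
- by rewrite sqrtr_gt0.
- by move=> y; rewrite ler_wsqrtr.
- by apply: (bounded_lipschitz_sqrt m0 mle); apply: blD; apply: blX.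
Qed.

Ltac bl_auto := solve [first [ exact: blC | exact: bl_u | exact: bl_v
  | exact: bl_r | exact: bl_p | exact: bl_sin | exact: bl_cos | exact: bl_tau | exact: bl_speedV
  | apply: blD; bl_auto | apply: blN; bl_auto | apply: bl_norm; bl_auto
  | apply: blM; bl_auto | apply: blX; bl_auto ]].

Let bl_eq f g : (forall y, f y = g y) -> bl g -> bl f.
Proof. by move=> fg; have -> : f = g by exact/funext. Qed.

Let bl_Y : bl (fun y => Y_total c er ep (uu y) (vv y) (rr y) (pp y)).
Proof.
apply: (@bl_eq _ (fun y => - (m_ship R * uu y * rr y) +
  (Y_b R * uu y * vv y + Y_g R * uu y * rr y + Y_b_b_ R * vv y * `|vv y|
  + Y_g_g_ R * rr y * `|rr y| + Y_b_g_ R * vv y * `|rr y|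
  + Y__b_g R * `|vv y| * rr y
  + Y_ab c * uu y ^+ 3 * `|vv y| * vv y * (speed (uu y) (vv y))^-1 ^+ 3)
  + tau (uu y) * sin (er * rr y + ep * pp y))); last by bl_auto.
by move=> y; rewrite /Y_total /Y_H exprVn.
Qed.

Let bl_N : bl (fun y => N_total c er ep (uu y) (vv y) (rr y) (pp y)).
Proof.
apply: (@bl_eq _ (fun y => (N_b R * uu y * vv y + N_g R * uu y * rr y
  + N_ugc c * uu y * `|rr y| * rr y * (speed (uu y) (vv y))^-1
  + N_g_g_ R * rr y * `|rr y| + N_b_b_ R * vv y * `|vv y|
  + N_bbg c * rr y * vv y ^+ 2 * (speed (uu y) (vv y))^-1
  + N_bgg c * vv y * rr y ^+ 2 * (speed (uu y) (vv y))^-1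
  + N_ab c * uu y * vv y ^+ 3 * (speed (uu y) (vv y))^-1 ^+ 2)
  + x_T R * tau (uu y) * sin (er * rr y + ep * pp y))); last by bl_auto.
by move=> y; rewrite /N_total /N_H exprVn.
Qed.

Let bl_acc i : bl (fun y => clamped_acc y i).
Proof.
rewrite /clamped_acc; move: i; apply: ord4_ind; rewrite inordK//=.
- by rewrite /surge_acc /X_total /X_H; bl_auto.
- by rewrite /sway_acc /solve_sway; apply: blM => //; apply: blD;
    [|apply: blN]; apply: blM.
- by rewrite /yaw_acc /solve_yaw; apply: blM => //; apply: blD; apply: blM.
Qed.

Lemma clamped_solution (x0 : 'cV[R]_4) :
  exists2 x : R -> 'cV[R]_4, x 0 = x0 &
    forall (t : R) i, 0 <= t -> is_derive t 1 (fun t => x t i 0)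
      (clamped_acc (fun j => x t j 0) i).
Proof.
have /choice[L hL] : forall i, exists L, 0 <= L /\
  ((forall y, `|clamped_acc y i| <= L) /\ forall y z (M : R), 0 <= M ->
   (forall j, `|y j - z j| <= M) -> `|clamped_acc y i - clamped_acc z i| <= L * M).
  by move=> i; have [L ? ?] := bl_acc i; exists L.
(* The sum dominates every [L i], and the added 1 makes it positive; [K] serves both as Lipschitz
   constant and as bound. *)
pose K := \sum_i L i + 1.
have LK i : L i <= K.
  rewrite /K (bigD1 i)//= -addrA lerDl addr_ge0// sumr_ge0// => j _.
  by have [] := hL j.
have K0 : 0 < K.
  by rewrite ltr_wpDl// sumr_ge0// => j _; have [] := hL j.
have [||x [x0E Dx]] := @picard_existence R 4 clamped_acc K K (fun i => x0 i 0) K0.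
- move=> y z M yz i; have [L0 [_ /(_ y z M) h]] := hL i.
  have M0 : 0 <= M by apply: le_trans (yz i).
  by rewrite (le_trans (h M0 yz))// ler_wpM2r.
- by move=> y i; have [_ [/(_ y) h _]] := hL i; exact: le_trans h _.
exists (fun t => \col_i x i t).
  by apply/matrixP => i j; rewrite mxE x0E (ord1 j).
move=> t i t0; under eq_fun do rewrite mxE.
have -> : (fun j => (\col_i0 x i0 t) j 0) = x^~ t by apply/funext => j; rewrite mxE.
exact: Dx.
Qed.

Lemma clamped_acc_id (x : 'cV[R]_4) i : size_dev u0 ep x <= eta ->
  clamped_acc (fun j => x j 0) i =
  acc c er ep i (x (inord 0) 0) (x (inord 1) 0) (x (inord 2) 0) (x (inord 3) 0).
Proof.
rewrite /size_dev /clamped_acc => xe.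
have h : 0 <= (ep != 0)%:R * `|x (inord 3) 0| by rewrite mulr_ge0.
have := normr_ge0 (x (inord 0) 0 - u0); have := normr_ge0 (x (inord 1) 0).
have := normr_ge0 (x (inord 2) 0) => h2 h1 h0.
have in_eta (a : R) : `|a| <= eta -> - eta <= a <= eta by rewrite ler_norml.
rewrite (@clamp_id _ (u0 - eta)); last first.
  have /in_eta/andP[? ?] : `|x (inord 0) 0 - u0| <= eta by lra.
  by apply/andP; split; lra.
rewrite (@clamp_id _ _ _ (x (inord 1) 0)); last by apply: in_eta; lra.
rewrite (@clamp_id _ _ _ (x (inord 2) 0)); last by apply: in_eta; lra.
(* For [ep = 0] the angle may lie far outside the box, but the field does not depend on it. *)
have [ep0|ep0] := eqVneq ep 0.
  have -> : acc c er ep i = acc c er 0 i by rewrite ep0.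
  by rewrite /acc /surge_acc /sway_acc /yaw_acc /X_total /Y_total /N_total !mul0r.
rewrite (@clamp_id _ _ _ (x (inord 3) 0))//; apply: in_eta.
by move: xe; rewrite ep0 mul1r; lra.
Qed.

End ClampedField.

(** * Stability *)

Section SchwarzCoordinates.
Variables (R : realType) (c : free_coeffs R) (u0 er ep : R).
Implicit Types x : 'cV[R]_4.

(* [X ^ 3 + char2 X ^ 2 + char1 X + char0] is the characteristic polynomial of
   the linearization in (v, r, psi). *)
Definition char2 : R := - (B11 u0 + B22 u0 er).
Definition char1 : R := B11 u0 * B22 u0 er - B12 u0 er * B21 u0 - B23 u0 ep.
Definition char0 : R := B11 u0 * B23 u0 ep - B13 u0 ep * B21 u0.
Definition schwarz3 : R := char0 / char2.
Definition schwarz2 : R := char1 - schwarz3.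

Let sg : R := (ep != 0)%:R.
Let G : R := B23 u0 ep + schwarz3.

Definition coord_w x : R := x (inord 0) 0 - u0.
(* Vanishes when [ep = 0], where [psi] decouples from the other variables. *)
Definition coord1 x : R := (ep != 0)%:R * x (inord 3) 0.
Definition coord2 x : R := x (inord 2) 0.
(** Linear part of the yaw acceleration plus [schwarz3 * coord1]. The nonlinear part is left out, so
    that the change of coordinates is linear. *)
Definition coord3 x : R := B21 u0 * x (inord 1) 0 + B22 u0 er * x (inord 2) 0
  + (B23 u0 ep + schwarz3) * coord1 x.
Definition coord_norm x : R :=
  `|coord_w x| + `|coord1 x| + `|coord2 x| + `|coord3 x|.

Let field i x := acc c er ep i (x (inord 0) 0) (x (inord 1) 0) (x (inord 2) 0)
  (x (inord 3) 0).

Definition rem_u x : R := surge_acc c er ep (x (inord 0) 0) (x (inord 1) 0)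
  (x (inord 2) 0) (x (inord 3) 0) - lam_u u0 * (x (inord 0) 0 - u0).
Definition rem_v x : R := sway_acc c er ep (x (inord 0) 0) (x (inord 1) 0)
  (x (inord 2) 0) (x (inord 3) 0)
  - (B11 u0 * x (inord 1) 0 + B12 u0 er * x (inord 2) 0 + B13 u0 ep * x (inord 3) 0).
Definition rem_r x : R := yaw_acc c er ep (x (inord 0) 0) (x (inord 1) 0)
  (x (inord 2) 0) (x (inord 3) 0)
  - (B21 u0 * x (inord 1) 0 + B22 u0 er * x (inord 2) 0 + B23 u0 ep * x (inord 3) 0).
Definition rem3 x : R := B21 u0 * rem_v x + B22 u0 er * rem_r x.

Let ep_sg : ep * sg = ep.
Proof. by rewrite /sg; have [->|] := eqVneq ep 0; rewrite ?mul0r ?mulr1. Qed.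

(** [char0] is proportional to [ep], hence [schwarz3] vanishes with it. *)
Lemma schwarz3_sg : schwarz3 * (ep != 0)%:R = schwarz3.
Proof.
by rewrite -/sg /schwarz3 /char0 /B23 /B13 -[in RHS]ep_sg; ring.
Qed.

Lemma coord_w_acc x : field 0 x = lam_u u0 * coord_w x + rem_u x.
Proof. by rewrite /field /rem_u /coord_w /=; ring. Qed.

Lemma coord2_acc x : field 2 x = - schwarz3 * coord1 x + coord3 x + rem_r x.
Proof.
have h : B23 u0 ep * sg = B23 u0 ep by rewrite /B23 -mulrA ep_sg.
rewrite /field /rem_r /coord3 /coord1 -/sg -[in X in _ = _ + (_ - X)]h /=; ring.
Qed.

Lemma coord3_acc x : char2 != 0 ->
  B21 u0 * field 1 x + B22 u0 er * field 2 x
    + (B23 u0 ep + schwarz3) * ((ep != 0)%:R * field 3 x)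
  = - schwarz2 * coord2 x - char2 * coord3 x + rem3 x.
Proof.
move=> c2.
have E : char2 * schwarz3 = char0 by rewrite /schwarz3 mulrC divfK.
have h : B23 u0 ep * sg = B23 u0 ep by rewrite /B23 -mulrA ep_sg.
have Gsg y : G * (sg * y) = G * y by rewrite mulrA /G mulrDl h schwarz3_sg.
rewrite -/G -/sg /coord3 /coord1 -/sg -/G !Gsg.
(* The two sides differ by psi times [char2 * schwarz3 - char0]; writing 0 in this form leaves a
   polynomial identity. *)
apply/eqP; rewrite -subr_eq0 -(mulr0 (x (inord 3) 0)) -(subrr char0) -{1}E.
apply/eqP; rewrite /rem3 /rem_v /rem_r /field /schwarz2 /coord2 /G /=.
by rewrite /char2 /char1 /char0; ring.
Qed.

(** The sway velocity enters the new coordinates only through [coord3], with coefficient [B21];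
    dividing by it inverts the change of coordinates. *)
Lemma coord_norm_equiv : B21 u0 != 0 -> exists A, [/\ 1 <= A,
  forall x, coord_norm x <= A * size_dev u0 ep x &
  forall x, size_dev u0 ep x <= A * coord_norm x].
Proof.
move=> b0; pose g := B23 u0 ep + schwarz3.
pose A1 := `|B21 u0| + `|B22 u0 er| + `|g|.
pose A2 := `|(B21 u0)^-1| * (1 + `|B22 u0 er| + `|g|).
have A10 : 0 <= A1 by rewrite !addr_ge0.
have A20 : 0 <= A2 by rewrite mulr_ge0// !addr_ge0.
have sizeE x : size_dev u0 ep x =
    `|coord_w x| + `|x (inord 1) 0| + `|coord2 x| + `|coord1 x|.
  by rewrite /size_dev /coord1 normrM [`|_%:R|]ger0_norm ?ler0n.
exists (1 + A1 + A2); split=> [|x|x]; first by rewrite -addrA lerDl addr_ge0.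
  have := size_dev_ge0 u0 ep x; rewrite sizeE /coord_norm.
  have [s sE] : exists s, s =
    `|coord_w x| + `|x (inord 1) 0| + `|coord2 x| + `|coord1 x| by eexists.
  rewrite -sE => s0.
  have [p0 p1 p2 p3] := And4 (normr_ge0 (coord_w x)) (normr_ge0 (x (inord 1) 0))
    (normr_ge0 (coord2 x)) (normr_ge0 (coord1 x)).
  have h3 : `|coord3 x| <= A1 * s.
    rewrite /coord3 (le_trans (ler_normD _ _))// /A1 (mulrDl _ `|g|) lerD//.
      rewrite (le_trans (ler_normD _ _))// (mulrDl `|B21 u0|).
      by rewrite lerD// normrM ler_wpM2l// sE -?/(coord2 x); lra.
    by rewrite normrM -/g ler_wpM2l// sE; lra.
  have hA2 := mulr_ge0 A20 s0.
  by rewrite (mulrDl (1 + A1)) (mulrDl 1) mul1r; lra.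
rewrite sizeE; have [s sE] : exists s, s = coord_norm x by eexists.
rewrite -sE; move: sE; rewrite /coord_norm => sE.
have [p0 p1 p2 p3] := And4 (normr_ge0 (coord_w x)) (normr_ge0 (coord1 x))
    (normr_ge0 (coord2 x)) (normr_ge0 (coord3 x)).
have s0 : 0 <= s by rewrite sE; lra.
have h1 : `|x (inord 1) 0| <= A2 * s.
  have -> : x (inord 1) 0 = (B21 u0)^-1 *
      (coord3 x + - (B22 u0 er * coord2 x) + - (g * coord1 x)).
    by rewrite /coord3 /coord2 -/g; field.
  rewrite normrM /A2 -mulrA ler_wpM2l// (mulrDl _ `|g|) (le_trans (ler_normD _ _))//.
  apply: lerD; last by rewrite normrN normrM ler_wpM2l// sE; lra.
  rewrite (mulrDl 1) mul1r (le_trans (ler_normD _ _))// normrN normrM lerD//.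
    by rewrite sE; lra.
  by rewrite ler_wpM2l// sE; lra.
have hA1 := mulr_ge0 A10 s0.
by rewrite (mulrDl (1 + A1)) (mulrDl 1) mul1r; lra.
Qed.

Lemma rem_bound : straight_speed u0 -> exists eta K, [/\ 0 < eta, eta <= u0 / 2, 0 <= K &
  forall x, size_dev u0 ep x <= eta -> [/\ `|rem_u x| <= K * size_dev u0 ep x ^+ 2,
    `|rem_r x| <= K * size_dev u0 ep x ^+ 2 & `|rem3 x| <= K * size_dev u0 ep x ^+ 2]].
Proof.
move=> straight; have [u00 _] := straight.
have [Ku Ku0 hu] := surge_remainder c er ep straight.
have [Kv Kv0 hv] := sway_remainder c er ep straight.
have [Kr Kr0 hr] := yaw_remainder c er ep straight.
have K30 : 0 <= `|B21 u0| * Kv + `|B22 u0 er| * Kr by rewrite addr_ge0 ?mulr_ge0.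
exists (Num.min 1 (u0 / 2)), (Ku + Kr + (`|B21 u0| * Kv + `|B22 u0 er| * Kr)).
split; [by rewrite lt_min ltr01 divr_gt0|by rewrite ge_min lexx orbT|
  by rewrite addr_ge0// addr_ge0|move=> x xe].
have s0 := sqr_ge0 (size_dev u0 ep x).
have ku := mulr_ge0 Ku0 s0; have kr := mulr_ge0 Kr0 s0; have k3 := mulr_ge0 K30 s0.
have {}hu := hu x xe; have {}hv := hv x xe; have {}hr := hr x xe.
have h3 : `|rem3 x| <= (`|B21 u0| * Kv + `|B22 u0 er| * Kr) * size_dev u0 ep x ^+ 2.
  rewrite /rem3 (le_trans (ler_normD _ _))// (mulrDl (`|B21 u0| * Kv)).
  rewrite -(mulrA `|B21 u0|) -(mulrA `|B22 u0 er|).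
  by apply: lerD; rewrite [leLHS]normrM ler_wpM2l.
split; rewrite !(mulrDl (_ + _) _ (size_dev u0 ep x ^+ 2)) (mulrDl Ku).
- by apply: (le_trans hu); lra.
- by apply: (le_trans hr); lra.
- by apply: (le_trans h3); lra.
Qed.

End SchwarzCoordinates.

Section DeriveHelpers.
Variable R : realType.
Implicit Types (f g : R -> R) (t k df dg : R).

Lemma is_derive_addf f g t df dg : is_derive t 1 f df -> is_derive t 1 g dg ->
  is_derive t 1 (fun s => f s + g s) (df + dg).
Proof. by move=> *; exact: (@is_deriveD _ _ _ f g). Qed.

Lemma is_derive_mulf f g t df dg : is_derive t 1 f df -> is_derive t 1 g dg ->
  is_derive t 1 (fun s => f s * g s) (f t * dg + g t * df).
Proof. by move=> *; exact: (@is_deriveM _ _ f g). Qed.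

Lemma is_derive_mulcf k f t df : is_derive t 1 f df ->
  is_derive t 1 (fun s => k * f s) (k * df).
Proof. by move=> *; exact: (@is_deriveZ _ _ _ f k). Qed.

Lemma is_derive_sqrf f t df : is_derive t 1 f df ->
  is_derive t 1 (fun s => f s ^+ 2) (2 * f t * df).
Proof.
move=> Df; apply: (is_derive_eq (is_derive_mulf Df Df)); ring.
Qed.

End DeriveHelpers.

Lemma is_derive_schwarz_form (R : realType) (b2 b3 e : R) (w x1 x2 x3 : R -> R)
    (t w' x1' x2' x3' : R) :
  is_derive t 1 w w' -> is_derive t 1 x1 x1' -> is_derive t 1 x2 x2' ->
  is_derive t 1 x3 x3' ->
  is_derive t 1 (fun s => schwarz_form b2 b3 e (w s) (x1 s) (x2 s) (x3 s))
    (schwarz_form_deriv b2 b3 e (w t) (x1 t) (x2 t) (x3 t) w' x1' x2' x3').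
Proof.
move=> Dw D1 D2 D3.
apply: (is_derive_eq (is_derive_addf (is_derive_addf (is_derive_addf
  (is_derive_sqrf Dw)
  (is_derive_mulcf b2 (is_derive_addf (is_derive_mulcf b3 (is_derive_sqrf D1))
    (is_derive_sqrf D2)))) (is_derive_sqrf D3))
  (is_derive_mulcf e (is_derive_addf
    (is_derive_mulcf (2 / b2) (is_derive_mulf D2 D3)) (is_derive_mulf D1 D2))))).
by rewrite /schwarz_form_deriv; ring.
Qed.

Section Stability.
Variables (R : realType) (c : free_coeffs R) (u0 er ep : R).
Implicit Types (x : R -> 'cV[R]_4) (t : R).

Lemma coord_derive x t (f : nat -> R) :
  (forall i, (i < 4)%N -> is_derive t 1 (fun t => x t (inord i) 0) (f i)) ->
  [/\ is_derive t 1 (fun t => coord_w u0 (x t)) (f 0%N),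
    is_derive t 1 (fun t => coord1 ep (x t)) ((ep != 0)%:R * f 3),
    is_derive t 1 (fun t => coord2 (x t)) (f 2) &
    is_derive t 1 (fun t => coord3 u0 er ep (x t))
      (B21 u0 * f 1%N + B22 u0 er * f 2
       + (B23 u0 ep + schwarz3 u0 er ep) * ((ep != 0)%:R * f 3))].
Proof.
move=> Dx.
have D0 := Dx 0%N isT; have D1 := Dx 1%N isT; have D2 := Dx 2 isT.
have D3 := is_derive_mulcf (ep != 0)%:R (Dx 3 isT).
split=> //.
- rewrite -[f 0%N]addr0.
  exact: (is_derive_addf D0 (@is_derive_cst _ _ _ (- u0) t 1)).
- exact: (is_derive_addf (is_derive_addf (is_derive_mulcf (B21 u0) D1)
    (is_derive_mulcf (B22 u0 er) D2)) (is_derive_mulcf _ D3)).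
Qed.

(** The velocities [f] have to agree with [acc] only where [size_dev] is at most [eta]. The lemma
    thus applies to true solutions and also to solutions of the clamped field, which by its
    conclusion never leave that region and so are true solutions. *)
Lemma size_dev_decay : straight_speed u0 -> lam_u u0 < 0 -> B21 u0 != 0 ->
  0 < char2 u0 er -> 0 < schwarz2 u0 er ep -> (ep != 0 -> 0 < schwarz3 u0 er ep) ->
  exists eta delta C kappa,
  [/\ [/\ 0 < eta, eta <= u0 / 2 & 0 < delta], 0 < C, 0 < kappa &
  forall x (f : nat -> R -> R),
  (forall t i, 0 <= t -> (i < 4)%N -> is_derive t 1 (fun t => x t (inord i) 0) (f i t)) ->
  (forall t i, 0 <= t -> (i < 4)%N -> size_dev u0 ep (x t) <= eta -> f i t =
    acc c er ep i (x t (inord 0) 0) (x t (inord 1) 0) (x t (inord 2) 0) (x t (inord 3) 0)) ->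
  size_dev u0 ep (x 0) < delta -> forall t, 0 <= t ->
  size_dev u0 ep (x t) <= eta /\
  size_dev u0 ep (x t) <= C * expR (- kappa * t) * size_dev u0 ep (x 0)].
Proof.
move=> straight lam0 b210 b10 b20 b3pos.
set b2 := schwarz2 u0 er ep in b20 *; set b1 := char2 u0 er in b10.
(* For [ep = 0] the Lyapunov form still needs a positive [b3], and any value will do because
   [coord1] is 0. *)
pose b3 := if ep == 0 then 1 else schwarz3 u0 er ep.
have b30 : 0 < b3 by rewrite /b3; case: eqVneq => // /b3pos.
have b3E y : b3 * coord1 ep y = schwarz3 u0 er ep * coord1 ep y.
  rewrite /b3 /coord1; have [->|//] := eqVneq ep 0.
  by rewrite !mul0r !mulr0.
have [e [k1 [k2 [k [k10 k20 k0 form_bnd form_der]]]]] :=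
  schwarz_form_lyapunov lam0 b10 b20 b30.
have [A [A1 hA hA']] := coord_norm_equiv er ep b210.
have A0 : 0 < A by exact: lt_le_trans A1.
have [eta0 [K [eta00 eta0u K0 hK]]] := rem_bound c er ep straight.
have KA0 : 0 < (K + 1) * A by rewrite mulr_gt0// ltr_wpDl.
(* Below the second threshold the quadratic remainder is at most [k] times the coordinate norm, the
   perturbation size that the Lyapunov form tolerates. *)
have [|eta eta_gt0 /and3P[eta_le0 eta_le1 _]] :=
  @pos_lower_bound R [:: eta0; k / ((K + 1) * A)].
  by rewrite /= eta00 divr_gt0.
pose W x t := schwarz_form b2 b3 e (coord_w u0 (x t)) (coord1 ep (x t))
  (coord2 (x t)) (coord3 u0 er ep (x t)).
pose sz x t := size_dev u0 ep (x t).
(* [W] is compared with the square of [size_dev] from both sides; the 4 bounds the square of a sum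
   of four terms by the sum of their squares. *)
pose H := k2 * A ^+ 2; pose G := 4 * A ^+ 2 / k1.
have H0 : 0 < H by rewrite mulr_gt0 ?exprn_gt0.
have G0 : 0 < G by rewrite divr_gt0 ?mulr_gt0 ?exprn_gt0.
have sz0 x t : 0 <= sz x t by exact: size_dev_ge0.
have WH x t : W x t <= H * sz x t ^+ 2.
  have /andP[_ h] := form_bnd (coord_w u0 (x t)) (coord1 ep (x t)) (coord2 (x t))
    (coord3 u0 er ep (x t)).
  apply: (le_trans h); rewrite /H -(mulrA k2 (A ^+ 2)) ler_wpM2l ?(ltW k20)// -exprMn.
  apply: (@le_trans _ _ (coord_norm u0 er ep (x t) ^+ 2)); last first.
    by rewrite lerXn2r ?nnegrE ?hA ?mulr_ge0 ?(ltW A0)// !addr_ge0.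
  rewrite /coord_norm.
  move: (coord_w _ _) (coord1 _ _) (coord2 _) (coord3 _ _ _ _) => y0 y1 y2 y3.
  rewrite -(real_normK (num_real y0)) -(real_normK (num_real y1)).
  rewrite -(real_normK (num_real y2)) -(real_normK (num_real y3)).
  move: (normr_ge0 y0) (normr_ge0 y1) (normr_ge0 y2) (normr_ge0 y3).
  move: `|y0| `|y1| `|y2| `|y3| => a b d g a0 b0 d0 g0.
  have := mulr_ge0 a0 b0; have := mulr_ge0 a0 d0; have := mulr_ge0 a0 g0.
  have := mulr_ge0 b0 d0; have := mulr_ge0 b0 g0; have := mulr_ge0 d0 g0; lra.
have szW x t : sz x t ^+ 2 <= G * W x t.
  have /andP[h _] := form_bnd (coord_w u0 (x t)) (coord1 ep (x t)) (coord2 (x t))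
    (coord3 u0 er ep (x t)).
  have -> : G * W x t = 4 * A ^+ 2 * (W x t / k1) by rewrite /G; field; rewrite gt_eqF.
  move: h; rewrite mulrC -ler_pdivlMr// => h.
  have p0 : 0 <= 4 * A ^+ 2 by rewrite mulr_ge0 ?exprn_ge0// ltW.
  apply: le_trans (ler_wpM2l p0 h).
  apply: (@le_trans _ _ ((A * coord_norm u0 er ep (x t)) ^+ 2)).
    by rewrite lerXn2r ?nnegrE ?sz0 ?hA' ?mulr_ge0 ?(ltW A0)// !addr_ge0.
  rewrite exprMn (mulrC 4) -(mulrA (A ^+ 2) 4) ler_wpM2l ?exprn_ge0 ?(ltW A0)// /coord_norm.
  move: (coord_w _ _) (coord1 _ _) (coord2 _) (coord3 _ _ _ _) => y0 y1 y2 y3.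
  rewrite -(real_normK (num_real y0)) -(real_normK (num_real y1)).
  rewrite -(real_normK (num_real y2)) -(real_normK (num_real y3)).
  move: `|y0| `|y1| `|y2| `|y3| => a b d g.
  have := sqr_ge0 (a - b); have := sqr_ge0 (a - d); have := sqr_ge0 (a - g).
  have := sqr_ge0 (b - d); have := sqr_ge0 (b - g); have := sqr_ge0 (d - g).
  lra.
pose C := Num.sqrt (G * H).
have GH0 : 0 < G * H by rewrite mulr_gt0.
have C0 : 0 < C by rewrite sqrtr_gt0.
have C2 : C ^+ 2 = G * H by rewrite sqr_sqrtr// ltW.
(* [W] is of the order of the squared size: the rate is halved, and a start below [eta / C] puts [W]
   below [eta ^+ 2 / G], which confines the size to [eta]. *)
exists eta, (eta / C), C, (k / 2).
split=> //.
- by split; [|exact: le_trans eta0u|rewrite divr_gt0].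
- by rewrite divr_gt0.
move=> x f Dx facc small.
pose w0 := eta ^+ 2 / G.
have W_small t : W x t < w0 -> sz x t <= eta.
  move=> Ww0; have : sz x t ^+ 2 <= eta ^+ 2.
    apply: (le_trans (szW x t)); rewrite mulrC -ler_pdivlMr//; exact: ltW.
  by rewrite ler_sqr ?nnegrE// ltW.
pose dW t := schwarz_form_deriv b2 b3 e (coord_w u0 (x t)) (coord1 ep (x t))
  (coord2 (x t)) (coord3 u0 er ep (x t)) (f 0%N t) ((ep != 0)%:R * f 3 t) (f 2 t)
  (B21 u0 * f 1%N t + B22 u0 er * f 2 t
   + (B23 u0 ep + schwarz3 u0 er ep) * ((ep != 0)%:R * f 3 t)).
have DW t : 0 <= t -> is_derive t 1 (W x) (dW t).
  move=> t0; have [D0 D1 D2 D3] := coord_derive (fun i i4 => Dx t i t0 i4).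
  exact: is_derive_schwarz_form.
have W0 t : 0 <= t -> 0 <= W x t.
  move=> _; rewrite -(pmulr_rge0 _ G0); apply: le_trans (szW x t); exact: sqr_ge0.
have Wini : W x 0 < w0.
  apply: (le_lt_trans (WH x 0)).
  rewrite /w0 ltr_pdivlMr// mulrAC [H * G]mulrC -C2 -exprMn.
  rewrite ltr_sqr ?nnegrE ?mulr_ge0 ?(ltW C0) ?(ltW eta_gt0)//.
  by rewrite mulrC -ltr_pdivlMr.
have dWle t : 0 <= t -> W x t < w0 -> dW t <= - k * W x t.
  move=> t0 /W_small se; have [//|hu hr h3] := hK (x t).
    exact: le_trans eta_le0.
  have quad y : `|y| <= K * sz x t ^+ 2 ->
      `|y| <= K * eta * A * coord_norm u0 er ep (x t).
    move=> /le_trans; apply; rewrite -2!mulrA ler_wpM2l// expr2.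
    by rewrite ler_pM// /sz ?size_dev_ge0.
  rewrite /dW !facc//.
  have cu := coord_w_acc c u0 er ep (x t); have c2 := coord2_acc c u0 er ep (x t).
  have c3 := coord3_acc c ep (x t) (lt0r_neq0 b10).
  rewrite c3 c2 cu -/b2 -/b1 mulNr -b3E -mulNr.
  apply: (form_der _ _ _ _ (ep != 0)%:R _ _ _ (K * eta * A)).
  - by rewrite ler0n lern1 leq_b1.
  - by rewrite /coord1 mulrA -natrM mulnb andbb.
  - exact: quad.
  - exact: quad.
  - exact: quad.
  - move: eta_le1; rewrite ler_pdivlMr//; apply: le_trans.
    rewrite mulrAC [eta * _]mulrC ler_wpM2r ?(ltW eta_gt0)//.
    by rewrite ler_wpM2r ?(ltW A0)// lerDl.
move=> t t0; have [Wt Wexp] := lyapunov_decay (ltW k0) DW W0 Wini dWle t0.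
split; first exact: W_small.
have -> : C * expR (- (k / 2) * t) * sz x 0 = C * sz x 0 * expR (- (k / 2) * t).
  by rewrite mulrAC.
rewrite -ler_sqr ?nnegrE ?mulr_ge0 ?size_dev_ge0 ?(ltW C0) ?expR_ge0//.
rewrite exprMn exprMn -[expR _ ^+ 2]expRM_natl.
have -> : 2%:R * (- (k / 2) * t) = - k * t by field.
apply: (le_trans (szW x t)); rewrite C2.
have -> : G * H * sz x 0 ^+ 2 * expR (- k * t) =
  G * (H * sz x 0 ^+ 2 * expR (- k * t)) by ring.
rewrite ler_wpM2l ?(ltW G0)// (le_trans Wexp)// ler_wpM2r ?expR_ge0//.
Qed.

Lemma stabilized_of_hurwitz : straight_speed u0 -> lam_u u0 < 0 -> B21 u0 != 0 ->
  0 < char2 u0 er -> 0 < schwarz2 u0 er ep -> (ep != 0 -> 0 < schwarz3 u0 er ep) ->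
  stabilized c u0 er ep.
Proof.
move=> straight lam0 b210 b10 b20 b3pos.
have [eta [delta [C [k [[eta0 etau delta0] C0 k0 decay]]]]] :=
  size_dev_decay straight lam0 b210 b10 b20 b3pos.
exists (delta / 4), (4 * C), k; split=> //; [by rewrite divr_gt0|by rewrite mulr_gt0|].
move=> x0 x0d; have sd : size_dev u0 ep x0 < delta.
  apply: (le_lt_trans (size_le_deviation _ _ _)).
  by rewrite mulrC -ltr_pdivlMr.
split.
  have [x xE Dx] := clamped_solution c er ep eta0 etau x0.
  pose f i t := clamped_acc c u0 er ep eta (fun j => x t j 0) (inord i).
  have stay t (t0 : 0 <= t) : size_dev u0 ep (x t) <= eta.
    have [|s i s0 i4 se||] := decay x f _ _ _ t t0 => //.
    - by move=> s i s0 _; exact: Dx.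
    - by rewrite /f clamped_acc_id// inordK.
    - by rewrite xE.
  exists x; split=> //; apply/solutionP => t i t0 i4.
  have := Dx t (inord i) t0; rewrite clamped_acc_id ?inordK//.
  exact: stay.
move=> x /solutionP sol xE t t0.
pose f i t := acc c er ep i (x t (inord 0) 0) (x t (inord 1) 0)
  (x t (inord 2) 0) (x t (inord 3) 0).
have small : size_dev u0 ep (x 0) < delta by rewrite xE.
have [_ h] := decay x f sol (fun t i _ _ _ => erefl) small t t0.
apply: (le_trans (deviation_le_size _ _ _)); apply: (le_trans h); rewrite xE.
have -> : 4 * C * expR (- k * t) * deviation u0 ep x0 =
  C * expR (- k * t) * (4 * deviation u0 ep x0) by ring.
by rewrite ler_wpM2l ?size_le_deviation// mulr_ge0 ?expR_ge0// ltW.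
Qed.

End Stability.

(** * Instability *)

Section UnstableForm.
Variable R : realType.
Implicit Types p q s al be x b sg ro th : R.

(** The shifts along [x3] make room for the projection onto the invariant plane in the critical
    case. *)
Definition square_form p q s al be x1 x2 x3 : R :=
  p * (x1 + al * x3) ^+ 2 + q * (x2 + be * x3) ^+ 2 + s * x3 ^+ 2.

Definition square_form_deriv p q s al be x1 x2 x3 x1' x2' x3' : R :=
  2 * p * (x1 + al * x3) * (x1' + al * x3')
  + 2 * q * (x2 + be * x3) * (x2' + be * x3') + 2 * s * x3 * x3'.

(* For [b2 < 0] the form is the opposite of the Schwarz form; at [b2 = 0] it is
   the squared norm on the invariant plane of the imaginary pair. *)
Lemma square_form_unstable b1 b2 b3 sg : 0 < b1 -> b2 <= 0 -> 0 <= b3 ->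
  b3 * sg = b3 -> exists p q s al be, 0 < q /\ forall x1 x2 x3,
  0 <= square_form_deriv p q s al be x1 x2 x3 (sg * x2) (- b3 * x1 + x3)
    (- b2 * x2 - b1 * x3).
Proof.
move=> b10 b20 b30 b3sg; move: b20; rewrite le_eqVlt => /predU1P[->|b20].
  have d0 : b1 ^+ 2 + b3 != 0 by rewrite gt_eqF// ltr_wpDr// exprn_gt0.
  (* With this [al] and [be = - al * b1], the quantities [y1 = x1 + al * x3] and [y2 = x2 + be * x3]
     obey the oscillator [y1' = y2], [y2' = - b3 * y1] when [sg = 1], whose energy is conserved. *)
  pose al := - (b1 ^+ 2 + b3)^-1.
  exists b3, 1, 0, al, (- (al * b1)); split=> // x1 x2 x3.
  have E : 1 + al * b1 ^+ 2 + al * b3 = 0 by rewrite /al; field.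
  have -> : square_form_deriv b3 1 0 al (- (al * b1)) x1 x2 x3 (sg * x2)
      (- b3 * x1 + x3) (- 0 * x2 - b1 * x3) =
      2 * (x2 - al * b1 * x3) * x3 * (1 + al * b1 ^+ 2 + al * b3)
      + 2 * (x1 + al * x3) * x2 * (b3 * sg - b3).
    by rewrite /square_form_deriv; ring.
  by rewrite E b3sg subrr !mulr0 addr0.
exists (- (b2 * b3)), (- b2), (-1), 0, 0; rewrite oppr_gt0; split=> // x1 x2 x3.
have -> : square_form_deriv (- (b2 * b3)) (- b2) (-1) 0 0 x1 x2 x3 (sg * x2)
    (- b3 * x1 + x3) (- b2 * x2 - b1 * x3) =
    2 * b1 * x3 ^+ 2 - 2 * b2 * x1 * x2 * (b3 * sg - b3).
  by rewrite /square_form_deriv; ring.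
by rewrite b3sg subrr mulr0 subr0 mulr_ge0 ?sqr_ge0// mulr_ge0// ltW.
Qed.

Lemma square_form_bound p q s al be : exists2 K, 0 <= K & forall x1 x2 x3,
  let S := `|x1| + `|x2| + `|x3| in
  square_form p q s al be x1 x2 x3 <= K * S ^+ 2 /\
  (forall x1' x2' x3' ro2 ro3 th, `|ro2| <= th -> `|ro3| <= th ->
   square_form_deriv p q s al be x1 x2 x3 x1' x2' x3' - K * S * th <=
   square_form_deriv p q s al be x1 x2 x3 x1' (x2' + ro2) (x3' + ro3)).
Proof.
pose K1 := `|p| * (1 + `|al|) ^+ 2 + `|q| * (1 + `|be|) ^+ 2 + `|s|.
pose K2 := 2 * (`|p| * ((1 + `|al|) * `|al|) + `|q| * ((1 + `|be|) * (1 + `|be|)) + `|s|).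
have al0 : 0 <= 1 + `|al| by rewrite addr_ge0.
have be0 : 0 <= 1 + `|be| by rewrite addr_ge0.
have K10 : 0 <= K1 by rewrite !addr_ge0 ?mulr_ge0 ?exprn_ge0.
have K20 : 0 <= K2 by rewrite mulr_ge0// !addr_ge0 ?mulr_ge0.
exists (K1 + K2); first exact: addr_ge0.
move=> x1 x2 x3 S.
have S0 : 0 <= S by rewrite !addr_ge0.
have [n1 n2 n3] : [/\ `|x1| <= S, `|x2| <= S & `|x3| <= S].
  have := normr_ge0 x1; have := normr_ge0 x2; have := normr_ge0 x3.
  by rewrite /S; split; lra.
have l1 : `|x1 + al * x3| <= (1 + `|al|) * S.
  by rewrite (le_trans (ler_normD _ _))// mulrDl mul1r lerD// normrM ler_wpM2l.
have l2 : `|x2 + be * x3| <= (1 + `|be|) * S.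
  by rewrite (le_trans (ler_normD _ _))// mulrDl mul1r lerD// normrM ler_wpM2l.
have sq (y B : R) : `|y| <= B -> y ^+ 2 <= B ^+ 2.
  move=> yB; rewrite -(real_normK (num_real y)) lerXn2r ?nnegrE//.
  exact: le_trans yB.
split.
  have term (a y B : R) : `|y| <= B * S -> a * y ^+ 2 <= `|a| * (B ^+ 2 * S ^+ 2).
    move=> /sq yB; rewrite -exprMn; apply: (@le_trans _ _ (`|a| * y ^+ 2)).
      by rewrite ler_wpM2r ?sqr_ge0// ler_norm.
    by rewrite ler_wpM2l.
  have h1 := term p _ _ l1; have h2 := term q _ _ l2.
  have h3 : s * x3 ^+ 2 <= `|s| * (1 ^+ 2 * S ^+ 2) by apply: term; rewrite mul1r.
  have h4 : 0 <= K2 * S ^+ 2 by rewrite mulr_ge0// sqr_ge0.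
  rewrite (mulrDl K1) /square_form /K1; move: h1 h2 h3 h4; rewrite expr1n.
  by lra.
move=> x1' x2' x3' ro2 ro3 th r2 r3.
have th0 : 0 <= th := le_trans (normr_ge0 _) r2.
have r23 : `|ro2 + be * ro3| <= (1 + `|be|) * th.
  by rewrite (le_trans (ler_normD _ _))// mulrDl mul1r lerD// normrM ler_wpM2l.
have r33 : `|al * ro3| <= `|al| * th by rewrite normrM ler_wpM2l.
have term (a y z B B' : R) : `|y| <= B * S -> `|z| <= B' * th ->
    - (`|a| * (B * B' * (S * th))) <= a * (y * z).
  move=> yB zB; have /ler_normlP[h _] : `|a * (y * z)| <= `|a| * (B * B' * (S * th)).
    rewrite normrM ler_wpM2l// (le_trans (normM_le yB zB))//.
    by rewrite mulrACA.
  by rewrite lerNl.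
have h1 := term p _ _ _ _ l1 r33; have h2 := term q _ _ _ _ l2 r23.
have h3 : - (`|s| * (1 * 1 * (S * th))) <= s * (x3 * ro3).
  by apply: term; rewrite mul1r.
have h4 : 0 <= K1 * (S * th) by rewrite mulr_ge0// mulr_ge0.
have -> : square_form_deriv p q s al be x1 x2 x3 x1' (x2' + ro2) (x3' + ro3) =
  square_form_deriv p q s al be x1 x2 x3 x1' x2' x3' +
  2 * (p * ((x1 + al * x3) * (al * ro3))) +
  2 * (q * ((x2 + be * x3) * (ro2 + be * ro3))) + 2 * (s * (x3 * ro3)).
  by rewrite /square_form_deriv; ring.
have -> : (K1 + K2) * S * th = K1 * (S * th) + K2 * (S * th) by ring.
move: h1 h2 h3 h4; rewrite /K2; lra.
Qed.

End UnstableForm.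

Lemma is_derive_square_form (R : realType) (p q s al be : R) (x1 x2 x3 : R -> R)
    (t x1' x2' x3' : R) :
  is_derive t 1 x1 x1' -> is_derive t 1 x2 x2' -> is_derive t 1 x3 x3' ->
  is_derive t 1 (fun t => square_form p q s al be (x1 t) (x2 t) (x3 t))
    (square_form_deriv p q s al be (x1 t) (x2 t) (x3 t) x1' x2' x3').
Proof.
move=> D1 D2 D3.
apply: (is_derive_eq (is_derive_addf (is_derive_addf
  (is_derive_mulcf p (is_derive_sqrf (is_derive_addf D1 (is_derive_mulcf al D3))))
  (is_derive_mulcf q (is_derive_sqrf (is_derive_addf D2 (is_derive_mulcf be D3)))))
  (is_derive_mulcf s (is_derive_sqrf D3)))).
by rewrite /square_form_deriv; ring.
Qed.

Section Instability.
Variables (R : realType) (c : free_coeffs R) (u0 er ep : R).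

Lemma not_stabilized : straight_speed u0 -> B21 u0 != 0 -> 0 < char2 u0 er ->
  schwarz2 u0 er ep <= 0 -> 0 <= schwarz3 u0 er ep -> ~ stabilized c u0 er ep.
Proof.
move=> straight b210 b10 b20 b30 [delta [C [k [delta0 C0 k0 stab]]]].
have [p [q [s [al [be [q0 Qge0]]]]]] :=
  square_form_unstable b10 b20 b30 (schwarz3_sg u0 er ep).
have [K K0 Kbnd] := square_form_bound p q s al be.
have [A [A1 hA _]] := coord_norm_equiv er ep b210.
have A0 : 0 < A by exact: lt_le_trans A1.
have [eta [Kr [eta0 _ Kr0 hKr]]] := rem_bound c er ep straight.
(* The start has size [m * d], decay bounds the later size by [g * d * expR (- k * t)], and
   [Gam * d ^+ 3] bounds the integrated effect of the remainder on the form. *)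
have [m mE] : exists m, m = 1 + `|B22 u0 er / B21 u0| by eexists.
have m0 : 0 < m by rewrite mE ltr_wpDr.
have [g gE] : exists g, g = 4 * C * m by eexists.
have g0 : 0 < g by rewrite gE !mulr_gt0.
have [Gam GamE] : exists Gam, Gam = K * A * Kr * g ^+ 3 / k by eexists.
have Gam0 : 0 <= Gam.
  by rewrite GamE divr_ge0 ?(ltW k0)// !mulr_ge0 ?exprn_ge0// ltW.
(* The thresholds place the start in the stability neighbourhood, keep the solution where the
   remainder estimate holds, and force [Gam * d < q]. *)
have [|d d0 /and4P[d1 d2 d3 _]] :=
  @pos_lower_bound R [:: delta / (2 * m); eta / g; q / (2 * (Gam + 1))].
  by rewrite /= !divr_gt0 ?mulr_gt0// ltr_wpDl.
(* The sway velocity is tuned so that [coord3] vanishes, as does [coord1]; the form at the start is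
   then [q * d ^+ 2 > 0]. *)
pose x0 : 'cV[R]_4 := col_of [:: u0; - (B22 u0 er / B21 u0) * d; d; 0].
have size0 : size_dev u0 ep x0 = m * d.
  rewrite /size_dev !col_ofE//= subrr normr0 add0r mulr0 addr0 normrM normrN.
  by rewrite [`|d|]gtr0_norm// mE (mulrDl 1) mul1r addrC.
have dev0 : deviation u0 ep x0 < delta.
  apply: (le_lt_trans (deviation_le_size _ _ _)); rewrite size0.
  have : d * (2 * m) <= delta by rewrite -ler_pdivlMr// mulr_gt0.
  by have := mulr_gt0 m0 d0; lra.
have [[x [sol xE]] /(_ _) decay] := stab x0 dev0.
have {}decay := decay x sol xE.
have sizet (t : R) : 0 <= t -> size_dev u0 ep (x t) <= expR (- k * t) * (g * d).
  move=> t0; apply: (le_trans (size_le_deviation _ _ _)).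
  apply: (@le_trans _ _ (4 * (C * expR (- k * t) * (m * d)))).
    rewrite ler_wpM2l// (le_trans (decay t t0))// ler_wpM2l//.
      by rewrite mulr_ge0 ?expR_ge0// ltW.
    by rewrite -size0 deviation_le_size.
  by rewrite gE le_eqVlt; apply/orP; left; apply/eqP; ring.
have E1 (t : R) : 0 <= t -> expR (- k * t) <= 1.
  by move=> t0; rewrite -expR0 ler_expR mulNr oppr_le0 mulr_ge0// ltW.
have gd0 : 0 < g * d by rewrite mulr_gt0.
have size_small (t : R) : 0 <= t -> size_dev u0 ep (x t) <= eta.
  move=> t0; apply: (le_trans (sizet t t0)).
  apply: (@le_trans _ _ (1 * (g * d))); first by rewrite ler_wpM2r ?E1// ltW.
  by rewrite mul1r mulrC -ler_pdivlMr.
(* One exponential factor is kept from each power, matching the form of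
   [not_decaying_of_derive_ge]. *)
have sizeX (t : R) n : 0 <= t ->
    size_dev u0 ep (x t) ^+ n.+1 <= expR (- k * t) * (g * d) ^+ n.+1.
  move=> t0; apply: (@le_trans _ _ ((expR (- k * t) * (g * d)) ^+ n.+1)).
    rewrite lerXn2r ?nnegrE ?size_dev_ge0 ?sizet// mulr_ge0 ?expR_ge0//.
    exact: ltW.
  rewrite exprMn ler_wpM2r ?exprn_ge0 ?(ltW gd0)// exprS.
  by rewrite ler_piMr ?expR_ge0// exprn_ile1 ?expR_ge0 ?E1.
pose f i t := acc c er ep i (x t (inord 0) 0) (x t (inord 1) 0)
  (x t (inord 2) 0) (x t (inord 3) 0).
pose c1 t := coord1 ep (x t); pose c2 t := coord2 (x t).
pose c3 t := coord3 u0 er ep (x t).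
pose Q t := square_form p q s al be (c1 t) (c2 t) (c3 t).
pose dQ t := square_form_deriv p q s al be (c1 t) (c2 t) (c3 t)
  ((ep != 0)%:R * f 3 t) (f 2 t) (B21 u0 * f 1%N t + B22 u0 er * f 2 t
   + (B23 u0 ep + schwarz3 u0 er ep) * ((ep != 0)%:R * f 3 t)).
have DQ (t : R) : 0 <= t -> is_derive t 1 Q (dQ t).
  move=> t0; have [_ D1 D2 D3] :=
    coord_derive u0 er ep (fun i i4 => (solutionP c er ep x).1 sol t i t0 i4).
  exact: is_derive_square_form.
have Sle (t : R) : `|c1 t| + `|c2 t| + `|c3 t| <= A * size_dev u0 ep (x t).
  apply: le_trans (hA (x t)); rewrite /coord_norm -/(c1 t) -/(c2 t) -/(c3 t).
  by have := normr_ge0 (coord_w u0 (x t)); lra.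
have Qle (t : R) : 0 <= t -> Q t <= K * A ^+ 2 * (g * d) ^+ 2 * expR (- k * t).
  move=> t0; have [h _] := Kbnd (c1 t) (c2 t) (c3 t); apply: (le_trans h).
  have -> : K * A ^+ 2 * (g * d) ^+ 2 * expR (- k * t) =
    K * (A ^+ 2 * (expR (- k * t) * (g * d) ^+ 2)) by ring.
  rewrite ler_wpM2l//.
  apply: (@le_trans _ _ ((A * size_dev u0 ep (x t)) ^+ 2)).
    by rewrite lerXn2r ?nnegrE ?Sle ?mulr_ge0 ?size_dev_ge0 ?(ltW A0)// !addr_ge0.
  by rewrite exprMn ler_wpM2l ?sizeX// exprn_ge0// ltW.
have dQge (t : R) : 0 <= t -> - (k * (Gam * d ^+ 3) * expR (- k * t)) <= dQ t.
  move=> t0; have [_ hr h3] := hKr (x t) (size_small t t0).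
  have [_ h] := Kbnd (c1 t) (c2 t) (c3 t).
  have e2 := coord2_acc c u0 er ep (x t).
  have e3 := coord3_acc c ep (x t) (lt0r_neq0 b10).
  rewrite /dQ /f e3 e2; apply: le_trans (h _ _ _ _ _ _ hr h3).
  have h0 := Qge0 (c1 t) (c2 t) (c3 t).
  rewrite -/(c1 t) -/(c2 t) -/(c3 t).
  have : K * (`|c1 t| + `|c2 t| + `|c3 t|) * (Kr * size_dev u0 ep (x t) ^+ 2)
      <= k * (Gam * d ^+ 3) * expR (- k * t); last first.
    by move: h0; rewrite /f /acc -/(c2 t); lra.
  have -> : k * (Gam * d ^+ 3) * expR (- k * t) =
    K * A * Kr * (expR (- k * t) * (g * d) ^+ 3).
    by rewrite GamE; field; rewrite gt_eqF.
  apply: (@le_trans _ _ (K * A * Kr * size_dev u0 ep (x t) ^+ 3)).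
    have -> : K * A * Kr * size_dev u0 ep (x t) ^+ 3 =
      K * (A * size_dev u0 ep (x t)) * (Kr * size_dev u0 ep (x t) ^+ 2) by ring.
    rewrite ler_wpM2r ?mulr_ge0 ?exprn_ge0 ?size_dev_ge0//.
    by rewrite ler_wpM2l.
  by rewrite ler_wpM2l ?sizeX// !mulr_ge0// ltW.
have := not_decaying_of_derive_ge k0 DQ dQge Qle.
have -> : Q 0 = q * d ^+ 2.
  rewrite /Q /c1 /c2 /c3 /coord3 /coord1 /coord2 xE /x0 !col_ofE//=.
  have -> : B21 u0 * (- (B22 u0 er / B21 u0) * d) + B22 u0 er * d = 0.
    by field.
  by rewrite /square_form !(mulr0, addr0, add0r) expr0n/= !(mulr0, addr0, add0r).
rewrite leNgt => /negP; apply.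
have -> : Gam * d ^+ 3 = Gam * d * d ^+ 2 by ring.
rewrite ltr_pM2r ?exprn_gt0//.
move: d3; rewrite ler_pdivlMr ?mulr_gt0 ?ltr_wpDl// => d3.
have := mulr_ge0 Gam0 (ltW d0); lra.
Qed.

End Instability.

(** * Eigenvalues *)

Section SmallDeterminants.
Variable K : comNzRingType.

Lemma det2 (M : 'M[K]_2) : \det M =
  let a i j := M (inord i) (inord j) in
  a 0%N 0%N * a 1%N 1%N - a 0%N 1%N * a 1%N 0%N.
Proof.
have [a E] : exists a : nat -> nat -> K, forall i j : 'I_2, M i j = a i j.
  by exists (fun i j => M (inord i) (inord j)) => i j; rewrite !inord_val.
rewrite (expand_det_row M 0) !big_ord_recl big_ord0 /cofactor !det_mx11 !mxE.
by rewrite !E /= /bump /= !inordK//= !(addn0, add0n, expr0, expr1, add1n, addn1)/=; ring.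
Qed.

Lemma det3 (M : 'M[K]_3) : \det M =
  let a i j := M (inord i) (inord j) in
  a 0%N 0%N * (a 1%N 1%N * a 2%N 2%N - a 1%N 2%N * a 2%N 1%N)
  - a 0%N 1%N * (a 1%N 0%N * a 2%N 2%N - a 1%N 2%N * a 2%N 0%N)
  + a 0%N 2%N * (a 1%N 0%N * a 2%N 1%N - a 1%N 1%N * a 2%N 0%N).
Proof.
have [a E] : exists a : nat -> nat -> K, forall i j : 'I_3, M i j = a i j.
  by exists (fun i j => M (inord i) (inord j)) => i j; rewrite !inord_val.
rewrite (expand_det_row M 0) !big_ord_recl big_ord0 /cofactor !det2 /= !mxE.
by rewrite !E /= /bump /= !inordK//= /bump /= !(addn0, add0n, add1n, addn1)/=; ring.
Qed.

Lemma det4_first_row (M : 'M[K]_4) :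
  (forall j, (0 < j < 4)%N -> M (inord 0) (inord j) = 0) -> \det M =
  let a i j := M (inord i) (inord j) in a 0%N 0%N * (
  a 1%N 1%N * (a 2%N 2%N * a 3%N 3%N - a 2%N 3%N * a 3%N 2%N)
  - a 1%N 2%N * (a 2%N 1%N * a 3%N 3%N - a 2%N 3%N * a 3%N 1%N)
  + a 1%N 3%N * (a 2%N 1%N * a 3%N 2%N - a 2%N 2%N * a 3%N 1%N)).
Proof.
move=> M0.
have [a E] : exists a : nat -> nat -> K, forall i j : 'I_4, M i j = a i j.
  by exists (fun i j => M (inord i) (inord j)) => i j; rewrite !inord_val.
have a0 j : (0 < j < 4)%N -> a 0%N j = 0.
  by move=> j4; have := M0 j j4; rewrite E !inordK//; case/andP: j4.
rewrite (expand_det_row M 0) !big_ord_recl big_ord0.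
rewrite /cofactor !det3 /= !mxE !E /= /bump /= !inordK//= /bump /=.
by rewrite !(addn0, add0n, add1n, addn1) (a0 1%N)// (a0 2%N)// (a0 3%N)// !mul0r !addr0 expr0 mul1r.
Qed.

End SmallDeterminants.

Lemma horner_map_cubic (R : realType) (l p q r : R) (z : R[i]) :
  (map_poly (real_complex R)
    (('X - l%:P) * ('X^3 + p%:P * 'X^2 + q%:P * 'X + r%:P))).[z]
  = (z - l%:C%C) * (z ^+ 3 + p%:C%C * z ^+ 2 + q%:C%C * z + r%:C%C).
Proof.
rewrite rmorphM hornerM; congr (_ * _).
  by rewrite rmorphB /= map_polyX map_polyC hornerD hornerN hornerC hornerX.
rewrite rmorphD rmorphD rmorphD (rmorphM _ p%:P) (rmorphM _ q%:P) !rmorphXn /=.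
rewrite !map_polyC !map_polyX !hornerD !hornerXn.
rewrite (hornerM (p%:C%C)%:P) (hornerM (q%:C%C)%:P).
by rewrite !hornerXn !hornerC hornerX.
Qed.

Section Spectrum.
Variables (R : realType) (u0 er ep : R).

Lemma mass_mx_unit : mass_mx R \in unitmx.
Proof.
pose y : 'M[R]_4 := \matrix_(i, j) let e k := (1%:M : 'M[R]_4) (inord k) j in
  match nat_of_ord i with
  | 0 => e 0%N / (m_ship R + m_uu R) | 1 => solve_sway (e 1%N) (e 2)
  | 2 => solve_yaw (e 1%N) (e 2) | _ => e 3 end.
have /mass_mx_mul : forall k,
  [/\ y (inord 0) k = (1%:M : 'M[R]_4) (inord 0) k / (m_ship R + m_uu R),
      y (inord 1) k = solve_sway ((1%:M : 'M[R]_4) (inord 1) k) ((1%:M : 'M[R]_4) (inord 2) k),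
      y (inord 2) k = solve_yaw ((1%:M : 'M[R]_4) (inord 1) k) ((1%:M : 'M[R]_4) (inord 2) k) &
      y (inord 3) k = (1%:M : 'M[R]_4) (inord 3) k].
  by move=> k; split; rewrite [LHS]mxE inordK.
by move=> /mulmx1_unit[].
Qed.

Lemma A_mxE : A_mx u0 er ep = mx_of
  [:: [:: lam_u u0; 0; 0; 0];
      [:: 0; B11 u0; B12 u0 er; B13 u0 ep];
      [:: 0; B21 u0; B22 u0 er; B23 u0 ep];
      [:: 0; 0; 1; 0]].
Proof.
apply: (canLR (mulKmx mass_mx_unit)); apply/esym/mass_mx_mul => k.
rewrite -(inord_val k) /J_mx; case: k => -[|[|[|[|//]]]] kn; rewrite !mx_ofE//=.
- by rewrite /solve_sway /solve_yaw !(mul0r, mulr0, subr0, addr0).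
- by rewrite /solve_sway /solve_yaw !(mul0r, mulr0, subr0, addr0) /B11 /B21 /p22u /p32u;
    split=> //; ring.
- by rewrite /solve_sway /solve_yaw !(mul0r, mulr0, subr0, addr0) /B12 /B22 /p23u /p33u /q23 /q33;
    split=> //; ring.
- by rewrite /solve_sway /solve_yaw !(mul0r, mulr0, subr0, addr0) /B13 /B23 /q23 /q33;
    split=> //; ring.
Qed.

Lemma char_poly_A : char_poly (A_mx u0 er ep) = ('X - (lam_u u0)%:P) *
  ('X^3 + (char2 u0 er)%:P * 'X^2 + (char1 u0 er ep)%:P * 'X + (char0 u0 ep)%:P).
Proof.
rewrite /char_poly A_mxE det4_first_row /=; last first.
  move=> j /andP[j0 j4]; rewrite !mxE -val_eqE/= !inordK//=.
  by rewrite ltn_eqF// mulr0n; case: j j0 j4 => [//|[|[|[|//]]]] _ _ /=; rewrite subrr.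
rewrite !mxE -!val_eqE/= !inordK//= /char2 /char1 /char0.
move: (lam_u u0) (B11 u0) (B12 u0 er) (B13 u0 ep) (B21 u0) (B22 u0 er) (B23 u0 ep).
move=> l a b d e f g; rewrite !(polyCD, polyCM, polyCN, polyC0, polyC1) !mulr0n !mulr1n.
ring.
Qed.

Lemma S_mxE : S_mx u0 er ep = mx_of
  [:: [:: lam_u u0; 0; 0]; [:: 0; B11 u0; B12 u0 er]; [:: 0; B21 u0; B22 u0 er]].
Proof.
apply/matrixP => i j; rewrite /S_mx A_mxE 2![LHS]mxE !mxE /=.
by case: i => -[|[|[|//]]] ?; case: j => -[|[|[|//]]] ?.
Qed.

Lemma char_poly_S : char_poly (S_mx u0 er ep) = ('X - (lam_u u0)%:P) *
  ('X^2 + (char2 u0 er)%:P * 'X + (B11 u0 * B22 u0 er - B12 u0 er * B21 u0)%:P).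
Proof.
rewrite /char_poly S_mxE det3 /= !mxE -!val_eqE/= !inordK//= /char2.
move: (lam_u u0) (B11 u0) (B12 u0 er) (B21 u0) (B22 u0 er).
move=> l a b d e; rewrite !(polyCD, polyCM, polyCN, polyC0, polyC1) !mulr0n !mulr1n.
ring.
Qed.

Lemma A_eigenvalueE (z : R[i]) : A_eigenvalue u0 er ep z =
  ((z - (lam_u u0)%:C%C) * (z ^+ 3 + (char2 u0 er)%:C%C * z ^+ 2
    + (char1 u0 er ep)%:C%C * z + (char0 u0 ep)%:C%C) == 0).
Proof.
by rewrite /A_eigenvalue eigenvalue_root_char -map_char_poly char_poly_A /root
  horner_map_cubic.
Qed.

(** The hypotheses are Vieta's relations for the real root [l] and the pair [a +i* b], [a -i* b]. *)
Lemma A_eigenvalue_pair (l a b : R) : char2 u0 er = - (l + 2 * a) ->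
  char1 u0 er ep = 2 * a * l + (a ^+ 2 + b ^+ 2) ->
  char0 u0 ep = - (l * (a ^+ 2 + b ^+ 2)) ->
  forall z, A_eigenvalue u0 er ep z = [|| z == (a +i* b)%C, z == (a -i* b)%C,
    z == (lam_u u0)%:C%C | z == l%:C%C].
Proof.
move=> h2 h1 h0 z; rewrite A_eigenvalueE h2 h1 h0.
have S : (a +i* b)%C + (a -i* b)%C = (2 * a)%:C%C.
  by apply/eqP; rewrite eq_complex /= subrr eqxx andbT; apply/eqP; ring.
have P : (a +i* b)%C * (a -i* b)%C = (a ^+ 2 + b ^+ 2)%:C%C.
  by apply/eqP; rewrite eq_complex /=; apply/andP; split; apply/eqP; ring.
have -> : z ^+ 3 + (- (l + 2 * a))%:C%C * z ^+ 2 + (2 * a * l + (a ^+ 2 + b ^+ 2))%:C%C * z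
    + (- (l * (a ^+ 2 + b ^+ 2)))%:C%C =
    (z - l%:C%C) * ((z - (a +i* b)%C) * (z - (a -i* b)%C)).
  move: S P; rewrite !(rmorphN, rmorphD, rmorphM) /=.
  move: (a +i* b)%C (a -i* b)%C => p q S P; rewrite -P -S.
  ring.
rewrite !mulf_eq0 !subr_eq0.
by case: (z == _); case: (z == _); case: (z == _); case: (z == _).
Qed.

End Spectrum.

(** * Sign change of a quadratic, and continuation of roots near the crossing *)

Section Crossing.
Variable R : realType.
Implicit Types s y : R.

(** Once a positive root [sc] is found, the polynomial is [s - sc] times [al * s - ga / sc], and the
    second factor is positive for [s >= 0] because [ga < 0]. *)
Lemma quadratic_sign_change (al be ga : R) : 0 <= al -> ga < 0 ->
  (al = 0 -> 0 < be) -> exists2 sc, 0 < sc &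
  forall s, 0 <= s -> Num.sg (al * s ^+ 2 + be * s + ga) = Num.sg (s - sc).
Proof.
move=> al0 ga0 be0.
have [sc sc0 root_sc] : exists2 sc, 0 < sc & al * sc ^+ 2 + be * sc + ga = 0.
  move: al0; rewrite le_eqVlt => /predU1P[al0|al0].
    have be0' := be0 (esym al0); exists (- ga / be).
      by rewrite divr_gt0// oppr_gt0.
    by rewrite -al0; field; rewrite gt_eqF.
  pose d := be ^+ 2 - 4 * al * ga.
  have hd : be ^+ 2 < d by rewrite /d ltrDl oppr_gt0 nmulr_llt0// mulr_gt0.
  have d0 : 0 <= d by apply: ltW; apply: le_lt_trans hd; exact: sqr_ge0.
  have q2 : Num.sqrt d ^+ 2 = d by rewrite sqr_sqrtr.
  exists ((- be + Num.sqrt d) / (2 * al)).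
    rewrite divr_gt0 ?mulr_gt0// addrC subr_gt0 (le_lt_trans (ler_norm _))//.
    rewrite -sqrtr_sqr ltr_sqrt//; apply: le_lt_trans hd; exact: sqr_ge0.
  have -> : al * ((- be + Num.sqrt d) / (2 * al)) ^+ 2 +
      be * ((- be + Num.sqrt d) / (2 * al)) + ga =
      (Num.sqrt d ^+ 2 - (be ^+ 2 - 4 * al * ga)) / (4 * al).
    by field; rewrite gt_eqF.
  by rewrite q2 subrr mul0r.
exists sc => // s s0.
have -> : al * s ^+ 2 + be * s + ga = (s - sc) * (al * s - ga / sc).
  have -> : be = - (al * sc ^+ 2 + ga) / sc.
    by apply: (mulIf (lt0r_neq0 sc0)); rewrite divfK ?gt_eqF//; lra.
  by field; rewrite gt_eqF.
rewrite sgrM [X in _ * X]gtr0_sg ?mulr1//.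
rewrite ltr_wpDl ?mulr_ge0// oppr_gt0 pmulr_llt0//.
by rewrite invr_gt0.
Qed.

Lemma near_ball (sc : R) (P : R -> Prop) : (\forall s \near sc, P s) ->
  exists2 rho, 0 < rho & forall s, `|s - sc| < rho -> P s.
Proof.
move=> /nbhs_ballP[rho rho0 hP]; exists rho => // s ssc; apply: hP.
by rewrite /ball/= distrC.
Qed.

(* If [l], [a +i* b] and [a -i* b] are the roots of the cubic, then [y = - 2 a]
   satisfies this equation, so that [a] has the sign of [- h] while [c1 > 0]. *)
Lemma crossing_pair (c2 c1 h : R -> R) (sc : R) :
  continuous c2 -> continuous c1 -> continuous h ->
  0 < c2 sc -> 0 < c1 sc -> h sc = 0 -> exists (rho : R) (y : R -> R), 0 < rho /\
  forall s, `|s - sc| < rho -> [/\ {for s, continuous y},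
    y s * ((y s - c2 s) ^+ 2 + c1 s) = h s, 0 < c1 s, y s < c2 s &
    0 < c1 s + y s * (y s - c2 s) - y s ^+ 2 / 4].
Proof.
move=> cc2 cc1 ch c20 c10 h0.
pose m := c1 sc / 2; pose M := 2 * c2 sc.
have m0 : 0 < m by rewrite divr_gt0.
have M0 : 0 < M by rewrite mulr_gt0.
(* The first threshold keeps [y] below [c2]; the second makes the left-hand side increase in [y]
   with slope at least [m / 2] on [[- eta, eta]]. *)
have [|eta eta0 /and3P[eta1 eta2 _]] := @pos_lower_bound R [:: c2 sc / 4; m / (8 * M)].
  by rewrite /= !divr_gt0 ?mulr_gt0.
have {}eta2 : eta * (8 * M) <= m by rewrite -ler_pdivlMr ?mulr_gt0.
have em0 : 0 < eta * m by rewrite mulr_gt0.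
have [rho rho0 hrho] : exists2 rho, 0 < rho & forall s, `|s - sc| < rho ->
    [/\ m < c1 s, c2 sc / 2 < c2 s, c2 s < M, - (eta * m) < h s & h s < eta * m].
  apply: near_ball; near=> s; split; near: s.
  - by apply: (cvgr_gt _ (cc1 sc)); rewrite /m; lra.
  - by apply: (cvgr_gt _ (cc2 sc)); lra.
  - by apply: (cvgr_lt _ (cc2 sc)); rewrite /M; lra.
  - by apply: (cvgr_gt _ (ch sc)); rewrite h0 oppr_lt0.
  - by apply: (cvgr_lt _ (ch sc)); rewrite h0.
have /choice[y hy] : forall s, exists y, `|s - sc| < rho ->
    - eta <= y <= eta /\ y * ((y - c2 s) ^+ 2 + c1 s) = h s.
  move=> s; have [|_] := ltP `|s - sc| rho; last by exists 0.
  move=> /hrho[h1 h2 h3 h4 h5].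
  pose p := 'X * (('X - (c2 s)%:P) ^+ 2 + (c1 s)%:P) - (h s)%:P.
  have pE y : p.[y] = y * ((y - c2 s) ^+ 2 + c1 s) - h s by rewrite /p !hornerE.
  have [||y yeta /rootP] := @poly_ivt R p (- eta) eta.
  - by rewrite ge0_cp// ltW.
  - rewrite !pE; have sq1 := mulr_ge0 (ltW eta0) (sqr_ge0 (- eta - c2 s)).
    have sq2 := mulr_ge0 (ltW eta0) (sqr_ge0 (eta - c2 s)).
    have := ltr_pM2l eta0 m (c1 s); rewrite h1 => h6.
    by apply/andP; split; lra.
  by rewrite pE => /eqP; rewrite subr_eq0 => /eqP hy; exists y.
have ybnd s (t : R) : `|s - sc| < rho -> - eta <= t <= eta -> `|t * c2 s| <= eta * M.
  move=> /hrho[h1 h2 h3 h4 h5] /andP[t1 t2].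
  apply: normM_le; first by rewrite ler_norml t1.
  by rewrite ger0_norm; lra.
have mono s (t : R) : `|s - sc| < rho -> - eta <= t <= eta ->
    `|y s - t| * (m / 2) <= `|t * ((t - c2 s) ^+ 2 + c1 s) - h s|.
  move=> srho teta; have [h1 h2 h3 h4 h5] := hrho s srho.
  have [yeta yE] := hy s srho.
  rewrite -yE [leRHS]distrC.
  have -> : y s * ((y s - c2 s) ^+ 2 + c1 s) - t * ((t - c2 s) ^+ 2 + c1 s) =
    (y s - t) * (y s ^+ 2 + y s * t + t ^+ 2 - 2 * (y s * c2 s + t * c2 s)
    + c2 s ^+ 2 + c1 s) by ring.
  rewrite [leRHS]normrM ler_wpM2l// (le_trans _ (ler_norm _))//.
  have := ybnd s _ srho yeta; rewrite ler_norml => /andP[_ h6].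
  have := ybnd s _ srho teta; rewrite ler_norml => /andP[_ h7].
  have := sqr_ge0 (y s + t); have := sqr_ge0 (y s); have := sqr_ge0 t.
  by have := sqr_ge0 (c2 s); lra.
exists rho, y; split=> // s srho.
have [h1 h2 h3 h4 h5] := hrho s srho; have [yeta yE] := hy s srho.
have := ybnd s _ srho yeta; rewrite ler_norml => /andP[h6 h7].
have [y1 y2] := andP yeta.
split=> //; [|by lra|by lra|by have := sqr_ge0 (y s); lra].
(* The value [y s] is frozen while the parameter moves: [mono] bounds the distance from [y r] to
   [y s] by a multiple of [G r], which tends to [G s = 0]. *)
pose G r := y s * ((y s - c2 r) ^+ 2 + c1 r) - h r.
have cG : {for s, continuous G}.
  apply: cvgB; last exact: ch.
  apply: cvgM; first exact: cvg_cst.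
  apply: cvgD; last exact: cc1.
  by apply: cvgM; apply: cvgB; [exact: cvg_cst|exact: cc2|exact: cvg_cst|exact: cc2].
have G0 : G s = 0 by rewrite /G yE subrr.
apply/cvgrPdist_le => e e0; near=> r.
have rrho : `|r - sc| < rho.
  near: r; apply/nbhs_ballP; exists (rho - `|s - sc|) => [|r]; rewrite /= ?subr_gt0//.
  rewrite /ball/= => sr; have -> : r - sc = (s - sc) - (s - r) by ring.
  by apply: le_lt_trans (ler_normB _ _) _; lra.
have Gr : `|G s - G r| <= e * (m / 2).
  near: r; have em : 0 < e * (m / 2) by rewrite mulr_gt0// divr_gt0.
  by move/cvgrPdist_le: cG => /(_ _ em).
have m20 : 0 < m / 2 by rewrite divr_gt0.
rewrite -(ler_pM2r m20) distrC (le_trans (mono r (y s) rrho yeta))//.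
by move: Gr; rewrite G0 sub0r normrN.
Unshelve. all: by end_near. Qed.

End Crossing.

Section RealCrossing.
Variable R : realType.

(** Quadratic formula for [X ^ 2 + c2 X + c1]. The positive discriminant separates [l] from [l'],
    and continuity from [l sc = 0] separates it from [lam], so that it stays simple. *)
Lemma crossing_real (c2 c1 : R -> R) (sc lam : R) :
  continuous c2 -> continuous c1 -> 0 < c2 sc -> c1 sc = 0 -> lam < 0 ->
  exists (rho : R) (l l' : R -> R), 0 < rho /\ forall s, `|s - sc| < rho ->
  [/\ {for s, continuous l}, l s + l' s = - c2 s, l s * l' s = c1 s &
    [/\ l' s < 0, l' s < l s & lam < l s]].
Proof.
move=> cc2 cc1 c20 c10 lam0.
pose d s := c2 s * c2 s - 4 * c1 s.
have cd : continuous d.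
  move=> s; apply: cvgB; first by apply: cvgM; exact: cc2.
  by apply: cvgM; [exact: cvg_cst|exact: cc1].
pose l s := (- c2 s + Num.sqrt (d s)) / 2; pose l' s := (- c2 s - Num.sqrt (d s)) / 2.
have cl : continuous l.
  move=> s; apply: cvgM; last exact: cvg_cst.
  apply: cvgD; first by apply: cvgN; exact: cc2.
  exact: (continuous_comp (cd s) (@sqrt_continuous R (d s))).
have lsc : l sc = 0.
  by rewrite /l /d c10 mulr0 subr0 -expr2 sqrtr_sqr gtr0_norm// addrC subrr mul0r.
have [rho rho0 hrho] : exists2 rho, 0 < rho & forall s, `|s - sc| < rho ->
    [/\ 0 < c2 s, 0 < d s & lam < l s].
  apply: near_ball; near=> s; split; near: s.
  - exact: (cvgr_gt _ (cc2 sc)).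
  - by apply: (cvgr_gt _ (cd sc)); rewrite /d c10 mulr0 subr0 mulr_gt0.
  - by apply: (cvgr_gt _ (cl sc)); rewrite lsc.
exists rho, l, l'; split=> // s /hrho[h1 h2 h3].
have q0 : 0 < Num.sqrt (d s) by rewrite sqrtr_gt0.
split; [exact: cl|by rewrite /l /l'; field| |split=> //; rewrite ?/l ?/l'; lra].
have -> : l s * l' s = (c2 s * c2 s - Num.sqrt (d s) ^+ 2) / 4.
  by rewrite /l /l'; field.
by rewrite sqr_sqrtr ?(ltW h2)// /d; field.
Unshelve. all: by end_near. Qed.

End RealCrossing.

(** * Signs of the coefficients for the HTC data *)

Section Signs.
Variables (R : realType) (u0 : R).
Hypothesis straight : straight_speed u0.

Lemma speed_gt0 : 0 < u0. Proof. by case: straight. Qed.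

Lemma thrust_gt0 : 0 < tau u0.
Proof.
have [u00 e0] := straight.
have -> : tau u0 = - X_u_u_ R * u0 ^+ 2.
  by rewrite mulNr -[RHS]addr0 -e0; ring.
by rewrite mulr_gt0 ?exprn_gt0// /X_u_u_; lra.
Qed.

Lemma B21_neq0 : B21 u0 != 0.
Proof.
rewrite /B21 mulf_neq0 ?(gt_eqF speed_gt0)// lt_eqF//.
by have /andP[] := p32u_bounds R; lra.
Qed.

Lemma trace_factor_lt0 : p22u R + p33u R < 0.
Proof.
have /andP[_ ?] := p22u_bounds R; have /andP[_ ?] := p33u_bounds R; lra.
Qed.

Let mul_itv (a b x y z w : R) : 0 <= a -> 0 <= b -> a <= x <= z -> b <= y <= w ->
  a * b <= x * y <= z * w.
Proof.
move=> a0 b0 /andP[ax xz] /andP[by_ yw].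
have x0 := le_trans a0 ax; have y0 := le_trans b0 by_.
by apply/andP; split; apply: ler_pM.
Qed.

Lemma det_factor_gt0 : 0 < p23u R * p32u R - p22u R * p33u R.
Proof.
move: (p22u_bounds R) (p33u_bounds R) (p23u_bounds R) (p32u_bounds R).
move: (p22u R) (p33u R) (p23u R) (p32u R) => a b d e ha hb hd he.
have /andP[h1 _] : 4 / 10 * 5 <= - d * - e <= 5 / 10 * (51 / 10).
  by apply: mul_itv; lra.
have /andP[_ h2] : 29 / 100 * (86 / 100) <= - a * - b <= 3 / 10 * (9 / 10).
  by apply: mul_itv; lra.
lra.
Qed.

(** The lower bound yields the signs of [K02] and [char0]. The upper one is for [K10], where this
    quantity is subtracted from a product that is at least 20.7. *)
Lemma steer_factor_bounds : 17 <= p22u R * q33 R - p32u R * q23 R <= 19.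
Proof.
move: (p22u_bounds R) (q33_bounds R) (p32u_bounds R) (q23_bounds R).
move: (p22u R) (q33 R) (p32u R) (q23 R) => a b d e ha hb hd he.
have h1 : 29 / 100 * 18 <= - a * - b <= 3 / 10 * 19.
  by apply: mul_itv; lra.
have h2 : 5 * (24 / 10) <= - d * e <= 51 / 10 * (25 / 10).
  by apply: mul_itv; lra.
lra.
Qed.

Lemma q33_lt0 : q33 R < 0.
Proof. by have /andP[_ ?] := q33_bounds R; lra. Qed.

Lemma K11_gt0 : 0 < K11 u0.
Proof.
rewrite /K11; apply: mulr_gt0; last by rewrite exprn_gt0// thrust_gt0.
by rewrite exprn_even_gt0//= lt_eqF// q33_lt0.
Qed.

Lemma K10_gt0 : 0 < K10 u0.
Proof.
rewrite /K10; apply: mulr_gt0 thrust_gt0; apply: mulr_gt0 speed_gt0.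
move: (p22u_bounds R) (q33_bounds R) (p33u_bounds R) steer_factor_bounds.
move: (p22u R) (q33 R) (p33u R) (p32u R) (q23 R) => a b d e f ha hb hd hg.
have h1 : 115 / 100 * 18 <= - (a + d) * - b <= 12 / 10 * 19.
  by apply: mul_itv; lra.
lra.
Qed.

Lemma K02_gt0 : 0 < K02 u0.
Proof.
have [u00 t0] := (speed_gt0, thrust_gt0).
rewrite /K02; apply: mulr_gt0; last by rewrite exprn_gt0.
apply: mulr_gt0 => //; rewrite nmulr_rgt0 ?q33_lt0//.
by move/andP: steer_factor_bounds => []; lra.
Qed.

Lemma K00_lt0 : K00 u0 < 0.
Proof.
rewrite /K00 pmulr_llt0; last by rewrite exprn_gt0// speed_gt0.
by rewrite nmulr_rlt0 ?det_factor_gt0// trace_factor_lt0.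
Qed.

Lemma char2_gt0 er : 0 <= er -> 0 < char2 u0 er.
Proof.
move=> er0; rewrite /char2 /B11 /B22.
have -> : - (p22u R * u0 + (p33u R * u0 + q33 R * tau u0 * er)) =
  - (p22u R + p33u R) * u0 + - q33 R * (tau u0 * er) by ring.
apply: ltr_wpDr.
  apply: mulr_ge0; first by rewrite oppr_ge0 ltW// q33_lt0.
  by apply: mulr_ge0 => //; exact: ltW thrust_gt0.
by apply: mulr_gt0 speed_gt0; rewrite oppr_gt0 trace_factor_lt0.
Qed.

Lemma char0E ep : char0 u0 ep = (p22u R * q33 R - p32u R * q23 R) * (u0 * tau u0) * ep.
Proof. by rewrite /char0 /B11 /B23 /B13 /B21; ring. Qed.

Let char0_factor : 0 < (p22u R * q33 R - p32u R * q23 R) * (u0 * tau u0).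
Proof.
apply: mulr_gt0; last exact: mulr_gt0 speed_gt0 thrust_gt0.
by move/andP: steer_factor_bounds => []; lra.
Qed.

Lemma char0_ge0 ep : 0 <= ep -> 0 <= char0 u0 ep.
Proof. by move=> ep0; rewrite char0E; apply: mulr_ge0 => //; exact: ltW char0_factor. Qed.

Lemma char0_gt0 ep : 0 < ep -> 0 < char0 u0 ep.
Proof. by move=> ep0; rewrite char0E; exact: mulr_gt0 char0_factor _. Qed.

(* The Routh-Hurwitz determinant is linear in [ep]; its zero set is the curve. *)
Lemma routh_hurwitzE er ep : char2 u0 er * char1 u0 er ep - char0 u0 ep =
  (K11 u0 * er + K10 u0) * ep + (K02 u0 * er ^+ 2 + K01 u0 * er + K00 u0).
Proof.
rewrite /char2 /char1 /char0 /B11 /B12 /B13 /B21 /B22 /B23.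
by rewrite /K11 /K10 /K02 /K01 /K00; ring.
Qed.

Lemma schwarz2E er ep : 0 <= er -> schwarz2 u0 er ep =
  (char2 u0 er * char1 u0 er ep - char0 u0 ep) / char2 u0 er.
Proof.
move=> er0; have c20 : char2 u0 er != 0 by rewrite gt_eqF// char2_gt0.
by apply: (mulIf c20); rewrite /schwarz2 /schwarz3 mulrBl !divfK// mulrC.
Qed.

(** The derivative of the propeller polynomial is bounded by a combination of squares, uniformly in
    its argument, so that no enclosure of [u0] enters. *)
Lemma lam_u_lt0 : lam_u u0 < 0.
Proof.
have u00 := speed_gt0.
rewrite /lam_u pmulr_llt0 ?invr_gt0 ?surge_mass_gt0//.
have : 2 * X_u_u_ R * u0 < 0 by rewrite pmulr_llt0// /X_u_u_; lra.
suff : derive1 (@tau R) u0 < 0 by lra.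
have Dp0 : 0 < D_p R by apply: divr_gt0; rewrite ?/D_p_bar ?/L_pp; lra.
have [a [aE a0]] : exists a : R, a = (1 - w_wake R) / D_p R /\ 0 < a.
  eexists; split; first by []; apply: divr_gt0 Dp0; rewrite /w_wake; lra.
have [k [kE k0]] : exists k : R,
    k = 2 * (1 - t_ded R) * (L_pp R / T_draft R) * D_p R ^+ 4 /\ 0 < k.
  eexists; split; first by []; apply: mulr_gt0; last exact: exprn_gt0.
  by apply: mulr_gt0; [|apply: divr_gt0];
    rewrite ?/t_ded ?/L_pp ?/T_draft; lra.
have Dpow n (t : R) : is_derive t 1 (fun s => (a * s) ^+ n.+1) (n.+1%:R * (a * t) ^+ n * a).
  elim: n => [|n IH].
    have := is_derive_mulcf a (@is_derive_id _ _ t 1).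
    by move=> /is_derive_eq; apply; rewrite expr0 !mulr1 mul1r.
  under eq_fun do rewrite exprS.
  apply: (is_derive_eq (is_derive_mulf (is_derive_mulcf a (@is_derive_id _ _ t 1)) IH)).
  by rewrite -[n.+2]addn1 natrD exprS; ring.
have tau_sum : @tau R = fun u => k * (K_T R (inord 0) + K_T R (inord 1) * (a * u) ^+ 1
    + K_T R (inord 2) * (a * u) ^+ 2 + K_T R (inord 3) * (a * u) ^+ 3
    + K_T R (inord 4) * (a * u) ^+ 4 + K_T R (inord 5) * (a * u) ^+ 5).
  apply/funext => u; rewrite /tau -kE -aE; congr (_ * _).
  under eq_bigr do rewrite -[X in K_T R X]inord_val.
  by rewrite !big_ord_recr big_ord0 /= add0r expr0 mulr1.
have Dtau (t : R) : is_derive t 1 (@tau R) (k * (0 + K_T R (inord 1) * (1%:R * (a * t) ^+ 0 * a)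
    + K_T R (inord 2) * (2%:R * (a * t) ^+ 1 * a) + K_T R (inord 3) * (3%:R * (a * t) ^+ 2 * a)
    + K_T R (inord 4) * (4%:R * (a * t) ^+ 3 * a) + K_T R (inord 5) * (5%:R * (a * t) ^+ 4 * a))).
  rewrite tau_sum; have P i n := is_derive_mulcf (K_T R (inord i)) (Dpow n t).
  exact: (is_derive_mulcf k (is_derive_addf (is_derive_addf (is_derive_addf
    (is_derive_addf (is_derive_addf (@is_derive_cst _ _ _ (K_T R (inord 0)) t 1)
    (P 1%N 0%N)) (P 2 1%N)) (P 3 2)) (P 4 3)) (P 5 4))).
have [_] := Dtau u0; rewrite derive1E => ->.
have K1 : K_T R (inord 1) = - (345 / 10 ^+ 3 + 36 / 10 ^+ 6) by rewrite /K_T inordK.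
have K2 : K_T R (inord 2) = 68 / 10 ^+ 3 + 841 / 10 ^+ 6 by rewrite /K_T inordK.
have K3 : K_T R (inord 3) = - (710 / 10 ^+ 3 + 991 / 10 ^+ 6) by rewrite /K_T inordK.
have K4 : K_T R (inord 4) = 948 / 10 ^+ 3 + 559 / 10 ^+ 6 by rewrite /K_T inordK.
have K5 : K_T R (inord 5) = - (428 / 10 ^+ 3 + 915 / 10 ^+ 6) by rewrite /K_T inordK.
move: (K_T R (inord 1)) (K_T R (inord 2)) (K_T R (inord 3)) (K_T R (inord 4))
  (K_T R (inord 5)) K1 K2 K3 K4 K5 => k1 k2 k3 k4 k5 K1 K2 K3 K4 K5.
have [x xE] : exists x, x = a * u0 by eexists.
rewrite (pmulr_rlt0 _ k0) -xE.
have -> : 0 + k1 * (1 * x ^+ 0 * a) + k2 * (2 * x ^+ 1 * a) + k3 * (3 * x ^+ 2 * a)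
   + k4 * (4 * x ^+ 3 * a) + k5 * (5 * x ^+ 4 * a) =
   a * (k1 + 2 * k2 * x + 3 * k3 * x ^+ 2 + 4 * k4 * x ^+ 3 + 5 * k5 * x ^+ 4) by ring.
rewrite (pmulr_rlt0 _ a0).
(* [h1] and [h4] absorb the cubic term, [h2] and [h5] the linear one. *)
have h1 : 0 <= (x * (x - 885 / 1000)) ^+ 2 by exact: sqr_ge0.
have h2 : 0 <= (x - 1 / 10) ^+ 2 by exact: sqr_ge0.
have h5 : 0 <= (x - 2 / 10) ^+ 2 by exact: sqr_ge0.
have h3 : 0 <= x ^+ 2 by exact: sqr_ge0.
have h4 : 0 <= (x * (x - 880 / 1000)) ^+ 2 by exact: sqr_ge0.
rewrite K1 K2 K3 K4 K5; lra.
Qed.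

End Signs.

(** * The ray of control gains *)

Lemma continuous_quadratic (R : realType) (a b c : R) :
  continuous (fun s : R => a * s ^+ 2 + b * s + c).
Proof.
have -> : (fun s : R => a * s ^+ 2 + b * s + c) =
    horner (a%:P * 'X ^+ 2 + b%:P * 'X + c%:P).
  by apply/funext => s; rewrite !hornerE.
exact: continuous_horner.
Qed.

Section Ray.
Variables (R : realType) (c : free_coeffs R) (u0 er ep : R).
Hypothesis straight : straight_speed u0.
Hypothesis er_ge0 : 0 <= er.
Hypothesis ep_ge0 : 0 <= ep.
Implicit Types s : R.

Let c2 s := char2 u0 (s * er).
Let c1 s := char1 u0 (s * er) (s * ep).
Let c0 s := char0 u0 (s * ep).
Let h s := c2 s * c1 s - c0 s.
Let den s := K11 u0 * (s * er) + K10 u0.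

Let c2_cont : continuous c2.
Proof.
have -> : c2 = fun s => 0 * s ^+ 2 + - (q33 R * tau u0 * er) * s
    + - (p22u R * u0 + p33u R * u0).
  by apply/funext => s; rewrite /c2 /char2 /B11 /B22; ring.
exact: continuous_quadratic.
Qed.

Let c1_cont : continuous c1.
Proof.
have -> : c1 = fun s => 0 * s ^+ 2 + (B11 u0 * (q33 R * tau u0 * er)
    - q23 R * tau u0 * er * B21 u0 - q33 R * tau u0 * ep) * s
    + (B11 u0 * (p33u R * u0) - p23u R * u0 * B21 u0).
  by apply/funext => s; rewrite /c1 /char1 /B22 /B12 /B23; ring.
exact: continuous_quadratic.
Qed.

Let hE s : h s = (K11 u0 * er * ep + K02 u0 * er ^+ 2) * s ^+ 2
  + (K10 u0 * ep + K01 u0 * er) * s + K00 u0.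
Proof. by rewrite /h /c2 /c1 /c0 routh_hurwitzE; ring. Qed.

Let h_cont : continuous h.
Proof.
by have -> := funext hE; exact: continuous_quadratic.
Qed.

Let c2_gt0 s : 0 <= s -> 0 < c2 s.
Proof. by move=> s0; apply: char2_gt0 => //; exact: mulr_ge0. Qed.

Let den_gt0 s : 0 <= s -> 0 < den s.
Proof.
move=> s0; apply: ltr_wpDl (K10_gt0 straight).
by apply: mulr_ge0; [exact: ltW (K11_gt0 straight)|exact: mulr_ge0].
Qed.

Lemma ray_crossing : ~ (er = 0 /\ ep = 0) -> exists2 sc, 0 < sc &
  forall s, 0 <= s -> Num.sg (h s) = Num.sg (s - sc).
Proof.
move=> nz.
have := hE; move: (K11_gt0 straight) (K02_gt0 straight) (K10_gt0 straight).
move: (K00 u0) (K00_lt0 straight) (K11 u0) (K02 u0) (K10 u0) (K01 u0).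
move=> k00 k000 k11 k02 k10 k01 k110 k020 k100 hE'.
have p0 : 0 <= k11 * er * ep by rewrite !mulr_ge0// ltW.
have p1 : 0 <= k02 * er ^+ 2 by rewrite mulr_ge0 ?sqr_ge0// ltW.
have [|||sc sc0 hsc] := @quadratic_sign_change R (k11 * er * ep + k02 * er ^+ 2)
  (k10 * ep + k01 * er) k00 => //.
- exact: addr_ge0.
(* The leading coefficient vanishes only for [er = 0]; then [ep > 0] and the linear coefficient is
   [K10 * ep > 0]. *)
- move=> /eqP; rewrite paddr_eq0// => /andP[_].
  rewrite mulf_eq0 gt_eqF//= sqrf_eq0 => /eqP er_0.
  rewrite er_0 mulr0 addr0 mulr_gt0// lt_neqAle ep_ge0 andbT eq_sym.
  by apply/negP => /eqP ep_0; apply: nz.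
by exists sc => // s s0; rewrite hE' hsc.
Qed.

Let above_curve s : 0 <= s -> s * ep - eps_psi u0 (s * er) = h s / den s.
Proof.
move=> s0; have d0 : den s != 0 by rewrite gt_eqF// den_gt0.
rewrite /h /c2 /c1 /c0 routh_hurwitzE /eps_psi -/(den s) opprK.
have gen (d x y : R) : d != 0 -> x + y / d = (d * x + y) / d by move=> ?; field.
exact: gen.
Qed.

Lemma sg_above_curve s : 0 <= s ->
  Num.sg (s * ep - eps_psi u0 (s * er)) = Num.sg (h s).
Proof.
move=> s0; rewrite above_curve// sgrM [X in _ * X]gtr0_sg ?mulr1//.
by rewrite invr_gt0 den_gt0.
Qed.

Lemma on_curveP s : 0 <= s -> on_curve u0 (s * er) (s * ep) <-> h s = 0.
Proof.
move=> s0; have d0 : den s != 0 by rewrite gt_eqF// den_gt0.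
split=> [[_ E]|h0].
  have := above_curve s0; rewrite {1}E subrr => /esym/eqP.
  by rewrite mulf_eq0 invr_eq0 (negPf d0) orbF => /eqP.
split=> //; apply/eqP; rewrite -subr_eq0 above_curve// h0 mul0r//.
Qed.

Lemma stabilizedP s : 0 <= s -> stabilized c u0 (s * er) (s * ep) <-> 0 < h s.
Proof.
move=> s0.
have ser := mulr_ge0 s0 er_ge0; have sep := mulr_ge0 s0 ep_ge0.
have c20 := char2_gt0 straight ser.
have s2E := schwarz2E straight (s * ep) ser.
split=> [st|h0].
  rewrite ltNge; apply/negP => h0; apply: not_stabilized st => //.
  - exact: B21_neq0.
  - by rewrite s2E pmulr_lle0// invr_gt0.
  - by apply: mulr_ge0; [exact: char0_ge0|rewrite invr_ge0 ltW].
apply: stabilized_of_hurwitz => //.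
- exact: lam_u_lt0.
- exact: B21_neq0.
- by rewrite s2E; apply: divr_gt0.
- move=> nz; apply: divr_gt0 => //; apply: char0_gt0 => //.
  by rewrite lt_neqAle eq_sym nz.
Qed.

Lemma pair_crossing sc : 0 < ep -> 0 < sc ->
  (forall s, 0 <= s -> Num.sg (h s) = Num.sg (s - sc)) ->
  exists (rho : R) (a b : R -> R), [/\ 0 < rho, traverses_zero a sc rho &
    forall s, `|s - sc| < rho ->
    [/\ {for s, continuous b}, 0 < b s,
      A_eigenvalue u0 (s * er) (s * ep) (a s +i* b s)%C,
      A_eigenvalue u0 (s * er) (s * ep) (a s -i* b s)%C &
      forall z, A_eigenvalue u0 (s * er) (s * ep) z ->
        [\/ z = (a s +i* b s)%C, z = (a s -i* b s)%C | complex.Re z < 0]]].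
Proof.
move=> ep_gt0 sc0 hsc.
have hsc0 : h sc = 0.
  by apply/eqP; rewrite -sgr_eq0 hsc ?ltW// subrr sgr0.
have c2sc := c2_gt0 (ltW sc0).
(* At the crossing [c2 * c1 = c0], which is positive as [ep > 0]; so the pair meets the axis away
   from 0. *)
have c1sc : 0 < c1 sc.
  rewrite -(pmulr_rgt0 _ c2sc); have -> : c2 sc * c1 sc = c0 sc.
    by apply/eqP; rewrite -subr_eq0 -/(h sc) hsc0.
  by apply: char0_gt0 => //; exact: mulr_gt0.
have [rho' [y [rho'0 hy]]] := crossing_pair c2_cont c1_cont h_cont c2sc c1sc hsc0.
(* By Vieta with real part [- y / 2], the third root is [y - c2 < 0] and [d] is the squared
   imaginary part. *)
pose d s := c1 s + y s * (y s - c2 s) - y s ^+ 2 / 4.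
pose a s := - (1 / 2) * y s; pose b s := Num.sqrt (d s).
(* The radius is capped by [sc], so that the window stays in [s >= 0], where the sign information
   holds. *)
have s_ge0 s : `|s - sc| < Num.min rho' sc -> `|s - sc| < rho' /\ 0 <= s.
  rewrite lt_min => /andP[-> ssc]; split=> //.
  by move: ssc; rewrite ltr_norml => /andP[]; lra.
exists (Num.min rho' sc), a, b; split; first by rewrite lt_min rho'0.
  move=> s /s_ge0[srho s0]; have [cy yE c1s _ _] := hy s srho.
  split; first by apply: cvgM => //; exact: cvg_cst.
  rewrite sgrM ltr0_sg; last by lra.
  rewrite mulN1r -[sc - s]opprB sgrN -hsc// -yE sgrM.
  by rewrite [X in _ = - (_ * X)]gtr0_sg ?mulr1// ltr_wpDl ?sqr_ge0.
move=> s /s_ge0[srho s0]; have [cy yE c1s ylt d0] := hy s srho.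
have b2 : b s ^+ 2 = d s by rewrite sqr_sqrtr// ltW.
have eig := @A_eigenvalue_pair R u0 (s * er) (s * ep) (y s - c2 s) (a s) (b s).
have {}eig : forall z, A_eigenvalue u0 (s * er) (s * ep) z =
    [|| z == (a s +i* b s)%C, z == (a s -i* b s)%C,
      z == (lam_u u0)%:C%C | z == (y s - c2 s)%:C%C].
  apply: eig; rewrite ?b2 -/(c2 s) -/(c1 s) -/(c0 s) /d /a; first by field.
    by field.
  have -> : c0 s = c2 s * c1 s - h s by rewrite /h; ring.
  by rewrite -yE; field.
split.
- have cd : {for s, continuous d}.
    apply: cvgB; last first.
      by apply: cvgM; [apply: cvgM; exact: cy|exact: cvg_cst].
    apply: cvgD; first exact: c1_cont.
    by apply: cvgM => //; apply: cvgB => //; exact: c2_cont.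
  exact: (continuous_comp cd (@sqrt_continuous R (d s))).
- by rewrite sqrtr_gt0.
- by rewrite eig eqxx.
- by rewrite eig eqxx orbT.
move=> z; rewrite eig => /or4P[]/eqP->; [exact: Or31|exact: Or32| |].
- by apply: Or33; exact: lam_u_lt0.
- by apply: Or33; rewrite /= subr_lt0.
Qed.

(** The shift symmetry in psi makes [char0] vanish: the cubic has the root 0, the other two belong
    to a quadratic, and the Routh-Hurwitz determinant reduces to [c2 * c1], whose sign is that of
    their product. *)
Lemma real_crossing sc : ep = 0 -> 0 < sc ->
  (forall s, 0 <= s -> Num.sg (h s) = Num.sg (s - sc)) ->
  (forall s, 0 <= s -> A_eigenvalue u0 (s * er) (s * ep) 0) /\
  exists (rho : R) (l : R -> R), [/\ 0 < rho, traverses_zero l sc rho &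
    forall s, `|s - sc| < rho ->
    [/\ A_eigenvalue u0 (s * er) (s * ep) (l s)%:C%C,
      mup (l s) (char_poly (S_mx u0 (s * er) (s * ep))) = 1%N &
      forall z, A_eigenvalue u0 (s * er) (s * ep) z ->
        [\/ z = 0, z = (l s)%:C%C | complex.Re z < 0]]].
Proof.
move=> ep_0 sc0 hsc.
have c0_0 s : c0 s = 0 by rewrite /c0 ep_0 char0E !mulr0.
have hM s : h s = c2 s * c1 s by rewrite /h c0_0 subr0.
split=> [s s0|].
  rewrite A_eigenvalueE -/(c0 s) c0_0.
  by rewrite !expr0n/= !mulr0 !add0r mulr0.
have lam0 := lam_u_lt0 straight.
have c2sc := c2_gt0 (ltW sc0).
have c1sc : c1 sc = 0.
  have /eqP : h sc = 0 by apply/eqP; rewrite -sgr_eq0 hsc ?ltW// subrr sgr0.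
  by rewrite hM mulf_eq0 gt_eqF//= => /eqP.
have [rho' [l [l' [rho'0 hl]]]] := crossing_real c2_cont c1_cont c2sc c1sc lam0.
have s_ge0 s : `|s - sc| < Num.min rho' sc -> `|s - sc| < rho' /\ 0 <= s.
  rewrite lt_min => /andP[-> ssc]; split=> //.
  by move: ssc; rewrite ltr_norml => /andP[]; lra.
exists (Num.min rho' sc), l; split; first by rewrite lt_min rho'0.
  move=> s /s_ge0[srho s0]; have [cl lS lP [l'0 _ _]] := hl s srho.
  split=> //; rewrite -[sc - s]opprB sgrN -hsc// hM sgrM (gtr0_sg (c2_gt0 s0)) mul1r.
  by rewrite -lP sgrM (ltr0_sg l'0) mulrN1 opprK.
move=> s /s_ge0[srho s0]; have [cl lS lP [l'0 l'l laml]] := hl s srho.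
have eig z : A_eigenvalue u0 (s * er) (s * ep) z =
    [|| z == (lam_u u0)%:C%C, z == 0, z == (l s)%:C%C | z == (l' s)%:C%C].
  rewrite A_eigenvalueE -/(c2 s) -/(c1 s) -/(c0 s) c0_0 -lP.
  have -> : c2 s = - (l s + l' s) by rewrite lS opprK.
  rewrite !(rmorphN, rmorphD, rmorphM) /= rmorph0.
  have -> : z ^+ 3 + - ((l s)%:C%C + (l' s)%:C%C) * z ^+ 2 + (l s)%:C%C * (l' s)%:C%C * z + 0 =
    z * ((z - (l s)%:C%C) * (z - (l' s)%:C%C)) by ring.
  by rewrite !mulf_eq0 !subr_eq0.
split.
- by rewrite eig eqxx !orbT.
- have -> : char_poly (S_mx u0 (s * er) (s * ep)) =
      ('X - (lam_u u0)%:P) * (('X - (l s)%:P) * ('X - (l' s)%:P)).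
    rewrite char_poly_S; congr (_ * _); rewrite -/(c2 s).
    have -> : B11 u0 * B22 u0 (s * er) - B12 u0 (s * er) * B21 u0 = c1 s.
      by rewrite /c1 /char1 /B23 ep_0 !mulr0 subr0.
    have -> : c2 s = - (l s + l' s) by rewrite lS opprK.
    rewrite -lP polyCN polyCD polyCM; ring.
  rewrite mupMr ?root_XsubC ?gt_eqF// mupMl ?root_XsubC ?gt_eqF//.
  by rewrite -['X - _]expr1 mup_XsubCX eqxx.
move=> z; rewrite eig => /or4P[]/eqP->; [|exact: Or31|exact: Or32|].
- by apply: Or33.
- by apply: Or33.
Qed.

End Ray.

Theorem theorem3p1 (R : realType) (c : free_coeffs R) (u0 er ep : R) :
  straight_speed u0 -> 0 <= er -> 0 <= ep -> ~ (er = 0 /\ ep = 0) ->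
  exists sc : R,
    [/\ (* the ray meets the curve exactly at s = sc > 0 ... *)
        0 < sc /\
        (forall s, 0 < s -> (on_curve u0 (s * er) (s * ep) <-> s = sc)),
        (* ... and passes there from below the curve to above it *)
        (forall s, 0 <= s ->
          Num.sg (s * ep - eps_psi u0 (s * er)) = Num.sg (s - sc)),
        (forall s, 0 <= s -> (stabilized c u0 (s * er) (s * ep) <-> sc < s)),
        (0 < ep ->
          exists (rho : R) (a b : R -> R),
            [/\ 0 < rho, traverses_zero a sc rho &
                forall s, `|s - sc| < rho ->
                  [/\ {for s, continuous b}, 0 < b s,
                      A_eigenvalue u0 (s * er) (s * ep) (a s +i* b s)%C,
                      A_eigenvalue u0 (s * er) (s * ep) (a s -i* b s)%C &
                      forall z, A_eigenvalue u0 (s * er) (s * ep) z ->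
                        [\/ z = (a s +i* b s)%C, z = (a s -i* b s)%C
                          | complex.Re z < 0]]]) &
        (ep = 0 ->
          (forall s, 0 <= s -> A_eigenvalue u0 (s * er) (s * ep) 0) /\
          exists (rho : R) (l : R -> R),
            [/\ 0 < rho, traverses_zero l sc rho &
                forall s, `|s - sc| < rho ->
                  [/\ A_eigenvalue u0 (s * er) (s * ep) (l s)%:C%C,
                      mup (l s) (char_poly (S_mx u0 (s * er) (s * ep))) = 1%N &
                      forall z, A_eigenvalue u0 (s * er) (s * ep) z ->
                        [\/ z = 0, z = (l s)%:C%C | complex.Re z < 0]]])].
Proof.
move=> straight er0 ep0 nz.
have [sc sc0 hsc] := ray_crossing straight er0 ep0 nz.
exists sc; split.
- split=> // s s0; split=> [/(on_curveP ep straight er0 (ltW s0)) h0|->].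
    move/eqP: (hsc s (ltW s0)); rewrite h0 sgr0 eq_sym sgr_eq0 subr_eq0.
    by move/eqP.
  apply/(on_curveP ep straight er0 (ltW sc0))/eqP.
  by rewrite -sgr_eq0 hsc ?(ltW sc0)// subrr sgr0.
- by move=> s s0; rewrite (sg_above_curve ep straight er0)// hsc.
- move=> s s0; split.
    move/(stabilizedP c straight er0 ep0 s0).
    by rewrite -sgr_gt0 hsc// sgr_gt0 subr_gt0.
  move=> scs; apply/(stabilizedP c straight er0 ep0 s0).
  by rewrite -sgr_gt0 hsc// sgr_gt0 subr_gt0.
- by move=> ep_gt0; exact: pair_crossing.
- by move=> ep_0; exact: real_crossing.
Qed.
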